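(* Let $\sigma\in\{-1,1\}$. If $\omega_L,\omega_R>0$ and $\xi\in\widehat{\mathcal X}$ is such that $\sum_{x\in V}\xi(x)\ge2$, then, for all $\theta_L,\theta_R\in\Theta$ with $\theta_L\neq\theta_R$ and all $t>0$, $$\frac{d}{dt}\,\mathbb E_{\mu_{\bar{\boldsymbol\theta}}}\left[D^{c\ell}(\xi,\eta_t)\right]\ \begin{cases}<0&\text{if }\sigma=-1\\ >0&\text{if }\sigma=1.\end{cases}$$ As a consequence, for all $x,y\in V$ with $x\neq y$, $$\mathbb E_{\mu_{\theta_L,\theta_R}}\left[\left(\frac{\eta(x)}{\alpha_x}-\bar\theta_x\right)\left(\frac{\eta(y)}{\alpha_y}-\bar\theta_y\right)\right]\ \begin{cases}<0&\text{if }\sigma=-1\\ >0&\text{if }\sigma=1.\end{cases}$$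
   Context: Setting. $\mathbb N=\{1,2,\dots\}$, $\mathbb N_0=\mathbb N\cup\{0\}$. Let $N\in\mathbb N$, $V=\{1,\dots,N\}$. Symmetric conductances $\omega_{\{x,y\}}\in[0,\infty)$, $x,y\in V$, with $\omega_{\{x,x\}}=0$; write $x\sim y$ if $\omega_{\{x,y\}}\neq0$ and assume the graph $(V,\sim)$ is connected. Site parameters $\alpha_x\in\mathbb N$. Boundary parameters $\omega_L,\omega_R\ge 0$, $\alpha_L,\alpha_R>0$. $\Theta=[0,1]$ if $\sigma=-1$ and $\Theta=[0,\infty)$ if $\sigma\in\{0,1\}$; $\theta_L,\theta_R\in\Theta$. Convention $0^0=1$. Boundary driven process. $\mathcal X=\prod_{x\in V}\{0,\dots,\alpha_x\}$ if $\sigma=-1$, $\mathcal X=\mathbb N_0^V$ otherwise. $\{\eta_t\}$ is the Markov process on $\mathcal X$ with generator $\mathcal L=\sum_{\{x,y\}:x\sim y}\omega_{\{x,y\}}\mathcal L_{\{x,y\}}+\omega_L\mathcal L_L+\omega_R\mathcal L_R$ (sum over unordered pairs), where $\mathcal L_{\{x,y\}}f(\eta)=\eta(x)(\alpha_y+\sigma\eta(y))(f(\eta-\delta_x+\delta_y)-f(\eta))+\eta(y)(\alpha_x+\sigma\eta(x))(f(\eta-\delta_y+\delta_x)-f(\eta))$, $\mathcal L_Lf(\eta)=\eta(1)\alpha_L(1+\sigma\theta_L)(f(\eta-\delta_1)-f(\eta))+\alpha_L\theta_L(\alpha_1+\sigma\eta(1))(f(\eta+\delta_1)-f(\eta))$,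 $\mathcal L_Rf(\eta)=\eta(N)\alpha_R(1+\sigma\theta_R)(f(\eta-\delta_N)-f(\eta))+\alpha_R\theta_R(\alpha_N+\sigma\eta(N))(f(\eta+\delta_N)-f(\eta))$. $\mathbb E_\mu[f(\eta_t)]$ is expectation for the process started from law $\mu$; $\mathbb E_\mu[f(\eta)]=\sum_\eta f(\eta)\mu(\eta)$. For $\omega_L\vee\omega_R>0$, the process has a unique stationary measure, denoted $\mu_{\theta_L,\theta_R}$. Dual configurations and classical duality functions. $\widehat{\mathcal X}=\mathcal X\times\mathbb N_0^{\{L,R\}}$. For $\xi\in\widehat{\mathcal X}$, $\eta\in\mathcal X$: $D^{c\ell}(\xi,\eta)=(\theta_L)^{\xi(L)}\left(\prod_{x\in V}d^{c\ell}_x(\xi(x),\eta(x))\right)(\theta_R)^{\xi(R)}$, with $d^{c\ell}_x(k,n)=\frac{n!}{(n-k)!}\frac1{w_x(k)}\mathbf 1_{\{k\le n\}}$, and $w_x(k)=\frac{\alpha_x!}{(\alpha_x-k)!}$ (for $k\le\alpha_x$) if $\sigma=-1$, $w_x(k)=\alpha_x^k$ if $\sigma=0$, $w_x(k)=\frac{\Gamma(\alpha_x+k)}{\Gamma(\alpha_x)}$ if $\sigma=1$. Profile: $\bar\theta_x:=\mathbb E_{\mu_{\theta_L,\theta_R}}[\eta(x)/\alpha_x]$, equivalently $\bar\theta_x=\theta_R+\widehat p_\infty(\delta_x,\delta_L)(\theta_L-\theta_R)$, where $\widehat p_\infty(\delta_x,\delta_L)$ is the probability that the continuous-time random walk on $V\cup\{L,R\}$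 started at $x$, jumping from $y\in V$ to $z\in V$ at rate $\omega_{\{y,z\}}\alpha_z$, from $1$ to $L$ at rate $\omega_L\alpha_L$, from $N$ to $R$ at rate $\omega_R\alpha_R$, and absorbed at $L,R$, is eventually absorbed at $L$. Local equilibrium product measure: $\mu_{\bar{\boldsymbol\theta}}=\otimes_{x\in V}\nu_{x,\bar\theta_x}$, where $\nu_{x,\theta}$ is Binomial$(\alpha_x,\theta)$ if $\sigma=-1$, Poisson$(\alpha_x\theta)$ if $\sigma=0$, and if $\sigma=1$ the Negative-Binomial law $\nu_{x,\theta}(n)=\frac{\Gamma(\alpha_x+n)}{\Gamma(\alpha_x)\,n!}\left(\frac{\theta}{1+\theta}\right)^n(1+\theta)^{-\alpha_x}$.
   Formalization: The first claim is proved for N ≥ 2, with ξ(L)=0 whenever θ_L=0 and ξ(R)=0 whenever θ_R=0; in the excluded cases the derivative is identically 0 (for N=1 the product measure is stationary; otherwise D^{cℓ}(ξ,·)=0), so the strict inequality fails. *)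

(* Defs.v *)
From HB Require Import structures.
From mathcomp Require Import all_boot all_order all_algebra.
From mathcomp Require Import all_classical all_reals all_analysis.

Set Implicit Arguments.
Unset Strict Implicit.
Unset Printing Implicit Defensive.

Import Order.TTheory GRing.Theory Num.Theory.
Import numFieldNormedType.Exports.

Local Open Scope classical_set_scope.
Local Open Scope ring_scope.

(* [V = 'I_n.+1], that is N = n + 1; the sites 1 and N are [ord0] and
   [ord_max]. *)
Record bd_system (R : realType) (n : nat) := BDSystem {
  sigma : int;
  omega : 'I_n.+1 -> 'I_n.+1 -> R;
  alpha : 'I_n.+1 -> nat;
  omegaL : R;
  omegaR : R;
  alphaL : R;
  alphaR : R;
  thetaL : R;
  thetaR : R }.

Definition in_Theta (R : realType) (sg : int) (theta : R) : Prop :=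
  0 <= theta /\ (sg = -1 -> theta <= 1).

Record bd_system_ok (R : realType) (n : nat) (S : bd_system R n) : Prop := {
  sigma_ok : sigma S = -1 \/ sigma S = 0 \/ sigma S = 1;
  omega_ge0 : forall x y, 0 <= omega S x y;
  omega_sym : forall x y, omega S x y = omega S y x;
  omega_diag : forall x, omega S x x = 0;
  omega_connected : forall x y, connect [rel u v | omega S u v != 0] x y;
  alpha_gt0 : forall x, (0 < alpha S x)%N;
  omegaL_ge0 : 0 <= omegaL S;
  omegaR_ge0 : 0 <= omegaR S;
  alphaL_gt0 : 0 < alphaL S;
  alphaR_gt0 : 0 < alphaR S;
  thetaL_ok : in_Theta (sigma S) (thetaL S);
  thetaR_ok : in_Theta (sigma S) (thetaR S) }.

Notation conf n := {ffun 'I_n.+1 -> nat}.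

Section BoundaryDriven.
Variables (R : realType) (n : nat) (S : bd_system R n).

Local Notation V := 'I_n.+1.
Local Notation sg := ((sigma S)%:~R : R).
Local Notation al x := ((alpha S x)%:R : R).

(* The state space, as a subset of N_0^V. *)
Definition states : set (conf n) :=
  [set eta | sigma S = -1 -> forall x, (eta x <= alpha S x)%N].

Definition incr (x : V) (eta : conf n) : conf n :=
  [ffun z => eta z + (z == x)]%N.

(* Truncated at 0; below, it always comes with the factor [eta x]. *)
Definition decr (x : V) (eta : conf n) : conf n :=
  [ffun z => eta z - (z == x)]%N.

(* The generator acts on functions on all of N_0^V: for [eta] in [states], the
   moves that leave [states] have rate 0. *)
Definition gen_edge (x y : V) (f : conf n -> R) (eta : conf n) : R :=
  (eta x)%:R * (al y + sg * (eta y)%:R) * (f (incr y (decr x eta)) - f eta)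
  + (eta y)%:R * (al x + sg * (eta x)%:R) * (f (incr x (decr y eta)) - f eta).

Definition gen_boundary (b : V) (a theta : R) (f : conf n -> R) (eta : conf n)
    : R :=
  (eta b)%:R * a * (1 + sg * theta) * (f (decr b eta) - f eta)
  + a * theta * (al b + sg * (eta b)%:R) * (f (incr b eta) - f eta).

Definition generator (f : conf n -> R) (eta : conf n) : R :=
  \sum_(x : V) \sum_(y : V | (x < y)%N && (omega S x y != 0))
     omega S x y * gen_edge x y f eta
  + omegaL S * gen_boundary ord0 (alphaL S) (thetaL S) f eta
  + omegaR S * gen_boundary ord_max (alphaR S) (thetaR S) f eta.

(* [p t eta zeta] is the probability that the process started from [eta] is in
   [zeta] at time [t]; only t >= 0 and configurations in [states] matter. *)
Record is_markov_process (p : R -> conf n -> conf n -> R) : Prop := {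
  trans_ge0 : forall (t : R) eta zeta, 0 <= t -> states eta -> states zeta ->
    0 <= p t eta zeta;
  trans_sum1 : forall (t : R) eta, 0 <= t -> states eta ->
    (\esum_(zeta in states) (p t eta zeta)%:E = 1)%E;
  trans_0 : forall eta zeta, states eta -> states zeta ->
    p 0 eta zeta = (eta == zeta)%:R;
  trans_cvg0 : forall eta zeta, states eta -> states zeta ->
    p t eta zeta @[t --> 0^'+] --> p 0 eta zeta;
  trans_Chapman_Kolmogorov : forall (s t : R) eta zeta, 0 <= s -> 0 <= t ->
    states eta -> states zeta ->
    (\esum_(z in states) (p s eta z * p t z zeta)%:E
       = (p (s + t) eta zeta)%:E)%E;
  (* d/dt P_t = L P_t *)
  trans_generator : forall (t : R) eta zeta, 0 < t -> states eta -> states zeta ->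
    is_derive t 1 (fun s => p s eta zeta) (generator (p t ^~ zeta) eta) }.

Definition is_pmf (mu : conf n -> R) : Prop :=
  (forall eta, states eta -> 0 <= mu eta)
  /\ (\esum_(eta in states) (mu eta)%:E = 1)%E.

Definition integrable_pmf (mu f : conf n -> R) : Prop :=
  summable states (fun eta => (f eta * mu eta)%:E).

(* The sum of [f eta * mu eta] over [states]; [\esum] is meant for nonnegative
   terms, hence the two parts. Meaningful under [integrable_pmf mu f]. *)
Definition expect (mu f : conf n -> R) : R :=
  let g eta := f eta * mu eta in
  fine (\esum_(eta in states) (g^\+ eta)%:E)
  - fine (\esum_(eta in states) (g^\- eta)%:E).

Definition law_at (p : R -> conf n -> conf n -> R) (mu : conf n -> R) (t : R)
    (zeta : conf n) : R :=
  fine (\esum_(eta in states) (mu eta * p t eta zeta)%:E)%E.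

Definition is_stationary (p : R -> conf n -> conf n -> R) (mu : conf n -> R)
    : Prop :=
  is_pmf mu /\
  forall (t : R) zeta, 0 <= t -> states zeta -> law_at p mu t zeta = mu zeta.

Record dual_conf := DualConf {
  dual_bulk : conf n;
  dual_L : nat;
  dual_R : nat }.

Definition dual_states : set dual_conf := [set xi | states (dual_bulk xi)].

(* As [alpha x] is a positive integer, the quotient
   Gamma(alpha x + k) / Gamma(alpha x) is one of factorials. *)
Definition weight (x : V) (k : nat) : R :=
  if sigma S == -1 then (alpha S x ^_ k)%:R
  else if sigma S == 0 then al x ^+ k
  else ((alpha S x + k).-1)`!%:R / ((alpha S x).-1)`!%:R.

(* [m ^_ k] is m! / (m - k)! if k <= m, and 0 otherwise. *)
Definition dual_cl_site (x : V) (k m : nat) : R := (m ^_ k)%:R / weight x k.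

Definition dual_cl (xi : dual_conf) (eta : conf n) : R :=
  thetaL S ^+ dual_L xi
  * (\prod_(x : V) dual_cl_site x (dual_bulk xi x) (eta x))
  * thetaR S ^+ dual_R xi.

(* Not [poisson_pmf] for sigma = 0: that one is 1 everywhere at rate 0. *)
Definition marginal (x : V) (theta : R) (k : nat) : R :=
  if sigma S == -1 then binomial_pmf (alpha S x) theta k
  else if sigma S == 0 then
    (al x * theta) ^+ k / k`!%:R * expR (- (al x * theta))
  else ((alpha S x + k).-1)`!%:R / (((alpha S x).-1)`!%:R * k`!%:R)
       * (theta / (1 + theta)) ^+ k * (1 + theta) ^- alpha S x.

Definition profile (mu : conf n -> R) (x : V) : R :=
  expect mu (fun eta => (eta x)%:R / al x).

Definition local_equilibrium (thetabar : V -> R) (eta : conf n) : R :=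
  \prod_(x : V) marginal x (thetabar x) (eta x).

End BoundaryDriven.

(* Main.v *)
(* The duality functions intertwine the boundary driven process with a dual
   process in which the bulk particles of a dual configuration interact in the
   same way and are absorbed at L and R; the number of dual particles is
   conserved, so the dual semigroup is a finite exponential. That the process
   itself obeys this duality follows from a comparison principle for the
   backward equation, with (1 + |eta|)^k as Lyapunov functions.

   Hence the expectation of D(xi, .) at time t, started from local equilibrium,
   is the dual semigroup applied to phi = thL^xi(L) * prod th_x^xi(x) *
   thR^xi(R). As the profile th is harmonic, the one-particle part of the dual
   generator kills phi and its interaction part gives sigma * phi / 2 times the
   sum over x, y of omega_xy xi(x) xi(y) (th_x - th_y)^2 / (th_x th_y), which
   the dual semigroup makes strictly positive: by irreducibility two dual
   particles reach an edge along which th is not constant. Integrating in time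
   up to infinity compares the stationary moments with phi. *)
Require Import Defs.
From HB Require Import structures.
From mathcomp Require Import all_boot all_order all_algebra.
From mathcomp Require Import all_classical all_reals all_analysis.
From mathcomp Require Import ring lra zify.
Import Order.TTheory GRing.Theory Num.Theory.
Import numFieldNormedType.Exports.
Local Open Scope classical_set_scope.
Local Open Scope ring_scope.

Set Implicit Arguments.
Unset Strict Implicit.
Unset Printing Implicit Defensive.

(** * Semigroups of jump processes with finitely many states *)

(** The process is known only through its transition function: the backward equation holds for each
    fixed target, and for [sigma S = 1] the rates are unbounded. Neither differentiation under the
    expectation of a duality function nor finiteness of the stationary moments is available at the
    start. Duality is therefore proved up to an error for expectations truncated to finitely many
    targets. A duality function with K particles grows like (1 + |eta|)^K; a barrier with one more
    power dominates the discrepancy at infinity and carries a factor 1 / (1 + M) that vanishes with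
    the truncation level M. Finite stationary moments then come out of absorption, since the duality
    function of a fully absorbed dual configuration does not depend on eta.

    Strictness needs an edge inside V along which the profile varies, hence two sites, and phi > 0.
    With a single site the interaction part is empty, and with theta = 0 at a reservoir holding a
    dual particle the duality function is identically 0; in both cases the derivative is 0. *)

Lemma is_derive_continuous (R : realType) (f : R -> R) (x df : R) :
  is_derive x 1 f df -> {for x, continuous f}.
Proof. by move=> [/derivable1_diffP/differentiable_continuous]. Qed.

Lemma is_derive_expRM (R : realType) (k x : R) :
  is_derive x 1 (fun y : R => expR (k * y)) (k * expR (k * x)).
Proof.
apply: is_derive_eq; rewrite /GRing.scale/= mulr1.
by rewrite mulrC.
Qed.

Section JumpSemigroup.
Variables (R : realType) (T : choiceType) (I : finType).
Variables (r : I -> T -> R) (mv : I -> T -> T) (Q : seq T).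
Hypothesis r_ge0 : forall i s, s \in Q -> 0 <= r i s.
Hypothesis mvQ : forall i s, s \in Q -> r i s != 0 -> mv i s \in Q.
Implicit Types (g h : T -> R) (s : T) (t : R).

Definition jgen g s : R := \sum_i r i s * (g (mv i s) - g s).

Definition jrate : R := \sum_(s <- Q) \sum_i `|r i s|.

Definition junif g s : R := jgen g s + jrate * g s.

(* Uniformization: [jsg t] is the exponential of [t * jgen], written as
   exp(- c t) times the exponential of [t * (jgen + c)], the latter operator
   being positive on functions on [Q] as [c] bounds the exit rates. *)
Definition jcoef g s (k : nat) : R := iter k junif g s / k`!%:R.

Definition jser t g s : R := limn (pseries (jcoef g s) t).

Definition jsg t g s : R := expR (- jrate * t) * jser t g s.

Lemma jrate_ge0 : 0 <= jrate.
Proof. by do 2 (apply: sumr_ge0 => ? _). Qed.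

Lemma le_bigsum_seq g s : s \in Q -> `|g s| <= \sum_(z <- Q) `|g z|.
Proof.
move=> sQ; rewrite (big_rem s) //= lerDl.
by apply: sumr_ge0.
Qed.

Lemma sum_rate_le s : s \in Q -> \sum_i r i s <= jrate.
Proof.
move=> sQ; apply: (@le_trans _ _ (\sum_i `|r i s|)).
  by apply: ler_sum => i _; rewrite ler_norm.
rewrite -[leLHS]ger0_norm ?sumr_ge0// /jrate.
rewrite (le_trans (le_bigsum_seq (fun z => \sum_i `|r i z|) sQ))//.
by apply: ler_sum => z _; rewrite ger0_norm ?sumr_ge0.
Qed.

(** The coefficients in this form are nonnegative on [Q], because [jrate] dominates every exit rate;
    the positivity and norm estimates on the iterates rest on it. *)
Lemma junifE g s :
  junif g s = \sum_i r i s * g (mv i s) + (jrate - \sum_i r i s) * g s.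
Proof.
rewrite /junif /jgen; under eq_bigr do rewrite mulrBr.
by rewrite sumrB -mulr_suml; ring.
Qed.

Lemma junif_linear (a : R) g h :
  junif (fun z => a * g z + h z) = (fun z => a * junif g z + junif h z).
Proof.
apply/funext => s; rewrite !junifE.
have -> : \sum_i r i s * (a * g (mv i s) + h (mv i s)) =
  a * (\sum_i r i s * g (mv i s)) + \sum_i r i s * h (mv i s).
  by rewrite mulr_sumr -big_split; apply: eq_bigr => i _ /=; ring.
by ring.
Qed.

Lemma junif_norm_le (M : R) g s : {in Q, forall z, `|g z| <= M} -> s \in Q ->
  `|junif g s| <= jrate * M.
Proof.
move=> gM sQ; rewrite junifE (le_trans (ler_normD _ _))//.
have -> : jrate * M = (\sum_i r i s) * M + (jrate - \sum_i r i s) * M by ring.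
apply: lerD.
  rewrite (le_trans (ler_norm_sum _ _ _))// mulr_suml; apply: ler_sum => i _.
  rewrite normrM ger0_norm ?r_ge0//.
  have [->|ri0] := eqVneq (r i s) 0; first by rewrite !mul0r.
  by apply: ler_wpM2l; rewrite ?r_ge0// gM// mvQ.
rewrite normrM ger0_norm ?subr_ge0 ?sum_rate_le//.
by rewrite ler_wpM2l ?gM// subr_ge0 sum_rate_le.
Qed.

Lemma junif_ge0 g s : {in Q, forall z, 0 <= g z} -> s \in Q -> 0 <= junif g s.
Proof.
move=> g0 sQ; rewrite junifE addr_ge0//; last first.
  by rewrite mulr_ge0 ?g0// subr_ge0 sum_rate_le.
apply: sumr_ge0 => i _.
have [->|ri0] := eqVneq (r i s) 0; first by rewrite !mul0r.
by rewrite mulr_ge0 ?r_ge0// g0// mvQ.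
Qed.

Lemma iter_junif_norm_le (M : R) g k s : {in Q, forall z, `|g z| <= M} ->
  s \in Q -> `|iter k junif g s| <= jrate ^+ k * M.
Proof.
move=> gM; elim: k s => [|k IH] s sQ; first by rewrite expr0 mul1r gM.
by rewrite iterS exprS -mulrA; apply: junif_norm_le.
Qed.

Lemma iter_junif_ge0 g k s : {in Q, forall z, 0 <= g z} -> s \in Q ->
  0 <= iter k junif g s.
Proof.
move=> g0; elim: k s => [|k IH] s sQ; first exact: g0.
by rewrite iterS; apply: junif_ge0.
Qed.

Lemma iter_junif_linear (a : R) g h k :
  iter k junif (fun z => a * g z + h z) =
  (fun z => a * iter k junif g z + iter k junif h z).
Proof. by elim: k => // k IH; rewrite !iterS IH junif_linear. Qed.

Lemma iter_junif_const (a : R) k s :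
  iter k junif (fun=> a) s = jrate ^+ k * a.
Proof.
elim: k s => [|k IH] s; first by rewrite expr0 mul1r.
rewrite iterS (_ : iter k junif _ = fun=> jrate ^+ k * a); last exact/funext.
by rewrite /junif /jgen big1 ?add0r ?exprS ?mulrA// => i _; rewrite subrr mulr0.
Qed.

Lemma is_cvg_jcoef g s t : s \in Q -> cvgn (pseries (jcoef g s) t).
Proof.
move=> sQ; set M : R := \sum_(z <- Q) `|g z|.
apply: normed_cvg.
have := @is_cvg_series_exp_coeff R (jrate * `|t|).
move=> /(is_cvg_seriesZ (k := M)) /=; apply: series_le_cvg => k /=.
- exact: normr_ge0.
- rewrite -[(_ *: _) k]/(M * ((jrate * `|t|) ^+ k / k`!%:R)).
  by rewrite !mulr_ge0 ?sumr_ge0 ?invr_ge0 ?exprn_ge0 ?mulr_ge0 ?jrate_ge0.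
- rewrite /jcoef normrM normrX normrM normfV (ger0_norm (ler0n _ _)).
  have -> : (M *: exp_coeff (jrate * `|t|)) k = jrate ^+ k * M / k`!%:R * `|t| ^+ k.
    rewrite -[LHS]/(M * ((jrate * `|t|) ^+ k / k`!%:R)) exprMn; ring.
  rewrite ler_wpM2r ?exprn_ge0// ler_wpM2r ?invr_ge0//.
  by apply: iter_junif_norm_le => // z zQ; exact: (le_bigsum_seq g).
Qed.

Lemma jser_linear (a : R) g h t s : s \in Q ->
  jser t (fun z => a * g z + h z) s = a * jser t g s + jser t h s.
Proof.
move=> sQ; have cg := @is_cvg_jcoef g s t sQ; have ch := @is_cvg_jcoef h s t sQ.
rewrite /jser /pseries.
rewrite (_ : (fun i => _) = a *: (fun i => jcoef g s i * t ^+ i) +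
    (fun i => jcoef h s i * t ^+ i)); last first.
  apply/funext => k; rewrite /jcoef iter_junif_linear.
  by rewrite /GRing.add/= /GRing.scale/= mulrDl mulrDl -!mulrA.
have ca := is_cvg_seriesZ (k := a) cg.
by rewrite lim_seriesD// lim_seriesZ.
Qed.

Lemma jsg_linear (a : R) g h t s : s \in Q ->
  jsg t (fun z => a * g z + h z) s = a * jsg t g s + jsg t h s.
Proof. by move=> sQ; rewrite /jsg jser_linear// mulrDr mulrCA. Qed.

Lemma jsg_const (a : R) t s : jsg t (fun=> a) s = a.
Proof.
rewrite /jsg /jser /pseries.
rewrite (_ : (fun i => _) = a *: exp_coeff (jrate * t)); last first.
  apply/funext => k; rewrite /jcoef iter_junif_const.
  by rewrite -[RHS]/(a * ((jrate * t) ^+ k / k`!%:R)) exprMn; ring.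
rewrite lim_seriesZ; last exact: is_cvg_series_exp_coeff.
rewrite -/(expR (jrate * t)).
by rewrite /GRing.scale/= mulrCA -expRD mulNr addNr expR0 mulr1.
Qed.

Lemma jsg0 g s : jsg 0 g s = g s.
Proof.
rewrite /jsg mulr0 expR0 mul1r; apply/cvg_lim => //.
rewrite -(cvg_shiftn 1); apply: cvg_near_cst; near=> k.
rewrite /pseries /series/= addn1 big_nat_recl// big1 ?addr0.
  by rewrite /jcoef fact0 invr1 expr0 !mulr1.
by move=> i _; rewrite expr0n mulr0.
Unshelve. all: by end_near. Qed.

(** Moves of nonzero rate stay in [Q], so the iterates at a point of [Q] never see values outside
    it. *)
Lemma jsg_eq g h t s : {in Q, g =1 h} -> s \in Q -> jsg t g s = jsg t h s.
Proof.
move=> gh sQ; rewrite /jsg /jser; congr (_ * limn (pseries _ _)).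
apply/funext => k; rewrite /jcoef; congr (_ / _).
elim: k s sQ => [|k IH] s sQ; first exact: gh.
rewrite !iterS !junifE IH//; congr (_ + _).
apply: eq_bigr => i _; have [->|ri0] := eqVneq (r i s) 0; first by rewrite !mul0r.
by rewrite IH// mvQ.
Qed.

Lemma jsg_sum (J : Type) (l : seq J) (a : J -> R) (g : J -> T -> R) t s :
  s \in Q ->
  jsg t (fun z => \sum_(j <- l) a j * g j z) s = \sum_(j <- l) a j * jsg t (g j) s.
Proof.
move=> sQ; elim: l => [|j l IH].
  rewrite big_nil (_ : (fun z => _) = fun=> 0) ?jsg_const//.
  by apply/funext => z; rewrite big_nil.
rewrite big_cons -IH -jsg_linear//; congr (jsg _ _ _).
by apply/funext => z; rewrite big_cons.
Qed.

Lemma jser_derive g t s : s \in Q ->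
  is_derive t 1 (fun x => jser x g s) (jser t (junif g) s).
Proof.
move=> sQ.
(* Termwise differentiation shifts the coefficients, which here means applying [junif] once to the
   function. *)
have dE f : pseries_diffs (jcoef f s) = jcoef (junif f) s.
  apply/funext => k; rewrite /pseries_diffs /jcoef -iterSr iterS factS natrM.
  by rewrite invfM mulrCA mulVKf.
rewrite /jser -dE; apply: (@pseries_snd_diffs _ _ (`|t| + 1)).
- exact: is_cvg_jcoef.
- by rewrite dE; exact: is_cvg_jcoef.
- by rewrite !dE; exact: is_cvg_jcoef.
- by rewrite [ltRHS]ger0_norm ?ltrDl// addr_ge0.
Qed.

Lemma jsg_derive g t s : s \in Q ->
  is_derive t 1 (fun x => jsg x g s) (jsg t (jgen g) s).
Proof.
move=> sQ.
have -> : jgen g = fun z => - jrate * g z + junif g z.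
  by apply/funext => z; rewrite /junif mulNr addrCA addNr addr0.
have dj := jser_derive g t sQ.
have de := is_derive_expRM (- jrate) t.
apply: is_derive_eq.
rewrite jsg_linear// /jsg /GRing.scale/=; ring.
Qed.

Lemma jsg_ge0 g t s : 0 <= t -> {in Q, forall z, 0 <= g z} -> s \in Q ->
  0 <= jsg t g s.
Proof.
move=> t0 g0 sQ; rewrite /jsg mulr_ge0 ?expR_ge0// /jser.
apply: limr_ge; first exact: is_cvg_jcoef.
near=> k; rewrite /pseries /series/= sumr_ge0// => i _.
by rewrite /jcoef !mulr_ge0 ?invr_ge0 ?exprn_ge0 ?iter_junif_ge0.
Unshelve. all: by end_near. Qed.

Lemma jsg_le g h t s : 0 <= t -> {in Q, forall z, g z <= h z} -> s \in Q ->
  jsg t g s <= jsg t h s.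
Proof.
move=> t0 gh sQ.
have := @jsg_ge0 (fun z => -1 * g z + h z) t s t0 _ sQ.
rewrite jsg_linear// mulN1r addrC subr_ge0; apply => z zQ.
by rewrite mulN1r addrC subr_ge0 gh.
Qed.

Lemma jsg_norm_le (M : R) g t s : 0 <= t -> {in Q, forall z, `|g z| <= M} ->
  s \in Q -> `|jsg t g s| <= M.
Proof.
move=> t0 gM sQ; have gM' z : z \in Q -> - M <= g z /\ g z <= M.
  by move=> /gM; rewrite ler_norml => /andP.
rewrite ler_norml; apply/andP; split.
  by rewrite -[leLHS](jsg_const (- M) t s) jsg_le// => z /gM'[].
by rewrite -[leRHS](jsg_const M t s) jsg_le// => z /gM'[].
Qed.

Definition jker t s s' : R := jsg t (fun z => (z == s')%:R) s.

Lemma jker_ge0 t s s' : 0 <= t -> s \in Q -> 0 <= jker t s s'.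
Proof. by move=> t0 sQ; apply: jsg_ge0. Qed.

Lemma jsg_kernel g t s : uniq Q -> s \in Q ->
  jsg t g s = \sum_(s' <- Q) g s' * jker t s s'.
Proof.
move=> uQ sQ; rewrite -jsg_sum//; apply: jsg_eq => // z zQ.
rewrite (bigD1_seq z)//= eqxx mulr1 big1 ?addr0// => z' /negbTE.
by rewrite eq_sym => ->; rewrite mulr0.
Qed.

(** The series has nonnegative terms, so a single positive iterate suffices; it stands for a path of
    at most k allowed jumps. *)
Lemma jsg_gt0 g t s k : 0 < t -> {in Q, forall z, 0 <= g z} -> s \in Q ->
  0 < iter k junif g s -> 0 < jsg t g s.
Proof.
move=> t0 g0 sQ gk; rewrite /jsg mulr_gt0 ?expR_gt0//.
have pos i : 0 <= jcoef g s i * t ^+ i.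
  by rewrite /jcoef !mulr_ge0 ?invr_ge0 ?exprn_ge0 ?iter_junif_ge0// ltW.
apply: (@lt_le_trans _ _ (pseries (jcoef g s) t k.+1)).
  rewrite /pseries /series/= big_nat_recr//= ltr_wpDl ?sumr_ge0//.
  by rewrite /jcoef !mulr_gt0 ?invr_gt0 ?exprn_gt0 ?ltr0n ?fact_gt0.
apply: nondecreasing_cvgn_le; last exact: is_cvg_jcoef.
by apply/nondecreasing_seqP => i; rewrite /pseries/= seriesSr lerDl.
Qed.

Lemma junif_gt0 g i s : {in Q, forall z, 0 <= g z} -> s \in Q ->
  0 < r i s -> 0 < g (mv i s) -> 0 < junif g s.
Proof.
move=> g0 sQ ri gi; rewrite junifE ltr_wpDr//.
  by rewrite mulr_ge0 ?g0// subr_ge0 sum_rate_le.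
rewrite (bigD1 i)//= ltr_wpDr ?mulr_gt0// sumr_ge0// => j _.
have [->|rj0] := eqVneq (r j s) 0; first by rewrite !mul0r.
by rewrite mulr_ge0 ?r_ge0// g0// mvQ.
Qed.

(** Gronwall's argument: the derivative of [expR (k * t) * jsg t g s] is, up to a positive factor,
    the positive semigroup applied to [k * g + jgen g <= 0]. *)
Lemma jsg_decay (k : R) g t s : 0 <= t -> s \in Q ->
  {in Q, forall z, jgen g z <= - k * g z} ->
  jsg t g s <= expR (- k * t) * g s.
Proof.
move=> t0 sQ gk.
have dE (x : R) : is_derive x 1 (fun y => expR (k * y) * jsg y g s)
    (expR (k * x) * jsg x (fun z => k * g z + jgen g z) s).
  have dj := jsg_derive g x sQ.
  have de := is_derive_expRM k x.
  apply: is_derive_eq; rewrite jsg_linear// /GRing.scale/=; ring.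
have [|c ct0] := MVT_segment t0 (fun (x : R) _ => dE x).
  apply: continuous_subspaceT => x; exact: is_derive_continuous (dE x).
rewrite mulr0 expR0 mul1r jsg0 subr0 => E.
have : expR (k * t) * jsg t g s - g s <= 0.
  have /andP[c0 ct] : 0 <= c <= t by have := ct0; rewrite in_itv.
  rewrite E mulr_le0_ge0// mulr_ge0_le0 ?expR_ge0//.
  rewrite (le_trans (@jsg_le _ (fun=> 0) _ _ c0 _ sQ)) ?jsg_const// => z zQ.
  by rewrite -lerBrDl sub0r -mulNr gk.
by rewrite subr_le0 -ler_pdivlMl ?expR_gt0// -expRN mulNr.
Qed.

End JumpSemigroup.

(** * Duality of the generators *)

Lemma natr_ffactSr (R : comNzRingType) (a k : nat) :
  (a ^_ k.+1)%:R = (a%:R - k%:R) * (a ^_ k)%:R :> R.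
Proof.
rewrite ffactnSr natrM mulrC; have [ka|ak] := leqP k a; first by rewrite natrB.
by rewrite (ffact_small ak) !mulr0.
Qed.

Lemma sum_pairs_lt (R : zmodType) (m : nat) (G : 'I_m -> 'I_m -> R) :
  (forall x, G x x = 0) ->
  \sum_x \sum_y G x y =
    \sum_(x : 'I_m) \sum_(y : 'I_m | (x < y)%N) (G x y + G y x).
Proof.
move=> G0.
transitivity (\sum_(x : 'I_m) (\sum_(y : 'I_m | (x < y)%N) G x y +
                      \sum_(y : 'I_m | (y < x)%N) G x y)).
  apply: eq_bigr => x _; rewrite (bigID (fun y : 'I_m => (x < y)%N))/=; congr (_ + _).
  rewrite (bigID (fun y : 'I_m => y == x))/= big1 ?add0r; last first.
    by move=> y /andP[_ /eqP->].
  by apply: eq_bigl => y; rewrite -leqNgt ltn_neqAle andbC.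
rewrite big_split/= addrC.
under [X in X + _]eq_bigr do rewrite big_mkcond.
rewrite exchange_big/= addrC -big_split/=.
apply: eq_bigr => x _; rewrite big_split/=; congr (_ + _).
by rewrite [RHS]big_mkcond.
Qed.

Section Duality.
Variables (R : realType) (n : nat) (S : bd_system R n).
Hypothesis hS : bd_system_ok S.
Hypothesis hsigma : sigma S = -1 \/ sigma S = 1.

Local Notation V := 'I_n.+1.
Local Notation sg := ((sigma S)%:~R : R).
Local Notation al x := ((alpha S x)%:R : R).
Local Notation d := (dual_cl_site S).
Implicit Types (x y z : V) (eta : conf n).

(* A dual configuration is encoded as [(bulk, (left, right))]. *)
Definition dconf : Type := (conf n * (nat * nat))%type.
HB.instance Definition _ := Choice.on dconf.

Definition dual_fun (xi : dconf) (eta : conf n) : R :=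
  dual_cl S (DualConf xi.1 xi.2.1 xi.2.2) eta.

Definition dmoves : Type := (V * V + bool)%type.
HB.instance Definition _ := Finite.on dmoves.

Definition drate (m : dmoves) (xi : dconf) : R :=
  match m with
  | inl (x, y) => omega S x y * (xi.1 x)%:R * (al y + sg * (xi.1 y)%:R)
  | inr true => omegaL S * alphaL S * (xi.1 ord0)%:R
  | inr false => omegaR S * alphaR S * (xi.1 ord_max)%:R
  end.

Definition dmove (m : dmoves) (xi : dconf) : dconf :=
  match m with
  | inl (x, y) => (incr y (decr x xi.1), xi.2)
  | inr true => (decr ord0 xi.1, (xi.2.1.+1, xi.2.2))
  | inr false => (decr ord_max xi.1, (xi.2.1, xi.2.2.+1))
  end.

Lemma weightS x k : (sigma S = -1 -> (k <= alpha S x)%N) ->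
  weight S x k.+1 = weight S x k * (al x + sg * k%:R).
Proof.
move=> kx; rewrite /weight; case: hsigma => s1; rewrite s1/=.
  by rewrite ffactnSr natrM natrB ?kx// mulN1r.
have a0 := alpha_gt0 hS x.
rewrite addnS/= mul1r -natrD mulrAC; congr (_ / _).
have ak0 : (0 < alpha S x + k)%N by rewrite addn_gt0 a0.
by rewrite -natrM -[in LHS](prednK ak0) factS mulnC prednK.
Qed.

Lemma weight_neq0 x k : (sigma S = -1 -> (k <= alpha S x)%N) ->
  weight S x k != 0.
Proof.
move=> kx; rewrite /weight; case: hsigma => s1; rewrite s1/=.
  by rewrite pnatr_eq0 -lt0n ffact_gt0 kx.
by rewrite mulf_neq0 ?invr_eq0// pnatr_eq0 -lt0n fact_gt0.
Qed.

(** With [site_decr] and [site_incr], this is the one-site algebra of the duality: a shifted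
    argument, weighted by the rate it comes with, reduces to the unshifted function and, in
    [site_incr], to one with a dual particle less. Both signs of [sigma S] are covered. *)
Lemma site_weightS x k a : (sigma S = -1 -> (k <= alpha S x)%N) ->
  (sigma S = -1 -> (a <= alpha S x)%N) ->
  (al x + sg * k%:R) * d x k.+1 a = (a%:R - k%:R) * d x k a.
Proof.
move=> kx ax; have w0 := weight_neq0 kx; have wS := weightS kx.
have aE := natr_ffactSr R a k.
(* A vanishing factor means a full site under exclusion. The right side is then 0 too, as [a <= k]
   makes either [a - k] or the falling factorial zero. *)
have [k1|k1] := eqVneq (al x + sg * k%:R) 0.
  rewrite k1 mul0r; case: hsigma => s1; rewrite s1 in k1; last first.
    move: k1 => /eqP; rewrite mul1r -natrD pnatr_eq0 addn_eq0.
    by have := alpha_gt0 hS x; case: (alpha S x).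
  move/eqP: k1; rewrite mulN1r subr_eq0 eqr_nat => /eqP k1.
  have := ax s1; rewrite k1 leq_eqVlt => /orP[/eqP->|ak].
    by rewrite subrr mul0r.
  by rewrite /dual_cl_site (ffact_small ak) !mul0r mulr0.
rewrite /dual_cl_site wS aE; field.
by rewrite w0.
Qed.

Lemma site_decr x k a : a%:R * d x k a.-1 = (a%:R - k%:R) * d x k a.
Proof.
rewrite /dual_cl_site mulrA -natrM mulrA; congr (_ / _).
by rewrite -ffactnS natr_ffactSr.
Qed.

Lemma site_incr x k a : (sigma S = -1 -> (k <= alpha S x)%N) ->
  (al x + sg * a%:R) * d x k a.+1 =
  (al x + sg * (a%:R + k%:R)) * d x k a + k%:R * d x k.-1 a.
Proof.
move=> kx; case: k kx => [|k] kx.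
  by rewrite /dual_cl_site !ffactn0 addr0 mul0r addr0.
have kx' : sigma S = -1 -> (k <= alpha S x)%N by move/kx/ltnW.
have wS := weightS kx'; have w0 := weight_neq0 kx'; have w1 := weight_neq0 kx.
have ak0 : al x + sg * k%:R != 0.
  by move: w1; rewrite wS mulf_eq0 negb_or => /andP[].
have aS : (a.+1 ^_ k.+1)%:R = a.+1%:R * (a ^_ k)%:R :> R by rewrite ffactSS natrM.
have aE := natr_ffactSr R a k.
rewrite /dual_cl_site wS aS aE /= -natr1 -[k.+1%:R]natr1; field.
by rewrite ak0 w0.
Qed.

Definition dual_rest (P : pred V) (xi : dconf) eta : R :=
  \prod_(z | P z) d z (xi.1 z) (eta z).

Lemma dual_fun1 b xi eta :
  dual_fun xi eta = thetaL S ^+ xi.2.1 * thetaR S ^+ xi.2.2 *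
    d b (xi.1 b) (eta b) * dual_rest (fun z => z != b) xi eta.
Proof. by rewrite /dual_fun/dual_cl (bigD1 b)//= /dual_rest; ring. Qed.

Lemma dual_fun2 x y xi eta : x != y ->
  dual_fun xi eta = thetaL S ^+ xi.2.1 * thetaR S ^+ xi.2.2 *
    (d x (xi.1 x) (eta x) * d y (xi.1 y) (eta y)) *
    dual_rest (fun z => (z != x) && (z != y)) xi eta.
Proof.
move=> xy; rewrite (dual_fun1 x) /dual_rest (bigD1 y)/= 1?eq_sym//.
by rewrite !mulrA.
Qed.

Lemma dual_rest_eq (P : pred V) (xi xi' : dconf) eta eta' :
  (forall z, P z -> xi.1 z = xi'.1 z /\ eta z = eta' z) ->
  dual_rest P xi eta = dual_rest P xi' eta'.
Proof. by move=> H; apply: eq_bigr => z /H[-> ->]. Qed.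

(** The factors away from x and y are common. The one-site relations, applied to the shifted factors
    grouped with their rates, leave a polynomial identity in the unshifted factors and those with
    one dual particle less. *)
Lemma duality_edge x y (xi : dconf) eta : x != y -> states S eta -> states S xi.1 ->
  gen_edge S x y (dual_fun xi) eta =
  (xi.1 x)%:R * (al y + sg * (xi.1 y)%:R) *
     (dual_fun (incr y (decr x xi.1), xi.2) eta - dual_fun xi eta) +
  (xi.1 y)%:R * (al x + sg * (xi.1 x)%:R) *
     (dual_fun (incr x (decr y xi.1), xi.2) eta - dual_fun xi eta).
Proof.
move=> xy heta hxi; rewrite /gen_edge !(dual_fun2 _ _ xy)/=.
have yx : y != x by rewrite eq_sym.
set C := thetaL S ^+ _ * _; set r := dual_rest _ xi eta.
have moveE u v (b : conf n) z : u != z -> v != z -> incr u (decr v b) z = b z.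
  by move=> uz vz; rewrite !ffunE ![z == _]eq_sym (negbTE uz) (negbTE vz) addn0 subn0.
have -> : dual_rest (fun z => (z != x) && (z != y)) xi (incr y (decr x eta)) = r.
  by apply: dual_rest_eq => z /andP[zx zy]; rewrite /= moveE 1?eq_sym.
have -> : dual_rest (fun z => (z != x) && (z != y)) xi (incr x (decr y eta)) = r.
  by apply: dual_rest_eq => z /andP[zx zy]; rewrite /= moveE 1?eq_sym.
have -> : dual_rest (fun z => (z != x) && (z != y))
    (incr y (decr x xi.1), xi.2) eta = r.
  by apply: dual_rest_eq => z /andP[zx zy]; rewrite /= moveE 1?eq_sym.
have -> : dual_rest (fun z => (z != x) && (z != y))
    (incr x (decr y xi.1), xi.2) eta = r.
  by apply: dual_rest_eq => z /andP[zx zy]; rewrite /= moveE 1?eq_sym.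
rewrite !ffunE !eqxx (negbTE xy) (negbTE yx) !addn0 !subn0 !subn1 !addn1.
have hx : sigma S = -1 -> (xi.1 x <= alpha S x)%N by move/hxi.
have hy : sigma S = -1 -> (xi.1 y <= alpha S y)%N by move/hxi.
have ex : sigma S = -1 -> (eta x <= alpha S x)%N by move/heta.
have ey : sigma S = -1 -> (eta y <= alpha S y)%N by move/heta.
move: (site_weightS hx ex) (site_weightS hy ey) (site_decr x (xi.1 x) (eta x))
  (site_decr y (xi.1 y) (eta y)) (site_incr (eta x) hx) (site_incr (eta y) hy).
set X1 := d x (xi.1 x).+1 _; set Y1 := d y (xi.1 y).+1 _.
set Xd := d x _ (eta x).-1; set Yd := d y _ (eta y).-1.
set Xi := d x _ (eta x).+1; set Yi := d y _ (eta y).+1.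
set X' := d x (xi.1 x).-1 _; set Y' := d y (xi.1 y).-1 _.
set X := d x _ _; set Y := d y _ _ => X1E Y1E XdE YdE XiE YiE.
transitivity (C * r * (((eta x)%:R * Xd) * ((al y + sg * (eta y)%:R) * Yi)
   - (eta x)%:R * (al y + sg * (eta y)%:R) * X * Y
   + ((eta y)%:R * Yd) * ((al x + sg * (eta x)%:R) * Xi)
   - (eta y)%:R * (al x + sg * (eta x)%:R) * X * Y)); first by ring.
transitivity (C * r * ((xi.1 x)%:R * X' * ((al y + sg * (xi.1 y)%:R) * Y1)
   - (xi.1 x)%:R * (al y + sg * (xi.1 y)%:R) * X * Y
   + (xi.1 y)%:R * Y' * ((al x + sg * (xi.1 x)%:R) * X1)
   - (xi.1 y)%:R * (al x + sg * (xi.1 x)%:R) * X * Y)); last by ring.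
by rewrite XdE YdE XiE YiE X1E Y1E; ring.
Qed.

(** The terms in [sg * th] cancel and k (th X' - X) remains, where X' has one dual particle less
    than X: the particle leaves a factor [th], which the hypothesis on the powers books as an
    absorption. *)
Lemma duality_boundary b (a th : R) (xi xi' : dconf) eta :
  states S eta -> states S xi.1 -> xi'.1 = decr b xi.1 ->
  thetaL S ^+ xi'.2.1 * thetaR S ^+ xi'.2.2 =
    th * (thetaL S ^+ xi.2.1 * thetaR S ^+ xi.2.2) ->
  gen_boundary S b a th (dual_fun xi) eta =
  a * (xi.1 b)%:R * (dual_fun xi' eta - dual_fun xi eta).
Proof.
move=> heta hxi xi'E thE; rewrite /gen_boundary !(dual_fun1 b) thE.
set C := thetaL S ^+ _ * _; set r := dual_rest _ xi eta.
have -> : dual_rest (fun z => z != b) xi (decr b eta) = r.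
  by apply: dual_rest_eq => z /negbTE zb; rewrite !ffunE zb subn0.
have -> : dual_rest (fun z => z != b) xi (incr b eta) = r.
  by apply: dual_rest_eq => z /negbTE zb; rewrite !ffunE zb addn0.
have -> : dual_rest (fun z => z != b) xi' eta = r.
  by apply: dual_rest_eq => z /negbTE zb; rewrite xi'E !ffunE zb subn0.
rewrite xi'E !ffunE !eqxx !subn1 !addn1.
have hb : sigma S = -1 -> (xi.1 b <= alpha S b)%N by move/hxi.
move: (site_decr b (xi.1 b) (eta b)) (site_incr (eta b) hb).
set Xd := d b _ (eta b).-1; set Xi := d b _ (eta b).+1; set X' := d b (xi.1 b).-1 _.
set X := d b _ _ => XdE XiE.
transitivity (C * r * a * ((1 + sg * th) * ((eta b)%:R * Xd - (eta b)%:R * X)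
   + th * ((al b + sg * (eta b)%:R) * Xi - (al b + sg * (eta b)%:R) * X))).
  by ring.
by rewrite XdE XiE; ring.
Qed.

Lemma generator_sum f eta : generator S f eta =
  \sum_x \sum_y omega S x y *
     ((eta x)%:R * (al y + sg * (eta y)%:R) * (f (incr y (decr x eta)) - f eta))
  + omegaL S * gen_boundary S ord0 (alphaL S) (thetaL S) f eta
  + omegaR S * gen_boundary S ord_max (alphaR S) (thetaR S) f eta.
Proof.
rewrite /generator; congr (_ + _ + _); rewrite sum_pairs_lt; last first.
  by move=> x; rewrite (omega_diag hS) mul0r.
apply: eq_bigr => x _; rewrite big_mkcondr/=; apply: eq_bigr => y _.
rewrite (omega_sym hS y x) -mulrDr; case: eqVneq => //= ->.
by rewrite mul0r.
Qed.

Lemma sum_dmoves (F : dmoves -> R) :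
  \sum_m F m = \sum_x \sum_y F (inl (x, y)) + F (inr true) + F (inr false).
Proof.
rewrite big_sumType/= big_bool/= addrA pair_bigA/=; congr (_ + _ + _).
by apply: eq_bigr => -[].
Qed.

Lemma duality (xi : dconf) eta : states S eta -> states S xi.1 ->
  generator S (dual_fun xi) eta = jgen drate dmove (dual_fun^~ eta) xi.
Proof.
move=> heta hxi; rewrite /jgen sum_dmoves /generator; congr (_ + _ + _).
- rewrite sum_pairs_lt; last by move=> x /=; rewrite (omega_diag hS) !mul0r.
  apply: eq_bigr => x _; rewrite big_mkcondr/=; apply: eq_bigr => y xy /=.
  rewrite duality_edge//; last by rewrite -val_eqE/= neq_ltn xy.
  rewrite (omega_sym hS y x); case: eqVneq => /= [->|_]; first by rewrite !mul0r addr0.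
  ring.
- rewrite (@duality_boundary _ _ _ _ (decr ord0 xi.1, (xi.2.1.+1, xi.2.2)))//= ?mulrA//.
  by rewrite exprS; ring.
- rewrite (@duality_boundary _ _ _ _ (decr ord_max xi.1, (xi.2.1, xi.2.2.+1)))//= ?mulrA//.
  by rewrite exprS; ring.
Qed.

End Duality.

(** * Comparison principle for the backward equation *)

(** One-sided Fermat rule: in [comparison] the maximum over [0, T0] may sit at T0, where only
    earlier times can be compared. *)
Lemma is_derive_ge0_left (R : realType) (f : R -> R) (c df : R) : 0 < c ->
  is_derive c 1 f df -> (forall t, 0 <= t <= c -> f t <= f c) -> 0 <= df.
Proof.
move=> c0 [dfc <-] cmax.
rewrite ['D_1 f c]cvg_at_leftE//; apply: limr_ge.
  rewrite -(cvg_at_leftE (fun h => h^-1 *: ((f \o shift c) _ - f c))) //.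
  apply: cvg_trans dfc; apply: cvg_app.
  move=> A [e egt0 Ae]; exists e => // x xe xgt0; apply: Ae => //.
  exact/ltr0_neq0.
near=> h; apply: mulr_le0.
  by rewrite invr_le0; apply: ltW; near: h; exists 1 => /=.
rewrite subr_le0 [_%:A]mulr1; apply: cmax; near: h.
exists c => //= h; rewrite /= distrC subr0 => /ltr_normlP[h1 _] h0.
by rewrite /= gerDr (ltW h0) andbT -lerBlDr sub0r lerNl ltW.
Unshelve. all: by end_near. Qed.

Lemma seq_argmax (R : realType) (T : eqType) (f : T -> R) (s : seq T) x :
  x \in s -> exists2 z, z \in s & forall y, y \in s -> f y <= f z.
Proof.
elim: s x => // a [|b s] IH x xs.
  by exists a; rewrite ?inE// => y; rewrite inE => /eqP ->.
have [z zs zmax] := IH b (mem_head _ _).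
have [az|za] := leP (f a) (f z).
  exists z; first by rewrite in_cons zs orbT.
  by move=> y; rewrite in_cons => /orP[/eqP->|/zmax].
exists a; first exact: mem_head.
move=> y; rewrite in_cons => /orP[/eqP->//|/zmax yz].
by rewrite (le_trans yz)// ltW.
Qed.

Section Comparison.
Variables (R : realType) (n : nat) (S : bd_system R n).
Hypothesis hS : bd_system_ok S.
Hypothesis hsigma : sigma S = -1 \/ sigma S = 1.

Local Notation V := 'I_n.+1.
Local Notation sg := ((sigma S)%:~R : R).
Local Notation al x := ((alpha S x)%:R : R).
Local Notation gen := (generator S).
Implicit Types (x y : V) (eta : conf n) (f g : conf n -> R).

Definition tot eta : nat := (\sum_x eta x)%N.

Lemma tot_incr x eta : tot (incr x eta) = (tot eta).+1.
Proof.
rewrite /tot (bigD1 x)//= [in RHS](bigD1 x)//= ffunE eqxx addn1 addSn.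
congr (_ + _).+1; apply: eq_bigr => y /negbTE yx.
by rewrite ffunE yx addn0.
Qed.

Lemma tot_decr x eta : (0 < eta x)%N -> (tot (decr x eta)).+1 = tot eta.
Proof.
move=> x0; rewrite /tot (bigD1 x)//= [in RHS](bigD1 x)//= ffunE eqxx subn1 -addSn prednK//.
congr (_ + _)%N; apply: eq_bigr => y /negbTE yx.
by rewrite ffunE yx subn0.
Qed.

Lemma tot_move x y eta : (0 < eta x)%N -> tot (incr y (decr x eta)) = tot eta.
Proof. by move=> x0; rewrite tot_incr tot_decr. Qed.

Lemma le_tot x eta : (eta x <= tot eta)%N.
Proof. by rewrite /tot (bigD1 x)//= leq_addr. Qed.

Lemma states_decr x eta : states S eta -> states S (decr x eta).
Proof. by move=> h s y; rewrite ffunE (leq_trans (leq_subr _ _))// h. Qed.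

Lemma states_incr x eta : states S eta ->
  al x + sg * (eta x)%:R != 0 -> states S (incr x eta).
Proof.
move=> h; rewrite /states/= => + s y; rewrite ffunE s mulN1r subr_eq0 eqr_nat.
have [->|_ _] := eqVneq y x; last by rewrite addn0 h.
by rewrite addn1 ltn_neqAle eq_sym => ->; rewrite h.
Qed.

Lemma room_ge0 x eta : states S eta -> 0 <= al x + sg * (eta x)%:R.
Proof.
move=> h; case: hsigma => s; rewrite s.
  by rewrite mulN1r subr_ge0 ler_nat h.
by rewrite mul1r addr_ge0.
Qed.

Lemma room_decr x y eta : states S eta -> al y + sg * (eta y)%:R != 0 ->
  al y + sg * (decr x eta y)%:R != 0.
Proof.
move=> h; rewrite ffunE; case: hsigma => s; rewrite s.
  rewrite !mulN1r !subr_eq0 !eqr_nat => ay; have := h s y.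
  by rewrite leq_eqVlt eq_sym (negbTE ay)/= => lt; rewrite gtn_eqF// (leq_ltn_trans (leq_subr _ _)).
by move=> _; rewrite mul1r -natrD pnatr_eq0 addn_eq0 negb_and -lt0n (alpha_gt0 hS).
Qed.

Lemma states_move x y eta : states S eta -> al y + sg * (eta y)%:R != 0 ->
  states S (incr y (decr x eta)).
Proof.
by move=> h ay; apply: states_incr; [exact: states_decr|exact: room_decr].
Qed.

Lemma Theta_ge0 th : in_Theta (sigma S) th -> 0 <= 1 + sg * th :> R.
Proof.
move=> [t0 t1]; case: hsigma => s; rewrite s; last by rewrite mul1r addr_ge0.
by rewrite mulN1r subr_ge0 t1.
Qed.

Lemma generator_linear (a : R) f g eta :
  gen (fun z => a * f z + g z) eta = a * gen f eta + gen g eta.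
Proof.
rewrite !(generator_sum hS) /gen_boundary.
set X := \sum_x _; set Y := \sum_x _; set Z := \sum_x _.
have -> : X = a * Y + Z.
  rewrite /X /Y /Z mulr_sumr -big_split/=; apply: eq_bigr => x _.
  rewrite mulr_sumr -big_split/=; apply: eq_bigr => y _; ring.
ring.
Qed.

Lemma generator0 eta : gen (fun=> 0) eta = 0.
Proof.
have := generator_linear (-1) (fun=> 0) (fun=> 0) eta.
rewrite (_ : (fun z => _) = fun=> 0); last by apply/funext => z; rewrite mulr0 addr0.
by rewrite mulN1r addNr.
Qed.

Lemma generator_sumr (J : Type) (l : seq J) (a : J -> R) (f : J -> conf n -> R) eta :
  gen (fun z => \sum_(j <- l) a j * f j z) eta = \sum_(j <- l) a j * gen (f j) eta.
Proof.
elim: l => [|j l IH].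
  rewrite big_nil (_ : (fun z => _) = fun=> 0) ?generator0//.
  by apply/funext => z; rewrite big_nil.
rewrite big_cons -IH -generator_linear; congr (gen _ _).
by apply/funext => z; rewrite big_cons.
Qed.

Lemma boundary_le0_at_max b (a th : R) f eta : 0 < a -> in_Theta (sigma S) th ->
  states S eta -> (forall zeta, states S zeta -> f zeta <= f eta) ->
  gen_boundary S b a th f eta <= 0.
Proof.
move=> a0 hth heta fmax; have [th0 _] := hth; rewrite /gen_boundary.
rewrite -[leRHS](addr0 0) lerD//.
  rewrite mulr_ge0_le0// ?subr_le0 ?fmax//; last exact: states_decr.
  by rewrite !mulr_ge0 ?Theta_ge0// ltW.
have [->|b0] := eqVneq (al b + sg * (eta b)%:R) 0; first by rewrite mulr0 mul0r.
rewrite mulr_ge0_le0 ?subr_le0 ?fmax//; last exact: states_incr.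
by rewrite !mulr_ge0 ?room_ge0// ltW.
Qed.

(** Maximum principle. A move out of [states S] has rate 0, so maximality over [states S] is
    enough. *)
Lemma generator_le0_at_max f eta : states S eta ->
  (forall zeta, states S zeta -> f zeta <= f eta) -> gen f eta <= 0.
Proof.
move=> heta fmax; rewrite (generator_sum hS).
rewrite -[leRHS](addr0 0) lerD//; last first.
  rewrite mulr_ge0_le0 ?(omegaR_ge0 hS)// boundary_le0_at_max ?(alphaR_gt0 hS)//.
  exact: thetaR_ok.
rewrite -[leRHS](addr0 0) lerD//; last first.
  rewrite mulr_ge0_le0 ?(omegaL_ge0 hS)// boundary_le0_at_max ?(alphaL_gt0 hS)//.
  exact: thetaL_ok.
apply: sumr_le0 => x _; apply: sumr_le0 => y _.
rewrite mulr_ge0_le0 ?(omega_ge0 hS)//.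
have [->|y0] := eqVneq (al y + sg * (eta y)%:R) 0; first by rewrite mulr0 mul0r.
rewrite mulr_ge0_le0 ?subr_le0 ?fmax//; last exact: states_move.
by rewrite mulr_ge0 ?room_ge0.
Qed.

Definition stateb eta : bool :=
  (sigma S == -1) ==> [forall x, eta x <= alpha S x]%N.

Lemma statesP eta : reflect (states S eta) (stateb eta).
Proof.
apply: (iffP implyP) => [h s x|h /eqP s]; first by have /forallP := h (introT eqP s).
by apply/forallP => x; exact: h.
Qed.

Definition confs (M : nat) : seq (conf n) :=
  [seq z <- undup [seq [ffun x => f x : nat] | f : {ffun V -> 'I_M.+1}]
     | stateb z & (tot z <= M)%N].

Lemma confs_uniq M : uniq (confs M).
Proof. by rewrite filter_uniq// undup_uniq. Qed.

Lemma mem_confs M eta : states S eta -> (tot eta <= M)%N -> eta \in confs M.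
Proof.
move=> h hM; rewrite mem_filter hM andbT; apply/andP; split; first exact/statesP.
rewrite mem_undup; apply/mapP; exists [ffun x => inord (eta x)]; first by rewrite mem_enum.
apply/ffunP => x; rewrite !ffunE inordK// ltnS (leq_trans _ hM)//.
exact: le_tot.
Qed.

Lemma confs_states M eta : eta \in confs M -> states S eta.
Proof. by rewrite mem_filter => /andP[/andP[/statesP]]. Qed.

(* At a positive maximum over [0, T0] and the (finitely many) relevant
   configurations, the time derivative is nonnegative whereas the generator is
   nonpositive. *)
Lemma comparison (w dw : R -> conf n -> R) (T0 : R) (M : nat) : 0 < T0 ->
  (forall eta, states S eta -> w t eta @[t --> 0^'+] --> w 0 eta) ->
  (forall (t : R) eta, 0 < t -> states S eta -> is_derive t 1 (w^~ eta) (dw t eta)) ->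
  (forall (t : R) eta, 0 < t -> states S eta -> dw t eta < gen (w t) eta) ->
  (forall eta, states S eta -> w 0 eta <= 0) ->
  (forall (t : R) eta, 0 <= t <= T0 -> states S eta -> (M < tot eta)%N -> w t eta <= 0) ->
  forall (t : R) eta, 0 <= t <= T0 -> states S eta -> w t eta <= 0.
Proof.
move=> T00 w0 wd wgen winit winf t1 eta1 t1T heta1.
rewrite leNgt; apply/negP => w1.
have cts eta : states S eta -> {within `[0, T0], continuous (w^~ eta)}.
  move=> heta; apply/continuous_within_itvP => //; split.
  - move=> x; rewrite in_itv/= => /andP[x0 _].
    exact: is_derive_continuous (wd x eta x0 heta).
  - exact: w0.
  - apply: cvg_at_left_filter; exact: is_derive_continuous (wd T0 eta T00 heta).
have maxE eta : exists c, states S eta -> 0 <= c <= T0 /\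
    forall t, 0 <= t <= T0 -> w t eta <= w c eta.
  have [/cts h|nh] := pselect (states S eta); last by exists 0.
  have [c cT cmax] := EVT_max (ltW T00) h.
  by exists c => _; split => [|t tT]; [rewrite in_itv in cT|apply: cmax; rewrite in_itv].
have /choice[c cP] := maxE.
have eta1M : eta1 \in confs M.
  apply: mem_confs => //; rewrite leqNgt; apply/negP => /(winf t1 eta1 t1T heta1).
  by rewrite leNgt w1.
have [eta0 eta0M max0] := seq_argmax (fun eta => w (c eta) eta) eta1M.
have heta0 := confs_states eta0M.
have [c0T c0max] := cP eta0 heta0.
have wpos : 0 < w (c eta0) eta0.
  apply: lt_le_trans w1 _; apply: le_trans (max0 _ eta1M).
  by have [_] := cP eta1 heta1; exact.
(* With more than M particles the function is nonpositive, hence below the positive value found: the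
   maximum over the finite list is global. *)
have gmax zeta : states S zeta -> w (c eta0) zeta <= w (c eta0) eta0.
  move=> hz; have [zM|Mz] := leqP (tot zeta) M.
    apply: le_trans (max0 _ (mem_confs hz zM)).
    by have [_] := cP zeta hz; exact.
  by apply: le_trans (ltW wpos); exact: winf.
have c0 : 0 < c eta0.
  have /andP[+ _] := c0T; rewrite le_eqVlt => /orP[/eqP c0|//].
  by move: wpos; rewrite -c0 ltNge winit.
have := wgen (c eta0) eta0 c0 heta0; rewrite ltNge => /negP; apply.
apply: le_trans (generator_le0_at_max heta0 gmax) _.
apply: is_derive_ge0_left c0 (wd _ _ c0 heta0) _ => t /andP[t0 tc].
by apply: c0max; rewrite t0 (le_trans tc)//; case/andP: c0T.
Qed.

End Comparison.

(** * Lyapunov functions and growth of the duality functions *)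

Lemma sum_seq_le_esum (R : realType) (T : choiceType) (D : set T) (a : T -> \bar R)
    (s : seq T) : uniq s -> (forall x, x \in s -> D x) ->
  (\sum_(x <- s) a x <= \esum_(x in D) a x)%E.
Proof.
move=> us sD; apply: esum_ge; exists [set` s]; last by rewrite -fsbig_seq.
split; first exact: finite_seq.
by move=> x /= /sD.
Qed.

Lemma esum_le_seq (R : realType) (T : choiceType) (D : set T) (a : T -> \bar R)
    (b : \bar R) :
  (forall s : seq T, uniq s -> (forall x, x \in s -> D x) ->
     (\sum_(x <- s) a x <= b)%E) ->
  (\esum_(x in D) a x <= b)%E.
Proof.
move=> H; apply: ge_ereal_sup => /= _ [A [finA AD] <-].
rewrite fsbig_finite//; apply: H; first exact: finmap.fset_uniq.
by move=> x; rewrite in_fset_set// inE => /AD.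
Qed.

Lemma is_derive_sumr (R : realType) (J : eqType) (l : seq J) (a : J -> R)
    (f : J -> R -> R) (df : J -> R) (x : R) :
  (forall j, j \in l -> is_derive x 1 (f j) (df j)) ->
  is_derive x 1 (fun y => \sum_(j <- l) a j * f j y) (\sum_(j <- l) a j * df j).
Proof.
elim: l => [|j l IH] H.
  rewrite big_nil (_ : (fun y => _) = cst 0); first exact: is_derive_cst.
  by apply/funext => y; rewrite big_nil.
rewrite big_cons (_ : (fun y => _) =
    (fun y => a j * f j y) + (fun y => \sum_(i <- l) a i * f i y)); last first.
  by apply/funext => y; rewrite big_cons.
have d1 : is_derive x 1 (f j) (df j) by apply: H; exact: mem_head.
have d2 : is_derive x 1 (fun y => \sum_(i <- l) a i * f i y) (\sum_(i <- l) a i * df i).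
  by apply: IH => i il; apply: H; rewrite in_cons il orbT.
have d3 : is_derive x 1 (fun y => a j * f j y) (a j * df j).
  exact: (is_deriveZ (a j) d1).
exact: is_deriveD.
Qed.

Lemma cvg_sumr_seq (R : realType) (J : eqType) (l : seq J) (a : J -> R)
    (T : Type) (F : set_system T) (FF : Filter F) (f : J -> T -> R) (b : J -> R) :
  (forall j, j \in l -> f j y @[y --> F] --> b j) ->
  (\sum_(j <- l) a j * f j y) @[y --> F] --> \sum_(j <- l) a j * b j.
Proof.
elim: l => [|j l IH] H.
  rewrite big_nil (_ : (fun y => _) = cst 0); first exact: cvg_cst.
  by apply/funext => y; rewrite big_nil.
rewrite big_cons (_ : (fun y => _) =
    (fun y => a j * f j y + \sum_(i <- l) a i * f i y)); last first.
  by apply/funext => y; rewrite big_cons.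
apply: cvgD; last by apply: IH => i il; apply: H; rewrite in_cons il orbT.
by apply: cvgMl_tmp; apply: H; exact: mem_head.
Qed.

(** By the binomial formula the left side is a sum of powers at most m^k, with coefficients adding
    up to 2^k - 1. *)
Lemma pow_incr_le (R : realDomainType) (m : R) (k : nat) : 1 <= m ->
  m * ((m + 1) ^+ k - m ^+ k) <= (2 ^+ k - 1) * m ^+ k.
Proof.
move=> m1; elim: k => [|k IH]; first by rewrite !expr0 !subrr mulr0 mul0r.
have mk : 0 <= m ^+ k by rewrite exprn_ge0// (le_trans ler01).
have k2 : 0 <= 2 ^+ k - 1 :> R by rewrite subr_ge0 exprn_ege1// ler1n.
apply: (@le_trans _ _ ((m + 1) * ((2 ^+ k - 1) * m ^+ k) + m * m ^+ k)).
  have -> : m * ((m + 1) ^+ k.+1 - m ^+ k.+1) =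
    (m + 1) * (m * ((m + 1) ^+ k - m ^+ k)) + m * m ^+ k by rewrite !exprS; ring.
  by rewrite lerD2r ler_wpM2l// addr_ge0// (le_trans ler01).
apply: (@le_trans _ _ ((2 * m) * ((2 ^+ k - 1) * m ^+ k) + m * m ^+ k)).
  by rewrite lerD2r ler_wpM2r ?mulr_ge0// mulr_natl mulr2n lerD2l.
by rewrite le_eqVlt; apply/orP; left; apply/eqP; rewrite !exprS; ring.
Qed.

Section DualSemigroup.
Variables (R : realType) (n : nat) (S : bd_system R n).
Hypothesis hS : bd_system_ok S.
Hypothesis hsigma : sigma S = -1 \/ sigma S = 1.

Local Notation V := 'I_n.+1.
Local Notation sg := ((sigma S)%:~R : R).
Local Notation al x := ((alpha S x)%:R : R).
Local Notation gen := (generator S).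
Local Notation D := (dual_fun S).
Implicit Types (x y : V) (eta zeta : conf n) (xi : dconf n) (K M : nat).

Definition dsize xi : nat := (tot xi.1 + (xi.2.1 + xi.2.2))%N.

Definition dconfs K : seq (dconf n) :=
  [seq z <- undup [seq ([ffun x => f.1 x : nat], (f.2.1 : nat, f.2.2 : nat))
                   | f : {ffun V -> 'I_K.+1} * ('I_K.+1 * 'I_K.+1)]
     | stateb S z.1 & dsize z == K].

Lemma dconfs_uniq K : uniq (dconfs K).
Proof. by rewrite filter_uniq// undup_uniq. Qed.

Lemma dconfsP xi K : reflect (states S xi.1 /\ dsize xi = K) (xi \in dconfs K).
Proof.
clear hS hsigma; apply: (iffP idP) => [|[h hK]].
  by rewrite mem_filter => /andP[/andP[/statesP h /eqP]].
rewrite mem_filter hK eqxx andbT; apply/andP; split; first exact/statesP.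
rewrite mem_undup; apply/mapP.
have hl : (xi.2.1 < K.+1)%N by rewrite -hK /dsize; lia.
have hr : (xi.2.2 < K.+1)%N by rewrite -hK /dsize; lia.
exists ([ffun x => inord (xi.1 x)], (inord xi.2.1, inord xi.2.2)).
  by rewrite mem_enum.
case: xi hK hl hr {h} => [b [l r]] /= hK hl hr; rewrite !inordK//; congr (_, _).
apply/ffunP => x; rewrite !ffunE inordK// -hK /dsize /= ltnS.
by rewrite (leq_trans (le_tot x b))// leq_addr.
Qed.

Lemma drate_ge0 K m xi : xi \in dconfs K -> 0 <= drate S m xi.
Proof.
move=> /dconfsP[h _]; case: m => [[x y]|[]]/=.
- by rewrite !mulr_ge0 ?room_ge0// (omega_ge0 hS).
- by rewrite !mulr_ge0// ?(omegaL_ge0 hS)// ltW// (alphaL_gt0 hS).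
- by rewrite !mulr_ge0// ?(omegaR_ge0 hS)// ltW// (alphaR_gt0 hS).
Qed.

Lemma dmove_dconfs K m xi : xi \in dconfs K -> drate S m xi != 0 ->
  dmove m xi \in dconfs K.
Proof.
move=> /dconfsP[h hK]; rewrite /dsize in hK.
case: m => [[x y]|[]]/=; rewrite !mulf_eq0 !negb_or.
- rewrite pnatr_eq0 -lt0n => /andP[/andP[_ x0] y0].
  by apply/dconfsP; split; [exact: states_move|rewrite /dsize/= tot_move].
- rewrite pnatr_eq0 -lt0n => /andP[_ x0].
  apply/dconfsP; split; first exact: states_decr.
  by rewrite /dsize /=; have := tot_decr x0; lia.
- rewrite pnatr_eq0 -lt0n => /andP[_ x0].
  apply/dconfsP; split; first exact: states_decr.
  by rewrite /dsize /=; have := tot_decr x0; lia.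
Qed.

Lemma weight_ge1 x k : (sigma S = -1 -> (k <= alpha S x)%N) -> 1 <= weight S x k.
Proof.
move=> kx; rewrite /weight; case: hsigma => s; rewrite s/=.
  by rewrite ler1n ffact_gt0 kx.
rewrite ler_pdivlMr ?ltr0n ?fact_gt0// mul1r ler_nat; apply: leq_fact.
by rewrite -!subn1 leq_sub2r// leq_addr.
Qed.

Lemma ffact_le_exp (a k : nat) : (a ^_ k <= a ^ k)%N.
Proof.
elim: k => // k IH; rewrite ffactnSr expnSr leq_mul// leq_subr//.
Qed.

Lemma site_ge0 x k a : (sigma S = -1 -> (k <= alpha S x)%N) ->
  0 <= dual_cl_site S x k a.
Proof.
by move=> kx; rewrite /dual_cl_site divr_ge0// (le_trans ler01)// weight_ge1.
Qed.

Lemma site_le x k a : (sigma S = -1 -> (k <= alpha S x)%N) ->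
  dual_cl_site S x k a <= a%:R ^+ k.
Proof.
move=> kx; have w1 := weight_ge1 kx; rewrite /dual_cl_site.
rewrite ler_pdivrMr ?(lt_le_trans ltr01)// (@le_trans _ _ (a%:R ^+ k))//.
  by rewrite -natrX ler_nat ffact_le_exp.
by rewrite ler_peMr// exprn_ge0.
Qed.

(** A crude bound, uniform in how the at most K absorbed particles are divided between the
    reservoirs: since 1 + theta >= 1, every exponent may be raised to K. *)
Definition dual_bound K : R := ((1 + thetaL S) * (1 + thetaR S)) ^+ K.

Lemma thetaL_ge0 : 0 <= thetaL S. Proof. by have [] := thetaL_ok hS. Qed.

Lemma thetaR_ge0 : 0 <= thetaR S. Proof. by have [] := thetaR_ok hS. Qed.

Lemma dual_bound_gt0 K : 0 < dual_bound K.
Proof.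
by rewrite exprn_gt0// mulr_gt0// ltr_wpDr// ?thetaL_ge0 ?thetaR_ge0.
Qed.

Lemma dual_fun_ge0 xi eta : states S xi.1 -> 0 <= D xi eta.
Proof.
move=> h; rewrite /dual_fun /dual_cl !mulr_ge0 ?exprn_ge0 ?thetaL_ge0 ?thetaR_ge0//.
by apply: prodr_ge0 => x _; apply: site_ge0 => s; exact: h.
Qed.

Lemma reservoirs_le (l r K : nat) : (l + r <= K)%N ->
  thetaL S ^+ l * thetaR S ^+ r <= dual_bound K.
Proof.
move=> lrK; have tl := thetaL_ge0; have tr := thetaR_ge0.
rewrite /dual_bound exprMn ler_pM ?exprn_ge0//.
- apply: (@le_trans _ _ ((1 + thetaL S) ^+ l)); first by rewrite lerXn2r ?nnegrE ?addr_ge0 ?lerDr.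
  by rewrite ler_weXn2l ?lerDl//; lia.
- apply: (@le_trans _ _ ((1 + thetaR S) ^+ r)); first by rewrite lerXn2r ?nnegrE ?addr_ge0 ?lerDr.
  by rewrite ler_weXn2l ?lerDl//; lia.
Qed.

Lemma dual_fun_le K xi eta : xi \in dconfs K ->
  D xi eta <= dual_bound K * (1 + tot eta)%:R ^+ K.
Proof.
move=> /dconfsP[h hK]; rewrite /dual_fun/dual_cl/= mulrAC ler_pM//.
- by rewrite mulr_ge0 ?exprn_ge0 ?thetaL_ge0 ?thetaR_ge0.
- by apply: prodr_ge0 => x _; apply: site_ge0 => s; exact: h.
- by apply: reservoirs_le; move: hK; rewrite /dsize; lia.
apply: (@le_trans _ _ (\prod_x (1 + tot eta)%:R ^+ xi.1 x)).
  apply: ler_prod => x _; have hx : sigma S = -1 -> (xi.1 x <= alpha S x)%N.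
    by move=> s; exact: h.
  rewrite site_ge0//= (le_trans (site_le _ hx))// lerXn2r ?nnegrE// ler_nat.
  by rewrite (leq_trans (le_tot x eta))// leq_addl.
rewrite -expr_sum -/(tot _) ler_weXn2l ?ler1n//.
by move: hK; rewrite /dsize; lia.
Qed.

Definition lyap K eta : R := (1 + tot eta)%:R ^+ K.

(** Deaths decrease [lyap K]. A birth rate at most linear in the number of particles meets an
    increment of one power less, which [pow_incr_le] balances. *)
Lemma lyap_boundary_le K b (a th : R) eta : 0 < a -> in_Theta (sigma S) th ->
  states S eta ->
  gen_boundary S b a th (lyap K) eta <= a * th * ((al b + 1) * 2 ^+ K) * lyap K eta.
Proof.
move=> a0 hth heta; have [th0 _] := hth; rewrite /gen_boundary -[leRHS]add0r lerD//.
  rewrite mulr_ge0_le0//; first by rewrite !mulr_ge0 ?Theta_ge0// ltW.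
  rewrite subr_le0 /lyap lerXn2r ?nnegrE// ler_nat leq_add2l leq_sum// => x _.
  by rewrite ffunE leq_subr.
rewrite -!mulrA; apply: ler_wpM2l; first exact: ltW.
apply: ler_wpM2l => //.
set m : R := (1 + tot eta)%:R.
have m1 : 1 <= m by rewrite ler1n.
have -> : lyap K (incr b eta) = (m + 1) ^+ K.
  by rewrite /lyap tot_incr addnS -natr1.
have room : al b + sg * (eta b)%:R <= (al b + 1) * m.
  apply: (@le_trans _ _ (al b + (tot eta)%:R)).
    rewrite lerD2l; apply: (@le_trans _ _ (eta b)%:R); last by rewrite ler_nat le_tot.
    by case: hsigma => s; rewrite s ?mulN1r ?mul1r// (le_trans (y := 0)) ?oppr_le0.
  rewrite /m natrD mulrDl !mulrDr !mul1r !mulr1.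
  rewrite -addrA lerD2l [leRHS]addrA lerDr addr_ge0// mulr_ge0//.
have mono : 0 <= (m + 1) ^+ K - m ^+ K.
  by rewrite subr_ge0 lerXn2r ?nnegrE ?lerDl// ?addr_ge0// (le_trans ler01).
apply: (le_trans (ler_wpM2r mono room)); rewrite -[leLHS]mulrA ler_wpM2l ?addr_ge0//.
apply: (le_trans (pow_incr_le K m1)); rewrite ler_wpM2r ?gerBl//.
by rewrite exprn_ge0// (le_trans ler01).
Qed.

Lemma lyap_gen K : exists2 C, 0 <= C &
  forall eta, states S eta -> gen (lyap K) eta < C * lyap K eta.
Proof.
set CL := omegaL S * (alphaL S * thetaL S * ((al ord0 + 1) * 2 ^+ K)).
set CR := omegaR S * (alphaR S * thetaR S * ((al ord_max + 1) * 2 ^+ K)).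
have hl := omegaL_ge0 hS; have hr := omegaR_ge0 hS.
have al0 := alphaL_gt0 hS; have ar0 := alphaR_gt0 hS.
have CL0 : 0 <= CL by rewrite !mulr_ge0 ?addr_ge0 ?exprn_ge0 ?thetaL_ge0 ?(ltW al0).
have CR0 : 0 <= CR by rewrite !mulr_ge0 ?addr_ge0 ?exprn_ge0 ?thetaR_ge0 ?(ltW ar0).
(* Bulk moves conserve [tot], so only the reservoirs count; the extra 1 gives the strict inequality
   that [comparison] asks for. *)
exists (CL + CR + 1); first by rewrite !addr_ge0.
move=> eta heta; rewrite (generator_sum hS) big1 ?add0r; last first.
  move=> x _; rewrite big1// => y _.
  have [->|x0] := posnP (eta x); first by rewrite !mul0r mulr0.
  by rewrite /lyap tot_move// subrr !mulr0.
rewrite !mulrDl mul1r; apply: (@le_lt_trans _ _ (CL * lyap K eta + CR * lyap K eta)).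
  rewrite lerD// -mulrA ler_wpM2l// lyap_boundary_le//.
    exact: thetaL_ok.
  exact: thetaR_ok.
by rewrite ltrDl /lyap exprn_gt0// ltr0n.
Qed.

Variable p : R -> conf n -> conf n -> R.
Hypothesis hp : is_markov_process S p.

Definition dsg K t (g : dconf n -> R) xi : R :=
  jsg (drate S) (@dmove n) (dconfs K) t g xi.

Lemma dsg_ge0 K t g xi : 0 <= t -> (forall z, z \in dconfs K -> 0 <= g z) ->
  xi \in dconfs K -> 0 <= dsg K t g xi.
Proof.
by move=> t0 g0 hxi; apply: jsg_ge0 => //; [exact: drate_ge0|exact: dmove_dconfs].
Qed.

Lemma dsg_kernel K t (g : dconf n -> R) xi : xi \in dconfs K ->
  dsg K t g xi = \sum_(s' <- dconfs K)
    g s' * jker (drate S) (@dmove n) (dconfs K) t xi s'.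
Proof.
move=> hxi; apply: jsg_kernel => //; last exact: dconfs_uniq.
  exact: drate_ge0.
exact: dmove_dconfs.
Qed.

(** The generator acts on the variable [eta] only, so it passes through the finite kernel expansion
    to each duality function, where duality of the generators applies. *)
Lemma generator_dsg K xi t eta : xi \in dconfs K -> states S eta ->
  gen (fun z => dsg K t (D^~ z) xi) eta =
  dsg K t (jgen (drate S) (@dmove n) (D^~ eta)) xi.
Proof.
move=> hxi heta; have kE g := dsg_kernel t g hxi.
rewrite kE (_ : (fun z => _) = fun z : conf n => \sum_(s' <- dconfs K)
    jker (drate S) (@dmove n) (dconfs K) t xi s' * D s' z); last first.
  by apply/funext => z; rewrite kE; apply: eq_bigr => s' _; rewrite mulrC.
rewrite (generator_sumr hS) !big_seq; apply: eq_bigr => s' /dconfsP[s'S _].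
by rewrite (duality hS hsigma)// mulrC.
Qed.

Lemma trans_sum_le1 M t eta : 0 <= t -> states S eta ->
  \sum_(zeta <- confs S M) p t eta zeta <= 1.
Proof.
move=> t0 heta; rewrite -lee_fin -(trans_sum1 hp t0 heta) -sumEFin.
apply: sum_seq_le_esum; first exact: confs_uniq.
by move=> x /confs_states.
Qed.

Lemma trans_le1 t eta zeta : 0 <= t -> states S eta -> states S zeta ->
  p t eta zeta <= 1.
Proof.
move=> t0 he hz; rewrite -lee_fin -(trans_sum1 hp t0 he).
have := @sum_seq_le_esum _ _ (states S) (fun z => (p t eta z)%:E) [:: zeta].
by rewrite big_seq1; apply => // x; rewrite inE => /eqP ->.
Qed.

End DualSemigroup.

Lemma mem_confs_tot (R : realType) (n : nat) (S : bd_system R n) M (eta : conf n) :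
  eta \in confs S M -> (tot eta <= M)%N.
Proof. by rewrite mem_filter => /andP[/andP[]]. Qed.

(** * Approximate duality for truncated expectations *)

Section SemigroupDuality.
Variables (R : realType) (n : nat) (S : bd_system R n).
Hypothesis hS : bd_system_ok S.
Hypothesis hsigma : sigma S = -1 \/ sigma S = 1.
Variable p : R -> conf n -> conf n -> R.
Hypothesis hp : is_markov_process S p.

Local Notation gen := (generator S).
Local Notation D := (dual_fun S).
Local Notation lyap := (@lyap R n).
Implicit Types (eta zeta : conf n) (xi : dconf n) (K M : nat) (t : R).

(** Truncating the target configurations keeps the sum finite, so that it solves the backward
    equation by termwise use of [trans_generator]. *)
Definition trunc_sg M xi t eta : R :=
  \sum_(zeta <- confs S M) D xi zeta * p t eta zeta.

Lemma trunc_sg0 M xi eta : states S eta ->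
  trunc_sg M xi 0 eta = if (tot eta <= M)%N then D xi eta else 0.
Proof.
move=> heta; rewrite /trunc_sg.
have pE zeta : zeta \in confs S M -> p 0 eta zeta = (eta == zeta)%:R.
  by move=> /confs_states hz; exact: (trans_0 hp).
case: leqP => etaM.
  rewrite (bigD1_seq eta) ?confs_uniq ?mem_confs//= pE ?mem_confs// eqxx mulr1.
  rewrite big_seq_cond big1 ?addr0// => zeta /andP[/pE -> /negbTE].
  by rewrite eq_sym => ->; rewrite mulr0.
rewrite big_seq big1// => zeta hz; rewrite pE//.
have := mem_confs_tot hz; case: eqVneq => [<-|_ _]; last by rewrite mulr0.
by rewrite leqNgt etaM.
Qed.

Lemma trunc_sg_le K M xi t eta : xi \in dconfs S K -> 0 <= t -> states S eta ->
  0 <= trunc_sg M xi t eta <= dual_bound S K * (1 + M)%:R ^+ K.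
Proof.
move=> hxi t0 heta; have /dconfsP[hxi1 _] := hxi.
have p0 zeta : zeta \in confs S M -> 0 <= p t eta zeta.
  by move=> /confs_states hz; exact: (trans_ge0 hp).
rewrite /trunc_sg big_seq; apply/andP; split.
  by apply: sumr_ge0 => zeta hz; rewrite mulr_ge0 ?p0 ?dual_fun_ge0.
have B0 := ltW (dual_bound_gt0 hS K).
rewrite -[leRHS]mulr1 (le_trans (y := dual_bound S K * (1 + M)%:R ^+ K *
    \sum_(zeta <- confs S M) p t eta zeta))//; last first.
  by rewrite ler_wpM2l ?(trans_sum_le1 hp)// mulr_ge0// exprn_ge0.
rewrite [in leRHS]big_seq mulr_sumr ler_sum// => zeta hz.
rewrite ler_wpM2r ?p0// (le_trans (dual_fun_le hS hsigma _ hxi))//.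
rewrite ler_wpM2l// lerXn2r ?nnegrE//.
by rewrite ler_nat leq_add2l (mem_confs_tot hz).
Qed.

Lemma dsg_le K xi t eta : xi \in dconfs S K -> 0 <= t ->
  0 <= dsg S K t (D^~ eta) xi <= dual_bound S K * (1 + tot eta)%:R ^+ K.
Proof.
move=> hxi t0; rewrite dsg_ge0//= => [|z /dconfsP[hz _]]; last exact: dual_fun_ge0.
apply: le_trans (ler_norm _) _.
apply: jsg_norm_le => //; [exact: drate_ge0|exact: dmove_dconfs|].
move=> z hz; have /dconfsP[hz1 _] := hz.
by rewrite ger0_norm ?dual_fun_ge0// dual_fun_le.
Qed.

Lemma generator_comb (e d k : R) (f g h : conf n -> R) eta :
  gen (fun z => e * (f z - g z) - d * (k * h z)) eta =
  e * (gen f eta - gen g eta) - d * (k * gen h eta).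
Proof.
rewrite (_ : (fun z => _) = fun z : conf n =>
    e * f z + (- e * g z + (- (d * k) * h z + 0))); last first.
  by apply/funext => z; ring.
by rewrite !(generator_linear hS) (generator0 hS); ring.
Qed.

(* Both sides of the difference solve the backward equation up to the error term,
   which is a strict supersolution dominating them at infinity. No a priori
   bound on the moments of the process is needed. *)
Lemma semigroup_approx K xi : xi \in dconfs S K -> exists C,
  forall M t eta, 0 <= t -> states S eta ->
    `|trunc_sg M xi t eta - dsg S K t (D^~ eta) xi| <=
      dual_bound S K / (1 + M)%:R * (expR (C * t) * lyap K.+1 eta).
Proof.
move=> hxi; have [C C0 lyapC] := lyap_gen hS hsigma K.+1; exists C => M t eta t0 heta.
have B0 := dual_bound_gt0 hS K.
set delta := dual_bound S K / (1 + M)%:R.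
have d0 : 0 < delta by rewrite divr_gt0// ltr0n.
have /dconfsP[hxi1 _] := hxi.
(* Both signs of the difference are treated at once, with [e] equal to 1 or -1. *)
suff H (e : R) : `|e| = 1 ->
    e * (trunc_sg M xi t eta - dsg S K t (D^~ eta) xi)
      - delta * (expR (C * t) * lyap K.+1 eta) <= 0.
  have := H 1 (normr1 _); have := H (-1); rewrite normrN1 => /(_ erefl).
  by rewrite !subr_le0 mul1r mulN1r ler_norml lerNl => -> ->.
move=> e1.
pose dw s z := e * (gen (trunc_sg M xi s) z - gen (fun z' => dsg S K s (D^~ z') xi) z)
  - delta * (C * expR (C * s) * lyap K.+1 z).
pose w s z := e * (trunc_sg M xi s z - dsg S K s (D^~ z) xi)
  - delta * (expR (C * s) * lyap K.+1 z).
rewrite -/(w t eta).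
set B := dual_bound S K * (1 + M)%:R ^+ K.
have B1 : 0 <= B by rewrite mulr_ge0 ?(ltW B0)// exprn_ge0.
have dtr (s : R) z : 0 < s -> states S z ->
    is_derive s 1 ((trunc_sg M xi)^~ z) (gen (trunc_sg M xi s) z).
  move=> s0 hz; rewrite /trunc_sg (generator_sumr hS).
  apply: is_derive_sumr => zeta /confs_states hzeta.
  exact: (trans_generator hp).
have ddsg (s : R) z : states S z -> is_derive s 1 (fun s => dsg S K s (D^~ z) xi)
    (gen (fun z' => dsg S K s (D^~ z') xi) z).
  move=> hz; rewrite (generator_dsg hS hsigma)// /dsg.
  by apply: jsg_derive => //; [exact: drate_ge0|exact: dmove_dconfs].
have dexp (s : R) z : is_derive s 1 (fun s => delta * (expR (C * s) * lyap K.+1 z))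
    (delta * (C * expR (C * s) * lyap K.+1 z)).
  have de := is_derive_expRM C s.
  apply: is_derive_eq; rewrite /GRing.scale/=; ring.
(* Beyond [B / delta] particles the extra factor [1 + tot z] of the barrier outweighs the bound
   [B]. *)
apply: (@comparison _ _ S hS hsigma w dw (t + 1)
    (Num.bound (B / delta))) => //.
- by rewrite ltr_wpDl.
- move=> z hz; rewrite /w; apply: cvgB; last first.
    by apply: cvg_at_right_filter; exact: is_derive_continuous (dexp 0 z).
  apply: cvgMl_tmp; apply: cvgB; last first.
    by apply: cvg_at_right_filter; exact: is_derive_continuous (ddsg 0 z hz).
  apply: cvg_sumr_seq => zeta /confs_states hzeta.
  exact: (trans_cvg0 hp).
- move=> s z s0 hz; have d1 := dtr s z s0 hz; have d2 := ddsg s z hz.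
  have d3 := dexp s z; rewrite /dw /w.
  apply: is_deriveB.
- move=> s z s0 hz; rewrite /dw /w generator_comb ltrD2l ltrN2 ltr_pM2l//.
  by rewrite -mulrA mulrCA ltr_pM2l ?expR_gt0// lyapC.
(* At time 0 the truncation loses only configurations with more than M particles, where (1 + tot z)
   / (1 + M) is at least 1: hence the form of [delta]. *)
- move=> z hz; rewrite /w trunc_sg0// /dsg jsg0 mulr0 expR0 mul1r subr_le0.
  have L0 : 0 <= lyap K.+1 z by rewrite exprn_ge0.
  case: leqP => zM; first by rewrite subrr mulr0 mulr_ge0// ltW.
  rewrite sub0r (le_trans (ler_norm _))// normrM e1 mul1r normrN.
  rewrite ger0_norm ?dual_fun_ge0// (le_trans (dual_fun_le hS hsigma _ hxi))//.
  rewrite /delta /lyap exprS mulrA ler_wpM2r ?exprn_ge0//.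
  rewrite -mulrA ler_peMr ?(ltW B0)// ler_pdivlMl ?ltr0n// mulr1 ler_nat.
  by rewrite leq_add2l ltnW.
- move=> s z /andP[s0 _] hz zM; rewrite /w subr_le0 (le_trans (ler_norm _))//.
  rewrite normrM e1 mul1r.
  have /andP[tr0 trB] := trunc_sg_le M hxi s0 hz.
  have /andP[ds0 dsB] := dsg_le z hxi s0.
  set P := (1 + tot z)%:R ^+ K in dsB *.
  have P1 : 1 <= P by rewrite exprn_ege1// ler1n.
  have hm : `|trunc_sg M xi s z - dsg S K s (D^~ z) xi| <= B * P.
    rewrite ler_distlC; apply/andP; split.
      by rewrite (le_trans _ ds0)// subr_le0 (le_trans trB)// ler_peMr.
    rewrite (le_trans dsB)// -[leLHS]add0r lerD// ler_wpM2r ?(le_trans _ P1)//.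
    by rewrite /B ler_peMr ?(ltW B0)// exprn_ege1// ler1n.
  rewrite (le_trans hm)// /lyap exprS -/P !mulrA ler_wpM2r ?(le_trans _ P1)//.
  have Bm : B <= delta * (1 + tot z)%:R.
    rewrite -ler_pdivrMl// mulrC.
    have /ltW := archi_boundP (divr_ge0 B1 (ltW d0)); move/le_trans; apply.
    by rewrite ler_nat (leq_trans (ltnW zM))// leq_addl.
  rewrite (le_trans Bm)// ler_wpM2r// ler_peMr ?(ltW d0)//.
  by rewrite -[leLHS]expR0 ler_expR mulr_ge0.
- by rewrite t0 lerDl ler01.
Qed.

End SemigroupDuality.

(** * Duality of the semigroups *)

Lemma esum_exchange (R : realType) (T1 T2 : choiceType) (I : set T1) (J : set T2)
    (a : T1 -> T2 -> \bar R) : (forall i j, I i -> J j -> (0 <= a i j)%E) ->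
  (\esum_(i in I) \esum_(j in J) a i j = \esum_(j in J) \esum_(i in I) a i j)%E.
Proof.
move=> a0; rewrite !esum_esum//; last by move=> j i Jj Ii; exact: a0.
rewrite (reindex_esum (J `*`` (fun=> I)) _ (fun x => (x.2, x.1)))//.
split=> [[j i] [/= ? ?]//|[j i] [j' i'] _ _ /= [-> ->]//|[i j] [/= Ii Jj]].
by exists (j, i).
Qed.

Lemma esumZl (R : realType) (T : choiceType) (D : set T) (c : R) (a : T -> \bar R) :
  0 <= c -> (forall i, D i -> (0 <= a i)%E) ->
  (\esum_(i in D) (c%:E * a i) = c%:E * \esum_(i in D) a i)%E.
Proof.
have le (d : R) (b : T -> \bar R) : 0 <= d -> (forall i, D i -> (0 <= b i)%E) ->
    (\esum_(i in D) (d%:E * b i) <= d%:E * \esum_(i in D) b i)%E.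
  move=> d0 b0; apply: esum_le_seq => s us sD.
  rewrite big_seq -ge0_sume_distrr; last by move=> i /sD /b0.
  by rewrite -big_seq lee_wpmul2l ?lee_fin// sum_seq_le_esum.
move=> c0 a0; apply/eqP; rewrite eq_le le//=.
have [->|cN0] := eqVneq c 0.
  by rewrite mul0e esum_ge0// => i _; rewrite mul0e.
have cP : 0 < c by rewrite lt_neqAle eq_sym cN0.
rewrite -lee_pdivlMl// (le_trans _ (le c^-1 (fun i => c%:E * a i)%E _ _))//.
- apply: le_esum => i Di; rewrite muleA -EFinM mulVf// mul1e.
  exact: lexx.
- by rewrite invr_ge0.
- by move=> i Di; rewrite mule_ge0 ?a0.
Qed.

Lemma ler_sum_subset_seq (R : numDomainType) (T : eqType) (s s' : seq T) (F : T -> R) :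
  uniq s -> uniq s' -> {subset s <= s'} -> (forall x, x \in s' -> 0 <= F x) ->
  \sum_(x <- s) F x <= \sum_(x <- s') F x.
Proof.
move=> us us' ss' F0.
have -> : \sum_(x <- s) F x = \sum_(x <- s' | x \in s) F x.
  rewrite -[RHS]big_filter; apply: perm_big.
  apply: uniq_perm; rewrite ?filter_uniq// => x; rewrite mem_filter.
  by case: (boolP (x \in s)) => //= /ss'.
rewrite [leRHS](bigID (mem s))/= lerDl big_seq_cond sumr_ge0// => x.
by move=> /andP[/F0].
Qed.

Section Laws.
Variables (R : realType) (n : nat) (S : bd_system R n).
Hypothesis hS : bd_system_ok S.
Hypothesis hsigma : sigma S = -1 \/ sigma S = 1.
Variable p : R -> conf n -> conf n -> R.
Hypothesis hp : is_markov_process S p.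

Local Notation D := (dual_fun S).
Implicit Types (eta zeta : conf n) (xi : dconf n) (K M : nat) (t : R).

Lemma seq_tot_bound (s : seq (conf n)) : exists M, forall z, z \in s -> (tot z <= M)%N.
Proof.
elim: s => [|a s [M HM]]; first by exists 0%N.
exists (maxn (tot a) M) => z; rewrite in_cons => /orP[/eqP->|/HM zM].
  exact: leq_maxl.
by rewrite (leq_trans zM)// leq_maxr.
Qed.

(** As M grows, the error in [semigroup_approx] vanishes while the truncated sums exhaust a series
    with nonnegative terms. *)
Lemma esum_dual_fun K xi t eta : xi \in dconfs S K -> 0 <= t -> states S eta ->
  (\esum_(zeta in states S) (D xi zeta * p t eta zeta)%:E =
   (dsg S K t (D^~ eta) xi)%:E)%E.
Proof.
move=> hxi t0 heta; have [C HC] := semigroup_approx hS hsigma hp hxi.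
have /dconfsP[hxi1 _] := hxi.
have pos zeta : states S zeta -> 0 <= D xi zeta * p t eta zeta.
  by move=> hz; rewrite mulr_ge0 ?dual_fun_ge0// (trans_ge0 hp).
have close M0 (e : R) : 0 < e -> exists2 M, (M0 <= M)%N &
    `|trunc_sg S p M xi t eta - dsg S K t (D^~ eta) xi| <= e.
  move=> e0; set Z := dual_bound S K * (expR (C * t) * lyap R K.+1 eta).
  have Z0 : 0 <= Z.
    by rewrite mulr_ge0// ?(ltW (dual_bound_gt0 hS K))// mulr_ge0 ?expR_ge0// exprn_ge0.
  exists (M0 + Num.bound (Z / e))%N; first exact: leq_addr.
  apply: le_trans (HC _ _ _ t0 heta) _.
  rewrite mulrAC -/Z ler_pdivrMr ?ltr0n// mulrC -ler_pdivrMr//.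
  have /ltW := archi_boundP (divr_ge0 Z0 (ltW e0)); move/le_trans; apply.
  by rewrite ler_nat addnA leq_addl.
apply/eqP; rewrite eq_le; apply/andP; split.
  apply: esum_le_seq => s us sS; rewrite sumEFin lee_fin.
  apply/ler_addgt0Pr => e e0.
  have [M0 sM0] := seq_tot_bound s; have [M M0M] := close M0 e e0.
  rewrite ler_distlC => /andP[+ _]; rewrite lerBlDr; apply: le_trans.
  apply: ler_sum_subset_seq; rewrite ?confs_uniq//.
    move=> x xs; apply: mem_confs; first exact: sS.
    exact: leq_trans (sM0 x xs) M0M.
  by move=> x /confs_states /pos.
apply/lee_addgt0Pr => e e0; have [M _] := close 0%N e e0.
rewrite ler_distlC => /andP[_]; rewrite -lee_fin => /le_trans; apply.
rewrite EFinD leeD2r// /trunc_sg -sumEFin; apply: sum_seq_le_esum.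
  exact: confs_uniq.
by move=> x /confs_states.
Qed.

(** Moments at time t are the dual semigroup applied to those at time 0: Tonelli, then the finite
    kernel expansion. It serves for the local equilibrium and for the stationary measure alike. The
    bound on the mass makes [law_at] a finite sum. *)
Lemma esum_dual_law K xi t (rho m_ : _ -> R) :
  xi \in dconfs S K -> 0 <= t ->
  (forall eta, states S eta -> 0 <= rho eta) ->
  (\esum_(eta in states S) (rho eta)%:E <= 1)%E ->
  (forall xi', xi' \in dconfs S K ->
     \esum_(eta in states S) (D xi' eta * rho eta)%:E = (m_ xi')%:E)%E ->
  (\esum_(zeta in states S) (D xi zeta * law_at S p rho t zeta)%:E =
    (dsg S K t m_ xi)%:E)%E.
Proof.
move=> hxi t0 rho0 rho1 m_E; have /dconfsP[hxi1 _] := hxi.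
have p0 eta zeta : states S eta -> states S zeta -> 0 <= p t eta zeta.
  by move=> he hz; rewrite (trans_ge0 hp).
have p1 eta zeta : states S eta -> states S zeta -> p t eta zeta <= 1.
  exact: (trans_le1 hp).
have lawE zeta : states S zeta -> (law_at S p rho t zeta)%:E =
    (\esum_(eta in states S) (rho eta * p t eta zeta)%:E)%E.
  move=> hz; rewrite /law_at fineK// ge0_fin_numE; last first.
    by apply: esum_ge0 => eta he; rewrite lee_fin mulr_ge0 ?rho0 ?p0.
  apply: le_lt_trans (ltry 1); apply: le_trans rho1; apply: le_esum => eta he.
  by rewrite lee_fin ler_piMr ?rho0 ?p1.
transitivity (\esum_(zeta in states S) \esum_(eta in states S)
    (D xi zeta * (rho eta * p t eta zeta))%:E)%E.
  apply: eq_esum => zeta hz; rewrite EFinM lawE// -esumZl ?dual_fun_ge0//.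
  by move=> eta he; rewrite lee_fin mulr_ge0 ?rho0 ?p0.
rewrite esum_exchange; last first.
  move=> zeta eta hz he; by rewrite lee_fin mulr_ge0 ?dual_fun_ge0// mulr_ge0 ?rho0 ?p0.
transitivity (\esum_(eta in states S) \sum_(s' <- dconfs S K)
    (jker (drate S) (@dmove n) (dconfs S K) t xi s' * (D s' eta * rho eta))%:E)%E.
  apply: eq_esum => eta he.
  transitivity (\esum_(zeta in states S) ((rho eta)%:E * (D xi zeta * p t eta zeta)%:E))%E.
    by apply: eq_esum => zeta hz; rewrite -EFinM; congr (_%:E); ring.
  rewrite esumZl ?rho0//; last first.
    by move=> zeta hz; rewrite lee_fin mulr_ge0 ?dual_fun_ge0 ?p0.
  rewrite (esum_dual_fun hxi)// -EFinM sumEFin; congr (_%:E).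
  rewrite dsg_kernel//.
  by rewrite mulr_sumr; apply: eq_bigr => s' _; ring.
have ker0 s' : 0 <= jker (drate S) (@dmove n) (dconfs S K) t xi s'.
  by apply: jker_ge0 => //; [exact: drate_ge0|exact: dmove_dconfs].
under eq_esum do rewrite big_seq.
rewrite esum_sum; last first.
  move=> eta s' he /dconfsP[hs' _].
  by rewrite lee_fin mulr_ge0 ?ker0// mulr_ge0 ?rho0 ?dual_fun_ge0.
rewrite dsg_kernel//.
rewrite -sumEFin [RHS]big_seq; apply: eq_bigr => s' hs'; rewrite [RHS]EFinM -m_E// muleC.
rewrite -esumZl ?ker0//; have /dconfsP[hs1 _] := hs'.
by move=> eta he; rewrite lee_fin mulr_ge0 ?rho0 ?dual_fun_ge0.
Qed.

Lemma expect_ge0 (mu f : conf n -> R) (m : R) :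
  (forall eta, states S eta -> 0 <= f eta * mu eta) ->
  (\esum_(eta in states S) (f eta * mu eta)%:E = m%:E)%E ->
  integrable_pmf S mu f /\ expect S mu f = m.
Proof.
move=> f0 fm; split.
  rewrite /integrable_pmf /summable (eq_esum (b := fun eta => (f eta * mu eta)%:E)).
    by rewrite fm ltry.
  by move=> eta he; rewrite /= ger0_norm ?f0.
rewrite /expect (eq_esum (b := fun eta => (f eta * mu eta)%:E)); last first.
  by move=> eta he; rewrite /funrpos max_l// f0.
rewrite fm esum1 ?subr0//= => eta he.
by rewrite /funrneg max_r// oppr_le0 f0.
Qed.

End Laws.

(** * Absorption of the dual particles *)

Lemma antisym_sum (R : realDomainType) (m : nat) (a : 'I_m -> 'I_m -> R) :
  (forall x y, a x y = - a y x) -> \sum_x \sum_y a x y = 0.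
Proof.
move=> aN; have : \sum_x \sum_y a x y = - \sum_x \sum_y a x y.
  rewrite [in LHS]exchange_big/= -sumrN; apply: eq_bigr => x _.
  by rewrite -sumrN; apply: eq_bigr => y _; rewrite aN.
by lra.
Qed.

Section Walk.
Variables (R : realType) (n : nat) (S : bd_system R n).
Hypothesis hS : bd_system_ok S.
Hypothesis hsigma : sigma S = -1 \/ sigma S = 1.
Hypothesis hL : 0 < omegaL S.
Hypothesis hR : 0 < omegaR S.

Local Notation V := 'I_n.+1.
Local Notation al x := ((alpha S x)%:R : R).
Implicit Types (x y z : V) (v : V -> R).

Definition rateL x : R := omegaL S * alphaL S * (x == ord0)%:R.

Definition rateR x : R := omegaR S * alphaR S * (x == ord_max)%:R.

(** Generator of the one-particle walk on V with L and R, applied to v extended by a at L and b at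
    R; the values a = b = 0 give the walk killed at absorption. *)
Definition walk_gen (a b : R) v x : R :=
  \sum_y omega S x y * al y * (v y - v x)
  + rateL x * (a - v x) + rateR x * (b - v x).

Lemma rateL_ge0 x : 0 <= rateL x.
Proof. by rewrite /rateL !mulr_ge0// ltW// (alphaL_gt0 hS). Qed.

Lemma rateR_ge0 x : 0 <= rateR x.
Proof. by rewrite /rateR !mulr_ge0// ltW// (alphaR_gt0 hS). Qed.

Lemma rateL_gt0 : 0 < rateL ord0.
Proof. by rewrite /rateL eqxx mulr1 mulr_gt0// (alphaL_gt0 hS). Qed.

Lemma rateR_gt0 : 0 < rateR ord_max.
Proof. by rewrite /rateR eqxx mulr1 mulr_gt0// (alphaR_gt0 hS). Qed.

Lemma omega_connect_ind (P : V -> Prop) :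
  (forall x y, omega S x y != 0 -> P x -> P y) -> forall x y, P x -> P y.
Proof.
move=> step x y Px; have /connectP[s] := omega_connected hS x y.
elim: s x Px => [|z s IH] x Px /=; first by move=> _ ->.
by move=> /andP[xz]; apply: IH; exact: step xz Px.
Qed.

(** Strong minimum principle: at a minimum every term of the sum is nonnegative, hence zero, so the
    neighbours attain the minimum as well; connectedness does the rest. *)
Lemma min_propagates v (m : R) : (forall x, m <= v x) ->
  (forall x, v x = m -> \sum_y omega S x y * al y * (v y - v x) <= 0) ->
  forall x y, v x = m -> v y = m.
Proof.
move=> vm Hm; apply: omega_connect_ind => x y xy vx.
have pos z : 0 <= omega S x z * al z * (v z - v x).
  by rewrite !mulr_ge0 ?(omega_ge0 hS)// subr_ge0 vx.
have /eqP : \sum_y omega S x y * al y * (v y - v x) = 0.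
  by apply/eqP; rewrite eq_le Hm// sumr_ge0.
rewrite psumr_eq0// => /allP/(_ y (mem_index_enum _)).
rewrite !mulf_eq0 (negbTE xy)/= pnatr_eq0 eqn0Ngt (alpha_gt0 hS)/= subr_eq0.
by move=> /eqP ->.
Qed.

(** A negative minimum would spread to all of V, and the killing at [ord0] would then make
    [walk_gen] positive there. *)
Lemma walk_min_ge0 v : (forall x, walk_gen 0 0 v x <= 0) -> forall x, 0 <= v x.
Proof.
move=> Hv x; have [z _ zmax] := seq_argmax (fun x => - v x) (mem_enum V ord0).
have zmin y : v z <= v y by rewrite -lerN2 zmax// mem_enum.
apply: le_trans (zmin x); rewrite leNgt; apply/negP => z0.
have Hz y : v y = v z -> \sum_y0 omega S y y0 * al y0 * (v y0 - v y) <= 0.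
  move=> yz; have := Hv y; rewrite /walk_gen yz !sub0r -addrA; apply: le_trans.
  by rewrite lerDl addr_ge0// mulr_ge0 ?rateL_ge0 ?rateR_ge0 ?oppr_ge0 ?ltW.
have vE y : v y = v z by apply: (min_propagates zmin Hz (x := z)).
have := Hv ord0; rewrite /walk_gen big1 => [|y _]; last by rewrite !vE subrr mulr0.
rewrite vE add0r !sub0r leNgt ltr_wpDr//.
  by rewrite mulr_ge0 ?rateR_ge0// oppr_ge0 ltW.
by rewrite mulr_gt0 ?rateL_gt0// oppr_gt0.
Qed.

Lemma walk_genN v x : walk_gen 0 0 (fun y => - v y) x = - walk_gen 0 0 v x.
Proof.
rewrite /walk_gen.
have -> : \sum_y omega S x y * al y * (- v y - - v x) =
    - \sum_y omega S x y * al y * (v y - v x).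
  by rewrite -sumrN; apply: eq_bigr => y _; ring.
by ring.
Qed.

(** The solution is the mean absorption time. [B] is minus the killed generator, transposed to act
    on rows; the minimum principle makes it injective, hence invertible. *)
Lemma walk_solve : exists v, forall x, walk_gen 0 0 v x = -1.
Proof.
pose B : 'M[R]_n.+1 := \matrix_(y, x) ((y == x)%:R *
  (\sum_z omega S x z * al z + rateL x + rateR x) - omega S x y * al y).
have BE (u : 'rV[R]_n.+1) x : (u *m B) 0 x = - walk_gen 0 0 (u 0) x.
  rewrite mxE /walk_gen; under eq_bigr do rewrite mxE mulrBr.
  rewrite sumrB (bigD1 x)//= eqxx mul1r [X in _ + X - _]big1 ?addr0; last first.
    by move=> y /negbTE ->; rewrite mul0r mulr0.
  under [in RHS]eq_bigr do rewrite mulrBr.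
  rewrite sumrB -mulr_suml.
  have -> : \sum_i u 0 i * (omega S x i * al i) = \sum_i omega S x i * al i * u 0 i.
    by apply: eq_bigr => i _; rewrite mulrC.
  ring.
have Bunit : B \in unitmx.
  rewrite -row_free_unit; apply: inj_row_free => u uB.
  have u0 x : walk_gen 0 0 (u 0) x = 0 by rewrite -[LHS]opprK -BE uB mxE oppr0.
  apply/rowP => x; rewrite mxE; apply/eqP; rewrite eq_le.
  rewrite -oppr_ge0 (walk_min_ge0 (v := fun y => - u 0 y)) ?(walk_min_ge0 (v := u 0))//.
    by move=> y; rewrite u0.
  by move=> y; rewrite walk_genN u0 oppr0.
exists ((const_mx 1 *m invmx B : 'rV[R]_n.+1) 0) => x.
by rewrite -[LHS]opprK -BE mulmxKV// mxE.
Qed.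

(* A strict supersolution of the killed walk, hence a Lyapunov function for
   the absorption of the dual particles. *)
Lemma walk_supersolution : exists (G : V -> R) (k : R),
  [/\ 0 < k, forall x, 1 <= G x & forall x, walk_gen 0 0 G x <= - k * G x].
Proof.
have [v vE] := walk_solve.
have v0 x : 0 <= v x by apply: walk_min_ge0 => y; rewrite vE lerN10.
have vpos x : 0 < v x.
  rewrite lt_neqAle eq_sym v0 andbT; apply/eqP => vx0.
  have := vE x; rewrite /walk_gen vx0 !subr0 !mulr0 !addr0 => vx.
  have : 0 <= -1 :> R.
    by rewrite -vx sumr_ge0// => y _; rewrite !mulr_ge0 ?(omega_ge0 hS) ?subr0.
  by rewrite lerNr oppr0 ler10.
(* The factor [c] brings [c * v] above 1; as [v <= d], the value [- c] of the generator is at most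
   [- (c * v) / d], whence the rate 1 / d. *)
pose c := \sum_x (v x)^-1; pose d := \sum_x v x.
have cx x : 1 <= c * v x.
  rewrite -ler_pdivrMr// mul1r /c (bigD1 x)//= lerDl sumr_ge0// => y _.
  by rewrite invr_ge0.
have dx x : v x <= d by rewrite /d (bigD1 x)//= lerDl sumr_ge0.
have d0 : 0 < d by exact: lt_le_trans (vpos ord0) (dx ord0).
have c0 : 0 < c.
  by rewrite -(pmulr_lgt0 _ (vpos ord0)) (lt_le_trans ltr01).
exists (fun x => c * v x), d^-1; split => //; first by rewrite invr_gt0.
move=> x; have -> : walk_gen 0 0 (fun x => c * v x) x = c * walk_gen 0 0 v x.
  rewrite /walk_gen !mulrDr mulr_sumr; congr (_ + _ + _); last 2 first.
  - by ring.
  - by ring.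
  by apply: eq_bigr => y _; ring.
rewrite vE mulrN1 mulNr lerN2 mulrCA ler_piMr ?(ltW c0)//.
by rewrite ler_pdivrMl// mulr1.
Qed.

End Walk.

Section Absorption.
Variables (R : realType) (n : nat) (S : bd_system R n).
Hypothesis hS : bd_system_ok S.
Hypothesis hsigma : sigma S = -1 \/ sigma S = 1.
Hypothesis hL : 0 < omegaL S.
Hypothesis hR : 0 < omegaR S.

Local Notation V := 'I_n.+1.
Local Notation al x := ((alpha S x)%:R : R).
Local Notation sg := ((sigma S)%:~R : R).
Local Notation D := (dual_fun S).
Local Notation A := (jgen (drate S) (@dmove n)).
Implicit Types (x y : V) (eta zeta : conf n) (xi : dconf n) (K M : nat) (t : R).

Definition bulk_weight (G : V -> R) xi : R := \sum_x (xi.1 x)%:R * G x.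

Lemma bulk_weight_decr (G : V -> R) x (xi : dconf n) (lr : nat * nat) :
  (0 < xi.1 x)%N ->
  bulk_weight G (decr x xi.1, lr) = bulk_weight G xi - G x.
Proof.
move=> x0; rewrite /bulk_weight (bigD1 x)//= [in RHS](bigD1 x)//= ffunE eqxx.
rewrite subn1 -[X in _ = X%:R * _ + _ - _](prednK x0) -natr1.
rewrite [in LHS](eq_bigr (fun y => (xi.1 y)%:R * G y)) => [|y /negbTE yx].
  by ring.
by rewrite ffunE yx subn0.
Qed.

Lemma bulk_weight_incr (G : V -> R) x eta (lr : nat * nat) :
  bulk_weight G (incr x eta, lr) = bulk_weight G (eta, lr) + G x.
Proof.
rewrite /bulk_weight (bigD1 x)//= [in RHS](bigD1 x)//= ffunE eqxx.
rewrite addn1 -natr1.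
rewrite [in LHS](eq_bigr (fun y => (eta y)%:R * G y)) => [|y /negbTE yx].
  by ring.
by rewrite ffunE yx addn0.
Qed.

(* The exclusion/inclusion interaction is antisymmetric in the two sites, so
   it disappears on functions that are linear in the occupation numbers. *)
Lemma jgen_bulk_weight (G : V -> R) xi :
  A (bulk_weight G) xi = \sum_x (xi.1 x)%:R * walk_gen S 0 0 G x.
Proof.
rewrite /jgen sum_dmoves.
have -> : \sum_x \sum_y drate S (inl (x, y)) xi *
    (bulk_weight G (dmove (inl (x, y)) xi) - bulk_weight G xi) =
    \sum_x \sum_y (xi.1 x)%:R * (omega S x y * al y * (G y - G x)) +
    \sum_x \sum_y omega S x y * (xi.1 x)%:R * sg * (xi.1 y)%:R * (G y - G x).
  rewrite -big_split; apply: eq_bigr => x _ /=.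
  rewrite -big_split; apply: eq_bigr => y _ /=.
  have [->|x0] := posnP (xi.1 x); first by ring.
  rewrite bulk_weight_incr (bulk_weight_decr G xi.2 x0); ring.
rewrite [X in _ + X + _ + _]antisym_sum ?addr0; last first.
  by move=> x y; rewrite (omega_sym hS x y); ring.
have -> : \sum_x (xi.1 x)%:R * walk_gen S 0 0 G x =
    \sum_x \sum_y (xi.1 x)%:R * (omega S x y * al y * (G y - G x)) +
    \sum_x (xi.1 x)%:R * (rateL S x * (0 - G x)) +
    \sum_x (xi.1 x)%:R * (rateR S x * (0 - G x)).
  rewrite -!big_split; apply: eq_bigr => x _ /=.
  by rewrite /walk_gen !mulrDr mulr_sumr.
congr (_ + _ + _).
- rewrite (bigD1 ord0)//= big1 ?addr0; last first.
    by move=> x /negbTE x0; rewrite /rateL x0 /=; ring.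
  rewrite /rateL eqxx /=.
  have [->|x0] := posnP (xi.1 ord0); first by ring.
  rewrite (bulk_weight_decr G _ x0); ring.
- rewrite (bigD1 ord_max)//= big1 ?addr0; last first.
    by move=> x /negbTE x0; rewrite /rateR x0 /=; ring.
  rewrite /rateR eqxx /=.
  have [->|x0] := posnP (xi.1 ord_max); first by ring.
  rewrite (bulk_weight_decr G _ x0); ring.
Qed.

(** The bulk weight built on the supersolution decays exponentially and is at least 1 while a
    particle remains in the bulk, so a multiple of it dominates any function vanishing on absorbed
    configurations. *)
Lemma absorption K : exists2 k, 0 < k & forall xi (g : dconf n -> R),
  xi \in dconfs S K ->
  (forall z, z \in dconfs S K -> tot z.1 = 0%N -> g z = 0) ->
  exists2 C, 0 <= C & forall t, 0 <= t -> `|dsg S K t g xi| <= C * expR (- k * t).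
Proof.
have [G [k [k0 G1 Gk]]] := walk_supersolution hS hL hR.
exists k => // xi g hxi g0.
have N0 z : 0 <= bulk_weight G z.
  by rewrite /bulk_weight sumr_ge0// => x _; rewrite mulr_ge0// (le_trans ler01).
have N1 z : tot z.1 != 0%N -> 1 <= bulk_weight G z.
  move=> z0; apply: (@le_trans _ _ (tot z.1)%:R); first by rewrite ler1n lt0n.
  by rewrite /tot natr_sum ler_sum// => x _; rewrite ler_peMr.
pose B := \sum_(z <- dconfs S K) `|g z|.
have B0 : 0 <= B by rewrite sumr_ge0.
have gB z : z \in dconfs S K -> `|g z| <= B * bulk_weight G z.
  move=> hz; have [z0|z0] := eqVneq (tot z.1) 0%N.
    by rewrite g0// normr0 mulr_ge0.
  apply: (le_trans (le_bigsum_seq g hz)); rewrite -/B ler_peMr// N1//.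
have dN t : 0 <= t -> dsg S K t (bulk_weight G) xi <= expR (- k * t) * bulk_weight G xi.
  move=> t0; apply: jsg_decay => //; [exact: drate_ge0|exact: dmove_dconfs|].
  move=> z hz; rewrite jgen_bulk_weight /bulk_weight mulr_sumr ler_sum// => x _.
  by rewrite mulrCA ler_wpM2l.
exists (B * bulk_weight G xi); first by rewrite mulr_ge0.
move=> t t0.
have step (h : dconf n -> R) : (forall z, z \in dconfs S K -> h z <= B * bulk_weight G z) ->
    dsg S K t h xi <= B * bulk_weight G xi * expR (- k * t).
  move=> hB; apply: (@le_trans _ _ (dsg S K t (fun z => B * bulk_weight G z + 0) xi)).
    apply: jsg_le => //; [exact: drate_ge0|exact: dmove_dconfs|].
    by move=> z hz; rewrite addr0 hB.
  rewrite /dsg jsg_linear//; [|exact: drate_ge0|exact: dmove_dconfs].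
  rewrite jsg_const addr0 -mulrA ler_wpM2l// mulrC; exact: dN.
apply/ler_normlP; split; last first.
  by apply: step => z /gB; apply: le_trans; exact: ler_norm.
have -> : - dsg S K t g xi = dsg S K t (fun z => -1 * g z + 0) xi.
  rewrite /dsg jsg_linear//; [|exact: drate_ge0|exact: dmove_dconfs].
  by rewrite jsg_const mulN1r addr0.
apply: step => z /gB; apply: le_trans; rewrite mulN1r addr0 -normrN; exact: ler_norm.
Qed.

(** The part of the duality function living on absorbed configurations is bounded independently of
    [eta]; the rest decays, with a constant depending on [eta]. *)
Lemma dsg_dual_fun_absorbed K : exists2 k, 0 < k & forall xi, xi \in dconfs S K ->
  forall eta, exists2 C, 0 <= C & forall t, 0 <= t ->
    dsg S K t (D^~ eta) xi <= dual_bound S K + C * expR (- k * t).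
Proof.
have [k k0 abs] := absorption K; exists k => // xi hxi eta.
pose res z := if tot z.1 == 0%N then D z eta else 0.
have [|C C0 HC] := abs xi (fun z => D z eta - res z) hxi.
  by move=> z _ /eqP z0; rewrite /res z0 subrr.
exists C => // t t0.
have -> : dsg S K t (D^~ eta) xi =
    dsg S K t (fun z => 1 * res z + (D z eta - res z)) xi.
  by congr (dsg _ _ _ _ _); apply/funext => z; rewrite mul1r addrC subrK.
rewrite /dsg jsg_linear//; [|exact: drate_ge0|exact: dmove_dconfs].
rewrite mul1r lerD//; last by rewrite (le_trans (ler_norm _))// HC.
rewrite -[leRHS](jsg_const (drate S) (@dmove n) (dconfs S K) (dual_bound S K) t xi).
apply: jsg_le => //; [exact: drate_ge0|exact: dmove_dconfs|].
move=> z /dconfsP[hz hK]; rewrite /res; case: eqP => z0; last first.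
  exact: ltW (dual_bound_gt0 hS K).
rewrite /dual_fun /dual_cl big1 ?mulr1 /=.
  by apply: reservoirs_le => //; move: hK; rewrite /dsize; lia.
move=> x _; have -> : z.1 x = 0%N by have := le_tot x z.1; rewrite z0 leqn0 => /eqP.
rewrite /dual_cl_site ffactn0 div1r /weight ffactn0 addn0.
by case: hsigma => s; rewrite s/= ?invr1// divff ?invr1.
Qed.

End Absorption.

(** * Moments of the stationary measure *)

Section Stationary.
Variables (R : realType) (n : nat) (S : bd_system R n).
Hypothesis hS : bd_system_ok S.
Hypothesis hsigma : sigma S = -1 \/ sigma S = 1.
Hypothesis hL : 0 < omegaL S.
Hypothesis hR : 0 < omegaR S.
Variable p : R -> conf n -> conf n -> R.
Hypothesis hp : is_markov_process S p.
Variable mu : conf n -> R.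
Hypothesis hmu : is_stationary S p mu.

Local Notation V := 'I_n.+1.
Local Notation al x := ((alpha S x)%:R : R).
Local Notation sg := ((sigma S)%:~R : R).
Local Notation D := (dual_fun S).
Local Notation A := (jgen (drate S) (@dmove n)).
Implicit Types (x y : V) (eta zeta : conf n) (xi : dconf n) (K M : nat) (t : R).

Lemma stationary_ge0 eta : states S eta -> 0 <= mu eta.
Proof. by case: hmu => -[+ _] _; apply. Qed.

Lemma stationary_sum1 : (\esum_(eta in states S) (mu eta)%:E = 1)%E.
Proof. by case: hmu => -[]. Qed.

Lemma stationary_tight (e : R) : 0 < e -> exists s : seq (conf n),
  (\esum_(eta in states S) ((eta \notin s)%:R * mu eta)%:E <= e%:E)%E.
Proof.
move=> e0; have [s [us [sS hs]]] : exists s : seq (conf n), uniq s /\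
    (forall z, z \in s -> states S z) /\ 1 - e < \sum_(z <- s) mu z.
  apply: contrapT => H; have : (1 <= (1 - e)%:E :> \bar R)%E.
    rewrite -[leLHS]stationary_sum1; apply: esum_le_seq => s us sS.
    rewrite sumEFin lee_fin leNgt; apply/negP => hs; apply: H; exists s; split => //.
  by rewrite lee_fin lerBrDr gerDl leNgt e0.
exists s.
have m0 := stationary_ge0.
have : (\esum_(eta in states S) ((eta \in s)%:R * mu eta)%:E +
        \esum_(eta in states S) ((eta \notin s)%:R * mu eta)%:E = 1)%E.
  rewrite -esumD.
  - rewrite -stationary_sum1; apply: eq_esum => eta he; rewrite -EFinD -mulrDl.
    by case: (eta \in s); rewrite /= ?addr0 ?add0r mul1r.
  - by move=> eta he; rewrite lee_fin mulr_ge0 ?m0.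
  - by move=> eta he; rewrite lee_fin mulr_ge0 ?m0.
have in_s : ((1 - e)%:E <= \esum_(eta in states S) ((eta \in s)%:R * mu eta)%:E)%E.
  apply: (@le_trans _ _ (\sum_(eta <- s) ((eta \in s)%:R * mu eta)%:E)%E).
    rewrite sumEFin lee_fin (le_trans (ltW hs))// !big_seq ler_sum// => x ->.
    by rewrite mul1r.
  exact: sum_seq_le_esum.
move=> E.
have : ((1 - e)%:E + \esum_(eta in states S) ((eta \notin s)%:R * mu eta)%:E <= 1)%E.
  by rewrite -[leRHS]E leeD2r.
by rewrite -leeBrDl// -EFinB opprB addrC subrK.
Qed.

Lemma law_at_stationary t eta : 0 <= t -> states S eta ->
  law_at S p mu t eta = mu eta.
Proof. by case: hmu => _; apply. Qed.

(* By stationarity a truncation of [D xi] integrates as its image under the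
   semigroup at a large time, which is at most [D] after absorption of all the
   dual particles, up to an error that is small on compact sets. *)
Lemma stationary_moment_le K xi : xi \in dconfs S K ->
  (\esum_(eta in states S) (D xi eta * mu eta)%:E <= (dual_bound S K)%:E)%E.
Proof.
move=> hxi; have /dconfsP[hxi1 _] := hxi.
have m0 := stationary_ge0.
apply: esum_le_seq => s us sS; rewrite sumEFin lee_fin.
have [k k0 /(_ xi hxi)] := dsg_dual_fun_absorbed hS hsigma hL hR K.
move=> abs; have {abs}/choice[Cf HCf] : forall eta, exists C, 0 <= C /\
    forall t, 0 <= t -> dsg S K t (D^~ eta) xi <= dual_bound S K + C * expR (- k * t).
  by move=> eta; have [C C0 HC] := abs eta; exists C.
(* Two bounds on [u] are combined: the dual semigroup, whose error constant depends on [eta], on a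
   finite set of nearly full mass, and the uniform constant [b] off that set. *)
pose u t eta := \sum_(zeta <- s) D xi zeta * p t eta zeta.
pose b := \sum_(zeta <- s) D xi zeta.
have b0 : 0 <= b.
  by rewrite /b big_seq sumr_ge0// => z /sS hz; rewrite dual_fun_ge0.
have p0 t eta zeta : 0 <= t -> states S eta -> states S zeta -> 0 <= p t eta zeta.
  by move=> t0 he hz; rewrite (trans_ge0 hp).
have u_dsg t eta : 0 <= t -> states S eta -> u t eta <= dsg S K t (D^~ eta) xi.
  move=> t0 he; rewrite -lee_fin -(esum_dual_fun hS hsigma hp hxi t0 he) -sumEFin.
  exact: sum_seq_le_esum.
have u_b t eta : 0 <= t -> states S eta -> u t eta <= b.
  move=> t0 he; rewrite /u /b big_seq [leRHS]big_seq ler_sum// => zeta /sS hz.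
  by rewrite ler_piMr ?dual_fun_ge0// (trans_le1 hp).
have muE t : 0 <= t -> ((\sum_(zeta <- s) D xi zeta * mu zeta)%:E =
    \esum_(eta in states S) (u t eta * mu eta)%:E)%E.
  move=> t0.
  transitivity (\sum_(zeta <- s) \esum_(eta in states S)
      (D xi zeta * (mu eta * p t eta zeta))%:E)%E.
    rewrite -sumEFin !big_seq; apply: eq_bigr => zeta /sS hz.
    rewrite -(law_at_stationary t0 hz) EFinM /law_at fineK; last first.
      rewrite ge0_fin_numE; last first.
        by apply: esum_ge0 => eta he; rewrite lee_fin mulr_ge0 ?m0 ?p0.
      apply: le_lt_trans (ltry 1); rewrite -[leRHS]stationary_sum1.
      apply: le_esum => eta he; rewrite lee_fin ler_piMr ?m0//.
      exact: (trans_le1 hp).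
    rewrite -esumZl ?dual_fun_ge0// => eta he.
    by rewrite lee_fin mulr_ge0 ?m0 ?p0.
  rewrite big_seq -esum_sum; last first.
    by move=> eta zeta he /sS hz; rewrite lee_fin mulr_ge0 ?dual_fun_ge0// mulr_ge0 ?m0 ?p0.
  apply: eq_esum => eta he; rewrite -big_seq sumEFin /u mulr_suml; congr (_%:E).
  by apply: eq_bigr => zeta _; ring.
apply/ler_addgt0Pr => e e0.
(* The errors are [e / (1 + b)] on the finite set and [b] times as much off it; they add up to
   [e]. *)
have e1 : 0 < e / (1 + b) by rewrite divr_gt0// ltr_wpDr.
have [r hr] := stationary_tight e1.
pose C := \sum_(eta <- r) Cf eta.
have C0 : 0 <= C by rewrite sumr_ge0// => eta _; have [] := HCf eta.
have [t t0 tC] : exists2 t, 0 <= t & C * expR (- k * t) <= e / (1 + b).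
  exists (C / (e / (1 + b)) / k); first by rewrite divr_ge0 ?(ltW k0)// divr_ge0// ltW.
  rewrite mulNr expRN mulrCA divff ?gt_eqF// mulr1.
  rewrite ler_pdivrMr ?expR_gt0// mulrC -ler_pdivrMr//.
  by rewrite (le_trans _ (expR_ge1Dx _))// lerDr.
rewrite -lee_fin (muE t t0).
apply: (@le_trans _ _ (\esum_(eta in states S)
   (((dual_bound S K + e / (1 + b)) * mu eta)%:E +
    (b * ((eta \notin r)%:R * mu eta))%:E))%E).
  apply: le_esum => eta he; rewrite -EFinD lee_fin mulrA -mulrDl ler_wpM2r ?m0//.
  case: (boolP (eta \in r)) => er /=.
    rewrite mulr0 addr0 (le_trans (u_dsg _ _ t0 he))//.
    have [Cf0 Cfe] := HCf eta; rewrite (le_trans (Cfe _ t0))// lerD2l.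
    rewrite (le_trans _ tC)// ler_wpM2r ?expR_ge0//.
    rewrite /C (big_rem eta)//= lerDl sumr_ge0// => z _.
    by have [] := HCf z.
  by rewrite mulr1 (le_trans (u_b _ _ t0 he))// lerDr addr_ge0// ltW// dual_bound_gt0.
rewrite esumD; last 2 first.
- move=> eta he; rewrite lee_fin mulr_ge0 ?m0// addr_ge0// ltW// dual_bound_gt0//.
- by move=> eta he; rewrite lee_fin !mulr_ge0 ?m0.
under eq_esum do rewrite EFinM.
rewrite esumZl; last 2 first.
- by rewrite addr_ge0// ltW// dual_bound_gt0.
- by move=> eta he; rewrite lee_fin m0.
under [X in (_ + X)%E]eq_esum do rewrite EFinM.
rewrite esumZl//; last by move=> eta he; rewrite lee_fin mulr_ge0 ?m0.
rewrite stationary_sum1 mule1.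
apply: (@le_trans _ _ ((dual_bound S K + e / (1 + b))%:E + b%:E * (e / (1 + b))%:E)%E).
  by rewrite leeD2l// lee_wpmul2l.
rewrite -EFinM -EFinD lee_fin -addrA lerD2l.
rewrite -{1}[e / _]mul1r -mulrDl mulrCA divff ?mulr1//.
by rewrite gt_eqF// ltr_wpDr.
Qed.

Definition moment xi : R := fine (\esum_(eta in states S) (D xi eta * mu eta)%:E)%E.

Lemma momentE K xi : xi \in dconfs S K ->
  (\esum_(eta in states S) (D xi eta * mu eta)%:E = (moment xi)%:E)%E.
Proof.
move=> hxi; have /dconfsP[hxi1 _] := hxi.
rewrite /moment fineK// ge0_fin_numE.
  exact: le_lt_trans (stationary_moment_le hxi) (ltry _).
by apply: esum_ge0 => eta he; rewrite lee_fin mulr_ge0 ?dual_fun_ge0 ?stationary_ge0.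
Qed.

Lemma dsg_moment K xi t : xi \in dconfs S K -> 0 <= t ->
  dsg S K t moment xi = moment xi.
Proof.
move=> hxi t0; apply: EFin_inj.
rewrite -(esum_dual_law hS hsigma hp hxi t0 stationary_ge0 _ (@momentE K)); last first.
  by rewrite stationary_sum1.
rewrite -(momentE hxi); apply: eq_esum => eta he.
by rewrite law_at_stationary.
Qed.

(** Invariance under the dual semigroup is known for nonnegative times only, so the derivative is
    computed at t > 0 and followed down to 0. *)
Lemma jgen_moment K xi : xi \in dconfs S K -> A moment xi = 0.
Proof.
move=> hxi.
have d (t : R) : is_derive t 1 (fun s : R => dsg S K s moment xi) (dsg S K t (A moment) xi).
  by apply: jsg_derive => //; [exact: drate_ge0|exact: dmove_dconfs].
have z t : 0 < t -> dsg S K t (A moment) xi = 0.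
  move=> t0; have [_ <-] := d t.
  rewrite (near_eq_derive (g := cst (moment xi))) ?derive_cst//.
  near=> s; rewrite dsg_moment//; apply: ltW; near: s.
  exact: lt_nbhsr.
have c0 : dsg S K t (A moment) xi @[t --> 0^'+] --> dsg S K 0 (A moment) xi.
  apply: cvg_at_right_filter.
  have d' : is_derive (0 : R) 1 (fun s : R => dsg S K s (A moment) xi) (dsg S K 0 (A (A moment)) xi).
    by apply: jsg_derive => //; [exact: drate_ge0|exact: dmove_dconfs].
  exact: is_derive_continuous d'.
have := cvg_lim _ c0; rewrite /dsg jsg0 => <- //.
apply/cvg_lim => //; apply: cvg_near_cst; near=> s.
by apply: z; near: s; exact: nbhs_right_gt.
Unshelve. all: by end_near. Qed.

End Stationary.

(** * Moments of the local equilibrium *)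

(** Monotonicity gives (c - r) P <= sup Q, hence a limit l, which must solve c l = q + r l. *)
Lemma monotone_recursion_cvg (R : realType) (P Q : nat -> R) (c r q : R) :
  nondecreasing_seq P -> r < c -> Q M @[M --> \oo] --> q ->
  (forall M, c * P M.+1 = Q M + r * P M) -> 0 <= r ->
  P M @[M --> \oo] --> q / (c - r).
Proof.
move=> Pnd rc Qq rec r0; have cr : 0 < c - r by rewrite subr_gt0.
have [B QB] : exists B, forall M, Q M <= B.
  have /cvg_seq_bounded[B [_ HB]] : cvgn Q by apply/cvg_ex; exists q.
  exists (B + 1) => M; apply: le_trans (ler_norm _) _.
  by apply: (HB (B + 1)) => //; rewrite ltrDl.
have Pc : cvgn P.
  apply: nondecreasing_is_cvgn => //; exists (B / (c - r)) => _ [M _ <-].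
  apply: (le_trans (Pnd _ _ (leqnSn M))).
  rewrite ler_pdivlMr// mulrBr [P _ * c]mulrC rec lerBlDr [P _ * r]mulrC lerD//.
  by rewrite ler_wpM2l// Pnd.
have Pl : P M @[M --> \oo] --> limn P by [].
have PS : P M.+1 @[M --> \oo] --> limn P by rewrite (cvg_shiftS P).
have e1 : c * P M.+1 @[M --> \oo] --> c * limn P by exact: cvgMl_tmp.
have e2 : Q M + r * P M @[M --> \oo] --> q + r * limn P.
  by apply: cvgD => //; exact: cvgMl_tmp.
have e3 : c * limn P = q + r * limn P.
  apply: (cvg_unique _ e1) => //.
  by rewrite (_ : (fun M => c * P M.+1) = (fun M => Q M + r * P M))//; apply/funext.
have -> : q / (c - r) = limn P; last by [].
have -> : q = limn P * (c - r) by rewrite -[q](addrK (r * limn P)) -e3; ring.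
by rewrite mulfK// gt_eqF.
Qed.

(** Pascal's rule turns the partial sums for m + 1 into a recursion with the sums for m as
    source. *)
Lemma negbin_series (R : realType) (q : R) (m : nat) : 0 <= q < 1 ->
  \sum_(k < M) 'C(m + k, k)%:R * q ^+ k @[M --> \oo] --> (1 - q) ^- m.+1.
Proof.
move=> /andP[q0 q1]; elim: m => [|m IH].
  have := @cvg_geometric_series _ 1 q; rewrite ger0_norm// => /(_ q1).
  rewrite mul1r expr1; apply: cvg_trans; apply: near_eq_cvg; near=> M.
  rewrite /series/= big_mkord; apply: eq_bigr => k _.
  by rewrite add0n binn.
pose P M : R := \sum_(k < M) 'C(m.+1 + k, k)%:R * q ^+ k.
have -> : (1 - q) ^- m.+2 = (1 - q) ^- m.+1 / (1 - q).
  by rewrite exprSr invfM mulrC.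
apply: (@monotone_recursion_cvg _ P
  (fun M => \sum_(k < M.+1) 'C(m + k, k)%:R * q ^+ k) 1 q) => //.
- apply/nondecreasing_seqP => M; rewrite /P big_ord_recr/= lerDl.
  by rewrite mulr_ge0 ?exprn_ge0.
- by rewrite (cvg_shiftS (fun M => \sum_(k < M) 'C(m + k, k)%:R * q ^+ k)).
move=> M; rewrite mul1r /P.
have recl (j : nat) : \sum_(k < M.+1) 'C(j + k, k)%:R * q ^+ k =
    1 + \sum_(k < M) 'C(j + k.+1, k.+1)%:R * q ^+ k.+1.
  by rewrite big_ord_recl/= addn0 bin0 mul1r.
rewrite !recl -addrA; congr (_ + _).
rewrite mulr_sumr -big_split/=; apply: eq_bigr => k _.
by rewrite !addnS binS natrD addSn exprS; ring.
Unshelve. all: by end_near. Qed.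

Section Marginals.
Variables (R : realType) (n : nat) (S : bd_system R n).
Hypothesis hS : bd_system_ok S.
Hypothesis hsigma : sigma S = -1 \/ sigma S = 1.

Local Notation V := 'I_n.+1.
Local Notation sg := ((sigma S)%:~R : R).
Local Notation al x := ((alpha S x)%:R : R).
Local Notation d := (dual_cl_site S).
Local Notation nu := (marginal S).
Implicit Types (x : V) (th : R).

Lemma marginal_ge0 x th k : in_Theta (sigma S) th -> 0 <= nu x th k.
Proof.
move=> [t0 t1]; rewrite /marginal; case: hsigma => s; rewrite s/=.
  by apply: binomial_pmf_ge0; rewrite t0 t1.
have th1 : 0 <= 1 + th by rewrite addr_ge0.
rewrite !mulr_ge0 ?invr_ge0 ?exprn_ge0 ?mulr_ge0 ?invr_ge0//.
Qed.

Lemma marginal_small x th k : sigma S = -1 -> (alpha S x < k)%N -> nu x th k = 0.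
Proof.
by move=> s ak; rewrite /marginal s/= /binomial_pmf bin_small// mulr0n.
Qed.

(** Reversibility of a single site in contact with a reservoir of parameter [th]. *)
Lemma marginalS x th k : in_Theta (sigma S) th ->
  k.+1%:R * (1 + sg * th) * nu x th k.+1 = th * (al x + sg * k%:R) * nu x th k.
Proof.
move=> [t0 t1]; rewrite /marginal; case: hsigma => s; rewrite s/=.
  rewrite /binomial_pmf /unstable.onem -[_ *+ 'C(_, k.+1)]mulr_natr -[_ *+ 'C(_, k)]mulr_natr.
  have [ka|ak|->] := ltngtP k (alpha S x); last 2 first.
  - by rewrite !bin_small// ?ltnS ?(ltnW ak)// !mulr0.
  - by rewrite bin_small// !mulN1r subrr !mulr0 mul0r.
  have bE : k.+1%:R * 'C(alpha S x, k.+1)%:R = (al x - k%:R) * 'C(alpha S x, k)%:R :> R.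
    by rewrite -natrM mul_bin_left natrM natrB// ltnW.
  have -> : (alpha S x - k)%N = (alpha S x - k.+1).+1 by rewrite subnSK.
  rewrite !mulN1r !exprS.
  transitivity ((1 - th) * (th * th ^+ k * (1 - th) ^+ (alpha S x - k.+1)) *
    (k.+1%:R * 'C(alpha S x, k.+1)%:R)); first by ring.
  by rewrite bE; ring.
have th1 : 1 + th != 0 by rewrite gt_eqF// ltr_wpDr.
rewrite !mul1r -natrD addnS/= factS natrM.
have a0 := alpha_gt0 hS x.
have -> : ((alpha S x + k)`!%:R : R) = (alpha S x + k)%:R * ((alpha S x + k).-1)`!%:R.
  have ak0 : (0 < alpha S x + k)%N by rewrite addn_gt0 a0.
  by rewrite -natrM -[in LHS](prednK ak0) factS prednK.
rewrite exprS; field.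
have fN m : m`!%:R != 0 :> R by rewrite pnatr_eq0 -lt0n fact_gt0.
by rewrite expf_neq0// !fN th1 -[1]/(1%:R) -natrD pnatr_eq0.
Qed.

Definition site_sum x th j M : R := \sum_(k < M) d x j k * nu x th k.

(* Detailed balance [marginalS] combined with the relations [site_decr] and
   [site_weightS]; in the limit it says that the (j+1)-st normalized factorial
   moment is [th] times the j-th one, for both signs of [sigma]. *)
Lemma site_sumS x th j M : in_Theta (sigma S) th ->
  (sigma S = -1 -> (j < alpha S x)%N) ->
  (1 + sg * th) * site_sum x th j.+1 M.+1 =
  th * site_sum x th j M + sg * th * site_sum x th j.+1 M.
Proof.
move=> hth hj; set c := al x + sg * j%:R.
have c0 : c != 0.
  rewrite /c; case: hsigma => s; rewrite s.
    by rewrite mulN1r subr_eq0 eqr_nat gtn_eqF// hj.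
  by rewrite mul1r -natrD pnatr_eq0 addn_eq0 negb_and -lt0n (alpha_gt0 hS).
have cE k : c * (d x j.+1 k * nu x th k) = (k%:R - j%:R) * (d x j k * nu x th k).
  have [ka|ak] := boolP ((sigma S == -1) && (alpha S x < k)%N).
    by case/andP: ka => /eqP s ka; rewrite marginal_small// !mulr0.
  rewrite mulrA [RHS]mulrA /c site_weightS//; first by move/hj/ltnW.
  by move=> s; move: ak; rewrite s eqxx/= -leqNgt.
apply: (mulfI c0).
transitivity ((1 + sg * th) * \sum_(k < M.+1) k%:R * (d x j k.-1 * nu x th k)).
  rewrite mulrCA /site_sum [c * _]mulr_sumr; congr (_ * _).
  by apply: eq_bigr => k _; rewrite cE [LHS]mulrA [RHS]mulrA site_decr.
rewrite big_ord_recl/= mul0r add0r.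
transitivity (\sum_(k < M) th * ((al x + sg * k%:R) * (d x j k * nu x th k))).
  rewrite mulr_sumr; apply: eq_bigr => k _; rewrite /bump/= add1n/=.
  transitivity (d x j k * (k.+1%:R * (1 + sg * th) * nu x th k.+1)); first by ring.
  by rewrite marginalS//; ring.
rewrite -mulr_sumr mulrDr [in RHS]mulrCA [c * (sg * th * _)]mulrCA /site_sum !mulr_sumr.
rewrite -big_split; apply: eq_bigr => k _ /=.
have := cE k; rewrite /c => cEk.
transitivity (th * (c * (d x j k * nu x th k)) +
   sg * th * ((k%:R - j%:R) * (d x j k * nu x th k))).
  by rewrite /c; ring.
by rewrite -cEk /c; ring.
Qed.

Lemma site_sum_const x th j M : sigma S = -1 -> (alpha S x < M)%N ->
  site_sum x th j M = site_sum x th j (alpha S x).+1.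
Proof.
move=> s aM; rewrite /site_sum.
rewrite [RHS](big_ord_widen M (fun k => d x j k * nu x th k))//.
rewrite [RHS]big_mkcond/=; apply: eq_bigr => k _; case: ifP => //.
by move=> /negbT; rewrite -ltnNge => ak; rewrite marginal_small ?mulr0.
Qed.

(** Total mass one: the binomial formula under exclusion, the negative binomial series at th / (1 +
    th) under inclusion. *)
Lemma site_sum0_cvg x th : in_Theta (sigma S) th ->
  site_sum x th 0 M @[M --> \oo] --> (1 : R).
Proof.
move=> [t0 t1].
have w0 : weight S x 0 = 1.
  rewrite /weight ffactn0 addn0; case: hsigma => s; rewrite s/=//.
  by rewrite divff// pnatr_eq0 -lt0n fact_gt0.
have d0 k : d x 0 k = 1 by rewrite /dual_cl_site ffactn0 w0 divr1.
have th1 : 1 + th != 0 by rewrite gt_eqF// ltr_wpDr.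
case: hsigma => s.
  apply: cvg_near_cst; near=> M.
  have aM : (alpha S x < M)%N by near: M; exact: nbhs_infty_gt.
  rewrite site_sum_const// /site_sum -[RHS](expr1n _ (alpha S x)).
  rewrite -[X in _ = X ^+ _](subrK th) exprDn; apply: eq_bigr => k _.
  by rewrite d0 mul1r /marginal s/= /binomial_pmf /unstable.onem mulrC.
have a0 := alpha_gt0 hS x.
pose q := th / (1 + th).
have q1 : 1 - q = (1 + th)^-1 by rewrite /q; field.
have q01 : 0 <= q < 1.
  by rewrite divr_ge0 ?addr_ge0//= -subr_gt0 q1 invr_gt0 ltr_wpDr.
have := @negbin_series R q (alpha S x).-1 q01.
rewrite prednK// q1 -exprVn invrK => H.
have E : (fun M => (\sum_(k < M) 'C((alpha S x).-1 + k, k)%:R * q ^+ k) *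
    (1 + th) ^- alpha S x) = site_sum x th 0.
  apply/funext => M; rewrite /site_sum mulr_suml; apply: eq_bigr => k _.
  rewrite d0 mul1r /marginal s/= -/q; congr (_ * _ * _).
  have := bin_fact (leq_addl (alpha S x).-1 k); rewrite addnK.
  move=> /(congr1 (fun i => i%:R : R)).
  have -> : (alpha S x + k).-1 = ((alpha S x).-1 + k)%N by move: a0; lia.
  rewrite !natrM => <-; field.
  by rewrite !pnatr_eq0 -!lt0n !fact_gt0.
have := cvgMr_tmp (b := (1 + th) ^- alpha S x) H.
rewrite E divff ?expf_neq0//; apply.
Unshelve. all: by end_near. Qed.

Lemma site_sum_cvg x th j : in_Theta (sigma S) th ->
  (sigma S = -1 -> (j <= alpha S x)%N) ->
  site_sum x th j M @[M --> \oo] --> th ^+ j.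
Proof.
move=> hth; elim: j => [|j IH] hj; first exact: site_sum0_cvg.
have hj' : sigma S = -1 -> (j <= alpha S x)%N by move/hj/ltnW.
have {}IH := IH hj'; have rec M := site_sumS M hth hj.
have [t0 t1] := hth; case: hsigma => s; last first.
  have -> : th ^+ j.+1 = th * th ^+ j / (1 + th - th) by rewrite addrK divr1 exprS.
  apply: (@monotone_recursion_cvg _ _ (fun M => th * site_sum x th j M) (1 + th) th) => //.
  - apply/nondecreasing_seqP => M; rewrite /site_sum big_ord_recr/= lerDl.
    by rewrite mulr_ge0 ?marginal_ge0// site_ge0// => s'; move: s; rewrite s'.
  - by rewrite ltrDr.
  - exact: cvgMl_tmp.
  - by move=> M; have := rec M; rewrite s !mul1r.
(* Under exclusion the sums are constant past [alpha S x], so the recursion is a linear equation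
   with total coefficient (1 - th) + th = 1; there is no division by 1 - th, which may be 0. *)
have E := rec (alpha S x).+1; rewrite (@site_sum_const _ _ _ _.+2)// s in E.
have sj : site_sum x th j (alpha S x).+1 = th ^+ j.
  have <- := cvg_lim (@Rhausdorff R) IH; apply/esym/cvg_lim => //.
  apply: cvg_near_cst; near=> M; apply: site_sum_const => //.
  by near: M; exact: nbhs_infty_gt.
have -> : th ^+ j.+1 = site_sum x th j.+1 (alpha S x).+1.
  by move: E; rewrite sj exprS; lra.
apply: cvg_near_cst; near=> M; apply: site_sum_const => //.
by near: M; exact: nbhs_infty_gt.
Unshelve. all: by end_near. Qed.

End Marginals.

Lemma cvg_prod_seq (R : realType) (J : eqType) (l : seq J)
    (T : Type) (F : set_system T) (FF : Filter F) (f : J -> T -> R) (b : J -> R) :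
  (forall j, f j y @[y --> F] --> b j) ->
  (\prod_(j <- l) f j y) @[y --> F] --> \prod_(j <- l) b j.
Proof.
move=> H; elim: l => [|j l IH].
  rewrite big_nil (_ : (fun y => _) = cst 1); first exact: cvg_cst.
  by apply/funext => y; rewrite big_nil.
rewrite big_cons (_ : (fun y => _) =
    (fun y => f j y * \prod_(i <- l) f i y)); last first.
  by apply/funext => y; rewrite big_cons.
exact: cvgM.
Qed.

(** Sums over boxes factor into one-site sums, and boxes exhaust the nonnegative multiple series. *)
Lemma esum_prod (R : realType) (n : nat) (a : 'I_n.+1 -> nat -> R) (l : 'I_n.+1 -> R) :
  (forall x k, 0 <= a x k) ->
  (forall x, \sum_(k < M) a x k @[M --> \oo] --> l x) ->
  (\esum_(eta in [set: {ffun 'I_n.+1 -> nat}]) (\prod_x a x (eta x))%:E =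
   (\prod_x l x)%:E)%E.
Proof.
move=> a0 al.
pose emb M (f : {ffun 'I_n.+1 -> 'I_M}) : {ffun 'I_n.+1 -> nat} := [ffun x => f x : nat].
have emb_inj M : injective (@emb M).
  move=> f g /ffunP fg; apply/ffunP => x; apply/val_inj.
  by have := fg x; rewrite !ffunE.
pose box M := [seq emb M f | f : {ffun 'I_n.+1 -> 'I_M}].
have ubox M : uniq (box M) by rewrite map_inj_uniq ?enum_uniq//; exact: emb_inj.
have boxE M : \sum_(eta <- box M) \prod_x a x (eta x) = \prod_x \sum_(k < M) a x k.
  rewrite bigA_distr_bigA/= big_map big_enum; apply: eq_bigr => f _.
  by apply: eq_bigr => x _; rewrite ffunE.
have P0 (eta : {ffun 'I_n.+1 -> nat}) : 0 <= \prod_x a x (eta x) by apply: prodr_ge0.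
have lim : \prod_x \sum_(k < M) a x k @[M --> \oo] --> \prod_x l x.
  exact: cvg_prod_seq.
apply/eqP; rewrite eq_le; apply/andP; split.
  apply: esum_le_seq => s us _; rewrite sumEFin lee_fin.
  rewrite -(cvg_lim _ lim)//; apply: limr_ge; first by apply/cvg_ex; eexists; exact: lim.
  have [B sB] := seq_tot_bound s; near=> M; rewrite -boxE.
  apply: ler_sum_subset_seq => // eta es.
  have BM : (B < M)%N by near: M; exact: nbhs_infty_gt.
  have hM x : (eta x < M)%N.
    by rewrite (leq_ltn_trans _ BM)// (leq_trans (le_tot x eta))// sB.
  apply/mapP; exists [ffun x => Ordinal (hM x)]; first by rewrite mem_enum.
  by apply/ffunP => x; rewrite !ffunE.
rewrite -(cvg_lim _ lim)//.
set E := esum _ _; have : (0 <= E)%E by apply: esum_ge0 => eta _; rewrite lee_fin.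
have boxle M : ((\prod_x \sum_(k < M) a x k)%:E <= E)%E.
  by rewrite -boxE -sumEFin; apply: sum_seq_le_esum.
case: E boxle => [r| |] //= boxle _; last by rewrite leey.
rewrite lee_fin; apply: limr_le; first by apply/cvg_ex; eexists; exact: lim.
by near=> M; rewrite -lee_fin boxle.
Unshelve. all: by end_near. Qed.

Section LocalEquilibrium.
Variables (R : realType) (n : nat) (S : bd_system R n).
Hypothesis hS : bd_system_ok S.
Hypothesis hsigma : sigma S = -1 \/ sigma S = 1.
Variable th : 'I_n.+1 -> R.
Hypothesis hth : forall x, in_Theta (sigma S) (th x).

Local Notation D := (dual_fun S).

Definition profile_fun (xi : dconf n) : R :=
  thetaL S ^+ xi.2.1 * thetaR S ^+ xi.2.2 * \prod_x th x ^+ xi.1 x.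

Lemma local_equilibrium_ge0 eta : 0 <= local_equilibrium S th eta.
Proof. by apply: prodr_ge0 => x _; apply: marginal_ge0. Qed.

Lemma esum_local_equilibrium (xi : dconf n) : states S xi.1 ->
  (\esum_(eta in states S) (D xi eta * local_equilibrium S th eta)%:E =
   (profile_fun xi)%:E)%E.
Proof.
move=> hxi.
pose a x k := dual_cl_site S x (xi.1 x) k * marginal S x (th x) k.
have hx x : sigma S = -1 -> (xi.1 x <= alpha S x)%N by move/hxi.
have a0 x k : 0 <= a x k by rewrite mulr_ge0 ?marginal_ge0 ?site_ge0//; exact: hx.
set c := thetaL S ^+ xi.2.1 * thetaR S ^+ xi.2.2.
have c0 : 0 <= c by rewrite mulr_ge0 ?exprn_ge0 ?thetaL_ge0 ?thetaR_ge0.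
transitivity (\esum_(eta in states S) (c%:E * (\prod_x a x (eta x))%:E))%E.
  apply: eq_esum => eta _; rewrite -EFinM /a big_split/= /dual_fun /dual_cl /=.
  by congr (_%:E); rewrite /local_equilibrium /c; ring.
rewrite esumZl//; last by move=> eta _; rewrite lee_fin prodr_ge0.
(* The marginals vanish outside [states S], so the sum extends to all of N_0^V, where it
   factorizes. *)
rewrite esum_mkcond.
rewrite (eq_esum (b := fun eta : conf n => (\prod_x a x (eta x))%:E)); last first.
  move=> eta _; case: ifPn => // /negP hN.
  have [x ex] : exists x, ~~ ((sigma S == -1) ==> (eta x <= alpha S x)%N).
    apply: contrapT => H; apply: hN; rewrite inE => s x.
    by apply: contrapT => /negP N; apply: H; exists x; rewrite s eqxx.
  rewrite (bigD1 x)//= /a; move: ex; rewrite negb_imply -ltnNge => /andP[/eqP s ax].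
  by rewrite marginal_small// mulr0 mul0r.
rewrite (@esum_prod _ _ a (fun x => th x ^+ xi.1 x))//.
by move=> x; apply: site_sum_cvg => //; exact: hx.
Qed.

End LocalEquilibrium.

(** * Time derivative at local equilibrium and irreducibility *)

Section ProfileFun.
Variables (R : realType) (n : nat) (S : bd_system R n).
Hypothesis hS : bd_system_ok S.
Hypothesis hsigma : sigma S = -1 \/ sigma S = 1.
Variable th : 'I_n.+1 -> R.
Hypothesis th_gt0 : forall x, 0 < th x.
Hypothesis th_harm : forall x, walk_gen S (thetaL S) (thetaR S) th x = 0.

Local Notation V := 'I_n.+1.
Local Notation sg := ((sigma S)%:~R : R).
Local Notation al x := ((alpha S x)%:R : R).
Local Notation phi := (profile_fun S th).
Local Notation A := (jgen (drate S) (@dmove n)).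
Implicit Types (x y : V) (eta : conf n).

Lemma profile_fun_decr x (xi : dconf n) (l r : nat) : (0 < xi.1 x)%N ->
  phi (decr x xi.1, (l, r)) =
  thetaL S ^+ l * thetaR S ^+ r * (\prod_z th z ^+ xi.1 z) / th x.
Proof.
move=> x0; rewrite /profile_fun /= -[RHS]mulrA; congr (_ * _).
rewrite (bigD1 x)//= [in RHS](bigD1 x)//= ffunE eqxx subn1.
rewrite -[in RHS](prednK x0) exprS.
have -> : \prod_(i | i != x) th i ^+ decr x xi.1 i = \prod_(i | i != x) th i ^+ xi.1 i.
  by apply: eq_bigr => i /negbTE ix; rewrite ffunE ix subn0.
by field; rewrite gt_eqF.
Qed.

Lemma profile_fun_incr x eta (lr : nat * nat) :
  phi (incr x eta, lr) = th x * phi (eta, lr).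
Proof.
rewrite /profile_fun /= mulrCA; congr (_ * _).
rewrite (bigD1 x)//= [in RHS](bigD1 x)//= ffunE eqxx addn1 exprS -mulrA; congr (_ * (_ * _)).
by apply: eq_bigr => i /negbTE ix; rewrite ffunE ix addn0.
Qed.

Lemma profile_fun_move x y (xi : dconf n) : (0 < xi.1 x)%N ->
  phi (incr y (decr x xi.1), xi.2) = phi xi * (th y / th x).
Proof.
move=> x0; case: xi x0 => [b [l r]] /= x0.
rewrite profile_fun_incr (@profile_fun_decr x (b, (l, r)))// /profile_fun/=; ring.
Qed.

Definition edge_energy (xi : dconf n) : R :=
  \sum_x \sum_y omega S x y * (xi.1 x)%:R * (xi.1 y)%:R *
     ((th y - th x) ^+ 2 / (th x * th y)).

(* By harmonicity only the interaction part of the generator survives. *)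
Lemma jgen_profile_fun (xi : dconf n) :
  A phi xi = sg * (phi xi * edge_energy xi / 2).
Proof.
rewrite /jgen sum_dmoves.
have -> : \sum_x \sum_y drate S (inl (x, y)) xi *
    (phi (dmove (inl (x, y)) xi) - phi xi) =
    \sum_x \sum_y (xi.1 x)%:R * phi xi / th x * (omega S x y * al y * (th y - th x)) +
    sg * phi xi * \sum_x \sum_y omega S x y * (xi.1 x)%:R * (xi.1 y)%:R *
      ((th y - th x) / th x).
  rewrite mulr_sumr -big_split; apply: eq_bigr => x _ /=.
  rewrite mulr_sumr -big_split; apply: eq_bigr => y _ /=.
  have [->|x0] := posnP (xi.1 x); first by ring.
  by rewrite profile_fun_move//; field; rewrite gt_eqF.
set E := \sum_x \sum_y omega S x y * _ * _ * _.
(* Symmetrization: with a = th x and b = th y, (b - a) / a + (a - b) / b = (b - a)^2 / (a b). *)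
have -> : edge_energy xi = 2 * E.
  have -> : 2 * E = E + E by ring.
  rewrite {2}/E exchange_big/= -big_split; apply: eq_bigr => x _ /=.
  rewrite -big_split; apply: eq_bigr => y _ /=.
  by rewrite (omega_sym hS y x); field; rewrite !gt_eqF.
have harm : \sum_x (xi.1 x)%:R * phi xi / th x * walk_gen S (thetaL S) (thetaR S) th x = 0.
  by rewrite big1// => x _; rewrite th_harm mulr0.
transitivity (sg * phi xi * E +
  \sum_x (xi.1 x)%:R * phi xi / th x * walk_gen S (thetaL S) (thetaR S) th x); last first.
  by rewrite harm addr0; field.
rewrite [X in X + _ + _]addrC -!addrA; congr (_ + _).
have -> : \sum_x (xi.1 x)%:R * phi xi / th x * walk_gen S (thetaL S) (thetaR S) th x =
    \sum_x \sum_y (xi.1 x)%:R * phi xi / th x * (omega S x y * al y * (th y - th x)) +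
    (\sum_x (xi.1 x)%:R * phi xi / th x * (rateL S x * (thetaL S - th x)) +
    \sum_x (xi.1 x)%:R * phi xi / th x * (rateR S x * (thetaR S - th x))).
  rewrite -!big_split; apply: eq_bigr => x _ /=.
  by rewrite /walk_gen !mulrDr mulr_sumr addrA.
congr (_ + _); congr (_ + _).
- rewrite [RHS](bigD1 ord0)//= [X in _ = _ + X]big1 ?addr0; last first.
    by move=> x /negbTE x0; rewrite /rateL x0 /=; ring.
  rewrite /rateL eqxx /=.
  rewrite /=; have [->|x0] := posnP (xi.1 ord0); first by ring.
  rewrite profile_fun_decr// exprS /profile_fun; field.
  by rewrite gt_eqF.
- rewrite [RHS](bigD1 ord_max)//= [X in _ = _ + X]big1 ?addr0; last first.
    by move=> x /negbTE x0; rewrite /rateR x0 /=; ring.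
  rewrite /rateR eqxx /=.
  rewrite /=; have [->|x0] := posnP (xi.1 ord_max); first by ring.
  rewrite profile_fun_decr// exprS /profile_fun; field.
  by rewrite gt_eqF.
Qed.

Lemma profile_fun_ge0 xi : 0 <= phi xi.
Proof.
rewrite /profile_fun !mulr_ge0 ?exprn_ge0 ?thetaL_ge0 ?thetaR_ge0//.
by apply: prodr_ge0 => x _; rewrite exprn_ge0// ltW.
Qed.

Lemma edge_energy_ge0 xi : 0 <= edge_energy xi.
Proof.
apply: sumr_ge0 => x _; apply: sumr_ge0 => y _.
apply: mulr_ge0; first by rewrite !mulr_ge0 ?(omega_ge0 hS).
  by rewrite divr_ge0 ?sqr_ge0// mulr_ge0// ltW.
Qed.

Lemma edge_energy_gt0 x y (xi : dconf n) : omega S x y != 0 -> th x != th y ->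
  (0 < xi.1 x)%N -> (0 < xi.1 y)%N -> 0 < edge_energy xi.
Proof.
move=> xy txy x0 y0; have term a b : 0 <= omega S a b * (xi.1 a)%:R * (xi.1 b)%:R *
     ((th b - th a) ^+ 2 / (th a * th b)).
  apply: mulr_ge0; first by rewrite !mulr_ge0 ?(omega_ge0 hS).
  by rewrite divr_ge0 ?sqr_ge0// mulr_ge0// ltW.
rewrite /edge_energy (bigD1 x)//= ltr_wpDr ?sumr_ge0// => [a _|].
  by rewrite sumr_ge0.
rewrite (bigD1 y)//= ltr_wpDr ?sumr_ge0//.
apply: mulr_gt0.
  by rewrite !mulr_gt0 ?ltr0n// lt_neqAle eq_sym xy (omega_ge0 hS).
apply: divr_gt0; last by rewrite mulr_gt0.
rewrite lt_neqAle sqr_ge0 andbT eq_sym sqrf_eq0 subr_eq0.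
by rewrite eq_sym.
Qed.

End ProfileFun.

Section Transport.
Variables (R : realType) (n : nat) (S : bd_system R n).
Hypothesis hS : bd_system_ok S.
Hypothesis hsigma : sigma S = -1 \/ sigma S = 1.

Local Notation V := 'I_n.+1.
Local Notation sg := ((sigma S)%:~R : R).
Local Notation al x := ((alpha S x)%:R : R).
Implicit Types (x y w : V) (eta : conf n).

Definition room eta x : bool := al x + sg * (eta x)%:R != 0.

Variable P : conf n -> Prop.
Hypothesis P_move : forall x y eta, states S eta -> omega S x y != 0 ->
  (0 < eta x)%N -> room eta y -> P (incr y (decr x eta)) -> P eta.

Lemma room0 eta x : eta x = 0%N -> room eta x.
Proof.
by rewrite /room => ->; rewrite mulr0 addr0 pnatr_eq0 -lt0n (alpha_gt0 hS).
Qed.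

Lemma roomN eta x : ~~ room eta x -> sigma S = -1 /\ eta x = alpha S x.
Proof.
rewrite negbK; case: hsigma => s; rewrite s.
  by rewrite mulN1r subr_eq0 eqr_nat => /eqP.
rewrite mul1r -natrD pnatr_eq0 addn_eq0 => /andP[/eqP a0 _].
by have := alpha_gt0 hS x; rewrite a0.
Qed.

Lemma room_full eta x : sigma S = -1 -> (eta x < alpha S x)%N -> room eta x.
Proof. by move=> s lt; rewrite /room s mulN1r subr_eq0 eqr_nat gtn_eqF. Qed.

Lemma room_le eta eta' x : states S eta -> (eta' x <= eta x)%N -> room eta x -> room eta' x.
Proof.
move=> he le r; apply: contraT => /roomN[s e'].
move: r; rewrite /room s mulN1r subr_eq0 eqr_nat eqn_leq.
by rewrite (he s x) andbT -e' le.
Qed.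

(* If the next site is full, its particle is moved to the target first and the
   freed place is then used. *)
Lemma transport x w eta : states S eta -> (0 < eta x)%N -> room eta w ->
  P (incr w (decr x eta)) -> P eta.
Proof.
have /connectP[s] := omega_connected hS x w.
elim: s x eta => [|y s IH] x eta /=.
  move=> _ -> _ x0 _; congr P; apply/ffunP => z; rewrite !ffunE.
  by case: eqVneq => [->|_]; rewrite /=; lia.
move=> /andP[xy ys] wE he x0 rw Pw.
have xNy : x != y by apply: contraNneq xy => <-; rewrite (omega_diag hS).
have [ry|/roomN[s1 ey]] := boolP (room eta y).
  apply: (P_move he xy x0 ry).
  have [yw|yNw] := eqVneq y w; first by rewrite yw.
  apply: (IH y) => //.
  - exact: states_move.
  - by rewrite !ffunE eqxx addn1.
  - apply: room_le rw => //; rewrite !ffunE (negbTE (_ : w != y)) 1?eq_sym//.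
    by rewrite addn0 leq_subr.
  congr P: Pw; apply/ffunP => z; rewrite !ffunE.
  by case: (z == y); rewrite ?addn0 ?subn0// addnK.
have yNw : y != w.
  apply/eqP => yw; move: rw; rewrite -yw /room s1 ey mulN1r subrr eqxx//.
have y0 : (0 < eta y)%N by rewrite ey (alpha_gt0 hS).
apply: (IH y) => //.
apply: (P_move (x := x) (y := y)) => //.
- exact: states_move.
- by rewrite !ffunE (negbTE xNy) subn0 addn_gt0 x0.
- apply: room_full => //; rewrite !ffunE eqxx (negbTE yNw) addn0 ey subn1.
  by rewrite ltn_predL (alpha_gt0 hS).
congr P: Pw; apply/ffunP => z; rewrite !ffunE.
have [->|zy] := eqVneq z y.
  by rewrite eq_sym (negbTE xNy) (negbTE yNw); lia.
have [->|zx] := eqVneq z x; last by lia.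
lia.
Qed.

(** Irreducibility as a backward induction along moves, so that no path is written down: one
    particle is brought to x, then another to y without emptying x. *)
Lemma transport_pair x y eta : x != y ->
  (forall eta', states S eta' -> tot eta' = tot eta ->
     (0 < eta' x)%N -> (0 < eta' y)%N -> P eta') ->
  states S eta -> (2 <= tot eta)%N -> P eta.
Proof.
move=> xNy base he.
have stepB eta' : states S eta' -> tot eta' = tot eta -> (2 <= tot eta')%N ->
    (0 < eta' x)%N -> P eta'.
  move=> he' te' te2 x0; have [y0|y0] := posnP (eta' y); last exact: base.
  (* The second particle is taken at [u], which may be x only if x holds at least two. *)
  have [u u0 ux] : exists2 u, (0 < eta' u)%N & (u == x) ==> (1 < eta' x)%N.
    have [x1|x1] := boolP (1 < eta' x)%N; first by exists x; rewrite ?eqxx ?x1.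
    have := te2; rewrite /tot (bigD1 x)//= => le2.
    have : (0 < \sum_(i | i != x) eta' i)%N.
      by rewrite -(ltn_add2l (eta' x)) addn0 (leq_trans _ le2)// ltnS leqNgt.
    rewrite lt0n sum_nat_eq0 negb_forall => /existsP[u].
    rewrite negb_imply -lt0n => /andP[ux u0]; exists u => //.
  have uNy : u != y by apply: contraTneq u0 => ->; rewrite y0.
  apply: (transport (x := u) (w := y)) => //; first exact: room0.
  apply: base.
  - by apply: states_move => //; exact: room0.
  - by rewrite tot_move.
  - rewrite !ffunE (negbTE xNy) addn0; move: ux; rewrite eq_sym.
    by case: eqVneq => /= [->|_ _]; rewrite ?subn0 ?addn0 //=; lia.
  - by rewrite !ffunE eqxx addn1.
move=> te2; have [x0|x0] := posnP (eta x); last exact: stepB.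
have : (0 < tot eta)%N by lia.
rewrite lt0n sum_nat_eq0 negb_forall => /existsP[u].
rewrite negb_imply -lt0n => /andP[_ u0].
have rx := room0 x0.
apply: (transport (x := u) (w := x)) => //; apply: stepB.
- exact: states_move.
- by rewrite tot_move.
- by rewrite tot_move.
- by rewrite !ffunE eqxx addn1.
Qed.

End Transport.

(** * The stationary profile and the strict comparison of moments *)

Section Profile.
Variables (R : realType) (n : nat) (S : bd_system R n).
Hypothesis hS : bd_system_ok S.
Hypothesis hsigma : sigma S = -1 \/ sigma S = 1.
Hypothesis hL : 0 < omegaL S.
Hypothesis hR : 0 < omegaR S.
Variable p : R -> conf n -> conf n -> R.
Hypothesis hp : is_markov_process S p.
Variable mu : conf n -> R.
Hypothesis hmu : is_stationary S p mu.
Hypothesis htheta : thetaL S != thetaR S.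

Local Notation V := 'I_n.+1.
Local Notation sg := ((sigma S)%:~R : R).
Local Notation al x := ((alpha S x)%:R : R).
Local Notation D := (dual_fun S).
Local Notation A := (jgen (drate S) (@dmove n)).
Local Notation th := (profile S mu).
Local Notation phi := (profile_fun S th).
Local Notation mom := (moment S mu).
Implicit Types (x y : V) (eta : conf n) (K : nat) (t : R).

Definition delta1 x : conf n := [ffun z => (z == x) : nat].

Lemma site0 x k : dual_cl_site S x 0 k = 1.
Proof.
rewrite /dual_cl_site ffactn0 div1r /weight ffactn0 addn0.
by case: hsigma => s; rewrite s/= ?invr1// divff ?invr1.
Qed.

Lemma site1 x k : dual_cl_site S x 1 k = k%:R / al x.
Proof.
rewrite /dual_cl_site ffactn1 /weight; case: hsigma => s; rewrite s/= ?ffactn1//.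
have a0 := alpha_gt0 hS x.
by rewrite addn1/= -[X in X`!%:R](prednK a0) factS prednK// natrM mulfK.
Qed.

Lemma tot_delta1 x : tot (delta1 x) = 1%N.
Proof.
rewrite /tot (bigD1 x)//= ffunE eqxx big1// => y /negbTE yx.
by rewrite ffunE yx.
Qed.

Lemma states_delta1 x : states S (delta1 x).
Proof. by move=> s y; rewrite ffunE; case: eqP => // _; exact: alpha_gt0. Qed.

Lemma dual_fun_delta1 x eta : D (delta1 x, (0%N, 0%N)) eta = (eta x)%:R / al x.
Proof.
rewrite /dual_fun /dual_cl /= !expr0 mul1r mulr1 (bigD1 x)//= big1.
  by rewrite ffunE eqxx site1 mulr1.
by move=> y /negbTE yx; rewrite ffunE yx site0.
Qed.

Lemma dual_fun_no_bulk b (l r : nat) eta : tot b = 0%N ->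
  D (b, (l, r)) eta = thetaL S ^+ l * thetaR S ^+ r.
Proof.
move=> b0; rewrite /dual_fun /dual_cl /= big1 ?mulr1// => y _.
have -> : b y = 0%N by have := le_tot y b; rewrite b0 leqn0 => /eqP.
exact: site0.
Qed.

Lemma dconfs1_delta1 x : (delta1 x, (0%N, 0%N)) \in dconfs S 1.
Proof. by apply/dconfsP; split; [exact: states_delta1|rewrite /dsize/= tot_delta1]. Qed.

Lemma moment_no_bulk (b : conf n) (l r : nat) : tot b = 0%N ->
  mom (b, (l, r)) = thetaL S ^+ l * thetaR S ^+ r.
Proof.
move=> b0; rewrite /moment.
set c := _ * _.
have c0 : 0 <= c by rewrite mulr_ge0 ?exprn_ge0 ?thetaL_ge0 ?thetaR_ge0.
rewrite (eq_esum (b := fun eta : conf n => (c%:E * (mu eta)%:E)%E)).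
  rewrite esumZl//; last by move=> eta he; rewrite lee_fin (stationary_ge0 hmu).
  by rewrite (stationary_sum1 hmu) mule1.
by move=> eta _; rewrite dual_fun_no_bulk// EFinM.
Qed.

Lemma profile_moment x : th x = mom (delta1 x, (0%N, 0%N)).
Proof.
rewrite /profile; apply: (proj2 (expect_ge0 _ _)).
  by move=> eta he; rewrite mulr_ge0 ?divr_ge0// (stationary_ge0 hmu).
rewrite -(momentE hS hsigma hL hR hp hmu (dconfs1_delta1 x)).
by apply: eq_esum => eta _; rewrite dual_fun_delta1.
Qed.

Lemma tot_decr_delta1 x : tot (decr x (delta1 x)) = 0%N.
Proof.
by apply: succn_inj; rewrite tot_decr ?tot_delta1// ffunE eqxx.
Qed.

(** This is the vanishing of the dual generator on moments with one particle: a lone particle meets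
    only empty sites, so the interaction drops out. *)
Lemma profile_harmonic x : walk_gen S (thetaL S) (thetaR S) th x = 0.
Proof.
have := jgen_moment hS hsigma hL hR hp hmu (dconfs1_delta1 x).
rewrite /jgen sum_dmoves/=.
rewrite (bigD1 x)//= [X in _ + X + _ + _]big1 ?addr0; last first.
  move=> y yx; rewrite big1// => z _; rewrite ffunE (negbTE yx) /=; ring.
move=> E; rewrite -[RHS]E /walk_gen; congr (_ + _ + _).
- apply: eq_bigr => y _; rewrite !ffunE eqxx.
  have [->|yx] := eqVneq y x; first by rewrite (omega_diag hS) !mul0r.
  have -> : incr y (decr x (delta1 x)) = delta1 y.
    apply/ffunP => z; rewrite !ffunE; have [->|zx] := eqVneq z x; by [].
  by rewrite -!profile_moment /=; ring.
- rewrite /rateL ffunE [ord0 == x]eq_sym; have [->|x0] := eqVneq x ord0; last first.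
    by rewrite /=; ring.
  by rewrite moment_no_bulk ?tot_decr_delta1// -profile_moment /=; ring.
- rewrite /rateR ffunE [ord_max == x]eq_sym; have [->|x0] := eqVneq x ord_max; last first.
    by rewrite /=; ring.
  by rewrite moment_no_bulk ?tot_decr_delta1// -profile_moment /=; ring.
Qed.

Lemma profile_ge0 x : 0 <= th x.
Proof.
rewrite profile_moment /moment fine_ge0// esum_ge0// => eta he.
by rewrite lee_fin dual_fun_delta1 mulr_ge0 ?divr_ge0// (stationary_ge0 hmu).
Qed.

Lemma profile_le1 x : sigma S = -1 -> th x <= 1.
Proof.
move=> s; rewrite -lee_fin profile_moment.
rewrite -(momentE hS hsigma hL hR hp hmu (dconfs1_delta1 x)) -(stationary_sum1 hmu).
apply: le_esum => eta he; rewrite lee_fin dual_fun_delta1.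
rewrite ler_piMl ?(stationary_ge0 hmu)// ler_pdivrMr ?ltr0n ?(alpha_gt0 hS)//.
by rewrite mul1r ler_nat he.
Qed.

Lemma profile_Theta x : in_Theta (sigma S) (th x).
Proof. by split; [exact: profile_ge0|exact: profile_le1]. Qed.

(** A zero would spread to all sites by the minimum principle, and harmonicity at the two ends would
    force both reservoir parameters to be 0, hence equal. *)
Lemma profile_gt0 x : 0 < th x.
Proof.
rewrite lt_neqAle profile_ge0 andbT eq_sym; apply/eqP => x0.
have Hm y : th y = 0 -> \sum_z omega S y z * al z * (th z - th y) <= 0.
  move=> y0; rewrite -[leRHS](profile_harmonic y) /walk_gen y0 !subr0 -addrA lerDl.
  by rewrite addr_ge0// mulr_ge0 ?rateL_ge0 ?rateR_ge0 ?thetaL_ge0 ?thetaR_ge0.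
have z y : th y = 0 := min_propagates hS profile_ge0 Hm y x0.
have EL := profile_harmonic ord0; have ER := profile_harmonic ord_max.
have sum0 y : \sum_y0 omega S y y0 * al y0 * (th y0 - th y) = 0.
  by rewrite big1// => y0 _; rewrite !z subrr mulr0.
have l0 := rateL_gt0 hS hL; have r0 := rateR_gt0 hS hR.
have tl := thetaL_ge0 hS; have tr := thetaR_ge0 hS.
move: EL ER; rewrite /walk_gen !sum0 !add0r !z !subr0 => EL ER.
have PL y : 0 <= rateL S y * thetaL S by rewrite mulr_ge0 ?rateL_ge0.
have PR y : 0 <= rateR S y * thetaR S by rewrite mulr_ge0 ?rateR_ge0.
have tl0 : thetaL S = 0.
  have /eqP : rateL S ord0 * thetaL S = 0 by move: EL (PL ord0) (PR ord0); lra.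
  by rewrite mulf_eq0 gt_eqF//= => /eqP.
have tr0 : thetaR S = 0.
  have /eqP : rateR S ord_max * thetaR S = 0.
    by move: ER (PL ord_max) (PR ord_max); lra.
  by rewrite mulf_eq0 gt_eqF//= => /eqP.
by move: htheta; rewrite tl0 tr0 eqxx.
Qed.

(** With two sites or more the ends are distinct and each feels one reservoir only; a constant
    profile would have to equal both [thetaL S] and [thetaR S]. *)
Lemma profile_edge : (0 < n)%N ->
  exists x y, omega S x y != 0 /\ th x != th y.
Proof.
move=> n0; apply: contrapT => H.
have c y : th y = th ord0.
  apply: (omega_connect_ind hS (P := fun y => th y = th ord0)) (erefl (th ord0)) => a b ab <-.
  by apply/eqP; rewrite eq_sym; apply: contraT => nab; case: H; exists a, b.
have sum0 y : \sum_y0 omega S y y0 * al y0 * (th y0 - th y) = 0.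
  by rewrite big1// => y0 _; rewrite !c subrr mulr0.
have neq : (ord_max == ord0 :> V) = false by rewrite -val_eqE/= gtn_eqF.
have l0 := rateL_gt0 hS hL; have r0 := rateR_gt0 hS hR.
have := profile_harmonic ord0; have := profile_harmonic ord_max.
rewrite /walk_gen !sum0 !add0r !c.
have -> : rateL S ord_max = 0 by rewrite /rateL neq mulr0.
have -> : rateR S ord0 = 0 by rewrite /rateR eq_sym neq mulr0.
rewrite !mul0r add0r addr0 => /eqP; rewrite mulf_eq0 gt_eqF//= subr_eq0 => /eqP tr.
move=> /eqP; rewrite mulf_eq0 gt_eqF//= subr_eq0 => /eqP tl.
by move: htheta; rewrite tl tr eqxx.
Qed.

Lemma jgen_profile_ge0 xi : 0 <= sg * A phi xi.
Proof.
rewrite jgen_profile_fun//; [|exact: profile_gt0|exact: profile_harmonic].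
have -> : sg * (sg * (phi xi * edge_energy S th xi / 2)) = phi xi * edge_energy S th xi / 2.
  by rewrite mulrA; case: hsigma => ->; rewrite ?mulN1r ?opprK !mul1r.
by rewrite divr_ge0// mulr_ge0 ?profile_fun_ge0 ?edge_energy_ge0//; exact: profile_gt0.
Qed.

(** Positivity of some iterate is pulled back along bulk moves from configurations with particles at
    both ends of an edge where the profile varies. The conditions on the reservoirs keep the powers
    of theta positive there. *)
Lemma dsg_jgen_profile_gt0 K (xi : dconf n) t : xi \in dconfs S K -> (2 <= tot xi.1)%N ->
  (0 < n)%N -> (thetaL S = 0 -> xi.2.1 = 0%N) -> (thetaR S = 0 -> xi.2.2 = 0%N) ->
  0 < t -> 0 < sg * dsg S K t (A phi) xi.
Proof.
move=> hxi te2 n0 hl hr t0.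
(* The summand 0 matches the shape required by [jsg_linear]. *)
pose psi (z : dconf n) := sg * A phi z + 0.
have psi0 : {in dconfs S K, forall z, 0 <= psi z}.
  by move=> z _; rewrite /psi addr0 jgen_profile_ge0.
have r0 := @drate_ge0 _ _ _ hS hsigma K; have mQ := @dmove_dconfs _ _ _ hS hsigma K.
have -> : sg * dsg S K t (A phi) xi = dsg S K t psi xi.
  by rewrite /dsg jsg_linear// jsg_const addr0.
pose P eta := (eta, xi.2) \in dconfs S K ->
  exists k, 0 < iter k (junif (drate S) (@dmove n) (dconfs S K)) psi (eta, xi.2).
suff : P xi.1.
  rewrite /P -surjective_pairing => /(_ hxi)[k hk].
  exact: (jsg_gt0 r0 mQ t0 psi0 hxi hk).
have [x [y [xy txy]]] := profile_edge n0.
have xNy : x != y by apply: contraNneq xy => <-; rewrite (omega_diag hS).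
have /dconfsP[hxi1 hK] := hxi.
apply: (transport_pair hS hsigma (P := P) _ xNy) => //.
- move=> a b eta he ab a0 rb Pmove hz.
  have rab : 0 < drate S (inl (a, b)) (eta, xi.2).
    rewrite /= !mulr_gt0 ?ltr0n//.
      by rewrite lt_neqAle eq_sym ab (omega_ge0 hS).
    by rewrite lt_neqAle eq_sym room_ge0// andbT; exact: rb.
  have hz' := mQ (inl (a, b)) _ hz (lt0r_neq0 rab).
  have [k hk] := Pmove hz'; exists k.+1; rewrite iterS.
  apply: (junif_gt0 r0 mQ (i := inl (a, b))) => // z zQ.
  exact: (iter_junif_ge0 r0 mQ).
- move=> eta he teta x0 y0 hz; exists 0%N; rewrite /= /psi addr0.
  rewrite jgen_profile_fun//; [|exact: profile_gt0|exact: profile_harmonic].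
  set z := (eta, xi.2).
  have -> : sg * (sg * (phi z * edge_energy S th z / 2)) = phi z * edge_energy S th z / 2.
    by rewrite mulrA; case: hsigma => ->; rewrite ?mulN1r ?opprK !mul1r.
  rewrite divr_gt0// mulr_gt0 ?(edge_energy_gt0 hS profile_gt0 xy)//.
  rewrite /profile_fun /= mulr_gt0//; last first.
    by apply: prodr_gt0 => i _; rewrite exprn_gt0// profile_gt0.
  have powgt0 (v : R) k : 0 <= v -> (v = 0 -> k = 0%N) -> 0 < v ^+ k.
    rewrite le_eqVlt => /orP[/eqP <- /(_ erefl) ->|v0 _]; first by rewrite expr0.
    by rewrite exprn_gt0.
  by rewrite mulr_gt0// powgt0 ?thetaL_ge0 ?thetaR_ge0.
Qed.

(** The functions [phi] and [mom] agree once all particles are absorbed, so their difference decays,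
    and [mom] is invariant under the semigroup. *)
Lemma dsg_profile_cvg K (xi : dconf n) : xi \in dconfs S K ->
  exists k C, [/\ 0 < k, 0 <= C & forall t, 0 <= t ->
    `|dsg S K t phi xi - mom xi| <= C * expR (- k * t)].
Proof.
move=> hxi; have [k k0 abs] := absorption hS hsigma hL hR K.
have r0 := @drate_ge0 _ _ _ hS hsigma K; have mQ := @dmove_dconfs _ _ _ hS hsigma K.
have [|C C0 HC] := abs xi (fun z => -1 * mom z + phi z) hxi.
  move=> [b [l r]] _ /= b0; rewrite moment_no_bulk// /profile_fun/= big1 ?mulr1.
    by rewrite mulN1r addNr.
  move=> x _; have -> : b x = 0%N by have := le_tot x b; rewrite b0 leqn0 => /eqP.
  by rewrite expr0.
exists k, C; split => // t t0; have := HC t t0.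
rewrite /dsg jsg_linear// mulN1r addrC -!/(dsg _ _ _ _ _).
by rewrite (dsg_moment hS hsigma hL hR hp hmu).
Qed.

(** The function [G] increases strictly from [sg * phi xi] and tends to [sg * mom xi]; the gap
    gained on [0, 1] persists in the limit. *)
Lemma moment_profile_lt K (xi : dconf n) : xi \in dconfs S K -> (2 <= tot xi.1)%N ->
  (0 < n)%N -> (thetaL S = 0 -> xi.2.1 = 0%N) -> (thetaR S = 0 -> xi.2.2 = 0%N) ->
  sg * phi xi < sg * mom xi.
Proof.
move=> hxi te2 n0 hl hr.
have [k [C [k0 C0 HC]]] := dsg_profile_cvg hxi.
have r0 := @drate_ge0 _ _ _ hS hsigma K; have mQ := @dmove_dconfs _ _ _ hS hsigma K.
pose G t := sg * dsg S K t phi xi.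
have dG (t : R) : is_derive t 1 G (sg * dsg S K t (A phi) xi).
  have d : is_derive t 1 (fun s => dsg S K s phi xi) (dsg S K t (A phi) xi).
    exact: jsg_derive.
  exact: (is_deriveZ sg d).
have Gpos t : 0 < t -> 0 < sg * dsg S K t (A phi) xi.
  by move=> t0; exact: dsg_jgen_profile_gt0.
have Gincr (a b : R) : 0 <= a -> a < b -> G a < G b.
  move=> a0 ab; have [|c + E] := @MVT _ G _ a b ab (fun (t : R) _ => dG t).
    by apply: continuous_subspaceT => t; exact: is_derive_continuous (dG t).
  rewrite in_itv/= => /andP[ac _].
  by rewrite -subr_gt0 E mulr_gt0 ?subr_gt0 ?Gpos// (le_lt_trans a0).
have G0 : G 0 = sg * phi xi by rewrite /G /dsg jsg0.
have G01 : G 0 < G 1 by exact: Gincr.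
rewrite -G0 ltNge; apply/negP => le.
have e0 : 0 < G 1 - G 0 by rewrite subr_gt0.
(* At time [t + 1] the error [C * expR (- k * (t + 1))] is below the gap, by [expR x >= 1 + x]. *)
pose t : R := 1 + C / (G 1 - G 0) / k.
have t1 : 1 < t + 1.
  rewrite /t; have : 0 <= C / (G 1 - G 0) / k by rewrite divr_ge0 ?(ltW k0)// divr_ge0// ltW.
  by lra.
have t0 : 0 <= t + 1 by rewrite (le_trans _ (ltW t1)).
have := HC _ t0; rewrite leNgt => /negP; apply.
apply: (@lt_le_trans _ _ (G 1 - G 0)).
  rewrite mulNr expRN ltr_pdivrMr ?expR_gt0// mulrC -ltr_pdivrMr//.
  apply: lt_le_trans (expR_ge1Dx _).
  rewrite /t !mulrDr mulrCA divff ?gt_eqF// !mulr1; lra.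
have := Gincr 1 (t + 1) ler01 t1 => /ltW Gt.
apply: (@le_trans _ _ (sg * (dsg S K (t + 1) phi xi - mom xi))).
  by rewrite mulrBr -/(G _) lerB.
rewrite (le_trans (ler_norm _))// normrM.
by case: hsigma => ->; rewrite ?normrN1 ?normr1 mul1r.
Qed.

End Profile.

(** * Expectations of signed observables and the two inequalities *)

Section Expect.
Variables (R : realType) (n : nat) (S : bd_system R n).
Implicit Types (mu f g h : conf n -> R).

(** The parts in [expect] are those of [f * mu], not [g] and [h]; summability makes the value
    independent of the chosen difference of nonnegative terms. *)
Lemma expectB mu f g h (a b : R) :
  (forall eta, states S eta -> 0 <= g eta * mu eta) ->
  (forall eta, states S eta -> 0 <= h eta * mu eta) ->
  (\esum_(eta in states S) (g eta * mu eta)%:E = a%:E)%E ->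
  (\esum_(eta in states S) (h eta * mu eta)%:E = b%:E)%E ->
  (forall eta, f eta = g eta - h eta) ->
  integrable_pmf S mu f /\ expect S mu f = a - b.
Proof.
move=> g0 h0 ga hb fE.
pose G eta := (g eta * mu eta)%:E; pose H eta := (h eta * mu eta)%:E.
have sG : summable (states S) G.
  by rewrite /summable (eq_esum (b := G)) ?ga ?ltry// => eta he; rewrite gee0_abs ?lee_fin ?g0.
have sH : summable (states S) H.
  by rewrite /summable (eq_esum (b := H)) ?hb ?ltry// => eta he; rewrite gee0_abs ?lee_fin ?h0.
have fGH : (fun eta => (f eta * mu eta)%:E) = (G \- H)%E.
  by apply/funext => eta; rewrite /G /H /= -EFinB -mulrBl fE.
have sGH := summableB sG sH.
split; first by rewrite /integrable_pmf fGH.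
have posE : (\esum_(eta in states S) ((fun eta => f eta * mu eta)^\+ eta)%:E =
    \esum_(eta in states S) (G \- H)^\+%E eta)%E.
  by rewrite -fGH; apply: eq_esum => eta _; rewrite funeposE /funrpos EFin_max.
have negE : (\esum_(eta in states S) ((fun eta => f eta * mu eta)^\- eta)%:E =
    \esum_(eta in states S) (G \- H)^\-%E eta)%E.
  by rewrite -fGH; apply: eq_esum => eta _; rewrite funenegE /funrneg EFin_max EFinN.
rewrite /expect /= posE negE.
have fin1 : (\esum_(eta in states S) (G \- H)^\+%E eta)%E \is a fin_num.
  have := summable_funepos sGH; rewrite summableE; congr (_ \is a fin_num).
  by apply: eq_esum => eta _; rewrite gee0_abs.
have fin2 : (\esum_(eta in states S) (G \- H)^\-%E eta)%E \is a fin_num.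
  have := summable_funeneg sGH; rewrite summableE; congr (_ \is a fin_num).
  by apply: eq_esum => eta _; rewrite gee0_abs.
by rewrite -fineB// esumB// ga hb.
Qed.

End Expect.

Theorem theorem3p4 (R : realType) (n : nat) (S : bd_system R n)
    (p : R -> conf n -> conf n -> R) (mu : conf n -> R)
    (hS : bd_system_ok S)
    (hp : is_markov_process S p)
    (hmu : is_stationary S p mu)
    (hsigma : sigma S = -1 \/ sigma S = 1)
    (hL : 0 < omegaL S) (hR : 0 < omegaR S)
    (htheta : thetaL S != thetaR S) :
  (forall xi : dual_conf n, dual_states S xi ->
     (2 <= \sum_(x : 'I_n.+1) dual_bulk xi x)%N ->
     (* nondegeneracy: at least two sites, and [dual_cl S xi] is not
        identically zero *)
     (0 < n)%N ->
     (thetaL S = 0 -> dual_L xi = 0%N) ->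
     (thetaR S = 0 -> dual_R xi = 0%N) ->
     forall t : R, 0 < t ->
       let law s := law_at S p (local_equilibrium S (profile S mu)) s in
       let F s := expect S (law s) (dual_cl S xi) in
       [/\ integrable_pmf S (law t) (dual_cl S xi),
           derivable F t 1,
           sigma S = -1 -> F^`()%classic t < 0
         & sigma S = 1 -> 0 < F^`()%classic t])
  /\
  (forall x y : 'I_n.+1, x != y ->
     let f (eta : conf n) :=
       ((eta x)%:R / (alpha S x)%:R - profile S mu x)
       * ((eta y)%:R / (alpha S y)%:R - profile S mu y) in
     [/\ integrable_pmf S mu f,
         sigma S = -1 -> expect S mu f < 0
       & sigma S = 1 -> 0 < expect S mu f]).
Proof.
set th := profile S mu.
have hth x : in_Theta (sigma S) (th x) by exact: (profile_Theta hS hsigma hL hR hp hmu).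
split.
- move=> [b l r] hb te2 n0 hl hr t t0 law F.
  pose xi : dconf n := (b, (l, r)); pose K := dsize xi.
  have hxi : xi \in dconfs S K by apply/dconfsP.
  have hlaw s : 0 <= s ->
      (\esum_(zeta in states S) (dual_fun S xi zeta * law s zeta)%:E =
       (dsg S K s (profile_fun S th) xi)%:E)%E.
    move=> s0; apply: (esum_dual_law hS hsigma hp hxi s0).
    + by move=> eta _; exact: local_equilibrium_ge0.
    (* The empty dual configuration has duality function 1, so its moment is the total mass. *)
    + have := @esum_local_equilibrium _ _ S hS hsigma th hth ([ffun=> 0%N], (0%N, 0%N)).
      have -> : profile_fun S th ([ffun=> 0%N], (0%N, 0%N)) = 1.
        by rewrite /profile_fun /= !expr0 !mul1r big1// => x _; rewrite ffunE.
      move=> <-; last by move=> _ x; rewrite ffunE.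
      apply: le_esum => eta _; rewrite dual_fun_no_bulk ?expr0 ?mulr1 ?mul1r//.
      by rewrite /tot big1// => x _; rewrite ffunE.
    + by move=> xi' /dconfsP[hxi' _]; exact: esum_local_equilibrium.
  have lawP s : 0 <= s -> integrable_pmf S (law s) (dual_fun S xi) /\
      F s = dsg S K s (profile_fun S th) xi.
    move=> s0; apply: expect_ge0; last exact: hlaw.
    move=> eta he; rewrite mulr_ge0 ?dual_fun_ge0// /law /law_at fine_ge0// esum_ge0//.
    move=> zeta hz; rewrite lee_fin mulr_ge0 ?(trans_ge0 hp)//.
    exact: local_equilibrium_ge0.
  have dsgF : is_derive t 1 F (dsg S K t (jgen (drate S) (@dmove n) (profile_fun S th)) xi).
    (* [F] is identified with the dual semigroup at nonnegative times only, which covers a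
       neighbourhood of t > 0. *)
    apply: (@near_eq_is_derive _ _ _ (fun s => dsg S K s (profile_fun S th) xi)).
      near=> s; have [|_ ->//] := lawP s.
      by apply: ltW; near: s; exact: lt_nbhsr.
    apply: jsg_derive => //; first by move=> *; exact: (drate_ge0 hS hsigma (K := K)).
    by move=> *; exact: (dmove_dconfs hS hsigma).
  have dF : F^`()%classic t = dsg S K t (jgen (drate S) (@dmove n) (profile_fun S th)) xi.
    by rewrite derive1E; have [_ ->] := dsgF.
  have pos := dsg_jgen_profile_gt0 hS hsigma hL hR hp hmu htheta hxi te2 n0 hl hr t0.
  split.
  + exact: (lawP t (ltW t0)).1.
  + by have [] := dsgF.
  + by move=> s; rewrite dF; move: pos; rewrite s mulN1r oppr_gt0.
  + by move=> s; rewrite dF; move: pos; rewrite s mul1r.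
- move=> x y xNy f.
  have n0 : (0 < n)%N.
    apply: contraNT xNy; rewrite -eqn0Ngt => /eqP n0; apply/eqP/val_inj => /=.
    by have := ltn_ord x; have := ltn_ord y; lia.
  pose b : conf n := [ffun z => (delta1 x z + delta1 y z)%N].
  have tb : tot b = 2%N.
    rewrite /tot; under eq_bigr do rewrite ffunE.
    by rewrite big_split/= -/(tot _) -/(tot _) !tot_delta1.
  have hb : states S b.
    move=> s z; rewrite !ffunE; have [->|zx] := eqVneq z x.
      by rewrite (negbTE xNy) addn0 (alpha_gt0 hS).
    by case: eqP => // _; rewrite (alpha_gt0 hS).
  (* One dual particle at x and one at y: the duality function is the product of the two densities,
     and [phi] is [th x * th y]. *)
  pose xi : dconf n := (b, (0%N, 0%N)).
  have hxi : xi \in dconfs S 2 by apply/dconfsP; rewrite /dsize /= tb.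
  pose v z (eta : conf n) := (eta z)%:R / (alpha S z)%:R : R.
  have DE eta : dual_fun S xi eta = v x eta * v y eta.
    have yNx : y != x by rewrite eq_sym.
    rewrite (dual_fun2 S _ _ xNy) /= !expr0 !mul1r !ffunE !eqxx (negbTE xNy) (negbTE yNx).
    rewrite /dual_rest big1 ?mulr1; first by rewrite addn0 add0n !(site1 hS hsigma).
    by move=> z /andP[/negbTE zx /negbTE zy]; rewrite !ffunE zx zy (site0 hsigma).
  have m0 := stationary_ge0 hmu.
  have v0 z eta : 0 <= v z eta by rewrite divr_ge0.
  have th0 z : 0 <= th z by have [] := hth z.
  have vE z : (\esum_(eta in states S) (v z eta * mu eta)%:E = (th z)%:E)%E.
    rewrite /th (profile_moment hS hsigma hL hR hp hmu).
    rewrite -(momentE hS hsigma hL hR hp hmu (dconfs1_delta1 hS z)).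
    by apply: eq_esum => eta _; rewrite (dual_fun_delta1 hS hsigma).
  have phiE : profile_fun S th xi = th x * th y.
    have yNx : y != x by rewrite eq_sym.
    rewrite /profile_fun /= !expr0 !mul1r (bigD1 x)//= (bigD1 y)//= big1 => [|z].
      by rewrite !ffunE !eqxx (negbTE xNy) (negbTE yNx) addn0 add0n !expr1 mulr1.
    by move=> /andP[/negbTE zx /negbTE zy]; rewrite !ffunE zx zy.
  (* The centred product is split into its positive and its negative terms; the difference of their
     expectations is [moment S mu xi - th x * th y]. *)
  have [|||||fint fE] := @expectB _ _ S mu f
      (fun eta => v x eta * v y eta + th x * th y)
      (fun eta => th y * v x eta + th x * v y eta)
      (moment S mu xi + th x * th y) (th x * th y + th x * th y).
  + by move=> eta he; rewrite mulr_ge0 ?m0// addr_ge0// mulr_ge0.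
  + by move=> eta he; rewrite mulr_ge0 ?m0// addr_ge0// mulr_ge0.
  + rewrite (eq_esum (b := fun eta : conf n => ((dual_fun S xi eta * mu eta)%:E +
        ((th x * th y)%:E * (mu eta)%:E))%E)); last first.
      by move=> eta _; rewrite DE -EFinM -EFinD mulrDl.
    rewrite esumD; last 2 first.
    * by move=> eta he; rewrite lee_fin DE !mulr_ge0 ?m0.
    * by move=> eta he; rewrite -EFinM lee_fin !mulr_ge0 ?m0.
    rewrite (momentE hS hsigma hL hR hp hmu hxi) esumZl ?mulr_ge0//.
    by rewrite (stationary_sum1 hmu) mule1.
  + rewrite (eq_esum (b := fun eta : conf n => ((th y)%:E * (v x eta * mu eta)%:E +
        ((th x)%:E * (v y eta * mu eta)%:E))%E)); last first.
      by move=> eta _; rewrite -!EFinM -EFinD; congr (_%:E); ring.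
    rewrite esumD; last 2 first.
    * by move=> eta he; rewrite -EFinM lee_fin !mulr_ge0 ?m0.
    * by move=> eta he; rewrite -EFinM lee_fin !mulr_ge0 ?m0.
    rewrite !esumZl//; last 2 first.
    * by move=> eta he; rewrite lee_fin mulr_ge0 ?m0.
    * by move=> eta he; rewrite lee_fin mulr_ge0 ?m0.
    by rewrite !vE -!EFinM -EFinD mulrC.
  + by move=> eta; rewrite /f -/(v x eta) -/(v y eta); ring.
  have := moment_profile_lt hS hsigma hL hR hp hmu htheta hxi _ n0 (fun _ => erefl) (fun _ => erefl).
  rewrite tb phiE => /(_ isT) lt.
  split => // s; rewrite fE; move: lt; rewrite s ?mulN1r ?mul1r; lra.
Unshelve. all: by end_near. Qed.
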